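(* Suppose $N$ is even and $m$ is odd. For $k\ge1$ let $a_k$ (respectively $b_k$) be the dimension of the Hodge degree $k$ part of the defect $0$ homology $H_0$ (respectively defect $1$ homology $H_1$) of the two-loop hairy graph-complex $0\to\mathcal C_2\to\mathcal C_1\to\mathcal C_0\to 0$ with rational coefficients. Then $$a_k=\begin{cases}0& k\equiv0,1\bmod4,\\ \lfloor\frac{k+1}{12}\rfloor & k\equiv3\bmod4,\\ \lceil\frac{k}{12}\rceil & k\equiv2\bmod4,\end{cases}\qquad b_k=\begin{cases}0& k\equiv2,3\bmod4,\\ \lfloor\frac{k}{12}\rfloor & k\equiv1\bmod4,\\ \lceil\frac{k}{12}\rceil & k\equiv0\bmod4.\end{cases}$$
   Context: Let $m,N$ be positive integers; all coefficients are in $\mathbb Q$. Graph-complex $\mathcal E^{m,N}_\pi$. It is spanned by connected graphs (self-loops and multiple edges allowed) with a non-empty finite set of unlabeled external vertices of valence $1$ and a possibly empty finite set of unlabeled internal vertices of valence $\ge3$. The orientation set of a graph is the union of its external vertices (each of degree $-m$), internal vertices (each of degree $-N$) and edges (each of degree $N-1$). An orientation of a graph is a total order of its orientation set together with an orientation of every edge. Isomorphic oriented graphs (isomorphism respecting adjacency, edge orientations and the order) are identified. One takes the quotient of the $\mathbb Q$-vector space spanned by isomorphism classes of oriented graphs by the relations: reversing the orientation of one edge multiplies by $(-1)^N$; permuting the orientation set multiplies by the Koszul sign of the permutation, computed from the degrees of the elements. The differential $\partial\Upsilon$ is the sum, over all internal vertices $v$ and all unordered partitions of the half-edges at $v$ into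 two sets of size $\ge2$, of the graph obtained by replacing $v$ by a new edge joining two vertices, the half-edges of one set being attached to one endpoint and those of the other set to the other endpoint; one endpoint is regarded as the old vertex $v$, the other one as the new vertex; the new vertex and the new edge are added as the first and second elements of the ordered orientation set, and the new edge is oriented from the old vertex to the new one (the choice of which endpoint is new does not matter). Hairy graphs. An edge of a connected graph is tree-type if removing it disconnects the graph into two parts, exactly one of which is a tree. The frame is the subgraph generated by the edges that are not tree-type. A hair is a tree-type edge one of whose endpoints is univalent and whose other endpoint lies in the frame and has no other tree-type edges adjacent to it. A vertex is a cut vertex if removing it (as a point of the topological space) disconnects the graph. A two-loop hairy graph is a connected graph (self-loops and multiple edges allowed) with a non-empty finite set of unlabeled external vertices of valence $1$ and a finite set of unlabeled internal vertices of valence $\ge3$, of first Betti number $2$, whose frame has no cut vertices and all of whose tree-type edges are hairs; its frame is a (subdivided) $\Theta$-graph. The Hodge degree is the number of external vertices (i.e. of hairs). The defect is $\sum_v(|v|-3)$ over the internal vertices $v$, where $|v|$ is the valence; for two-loop hairy graphs it is $0$, $1$ or $2$. Let $\mathcal C_i\subset\mathcal E^{m,N}_\pi$ be the span of the two-loop hairy graphs of defect $i$. The differential $\partial$ preserves Hodge degree and lowers the defect by $1$, giving the two-loop hairy graph-complex $0\to\mathcal C_2\xrightarrow{\partial_2}\mathcal C_1\xrightarrow{\partial_1}\mathcal C_0\to0$, with $H_i=\ker\partial_i/\operatorname{im}\partial_{i+1}$. *)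

(* Defs.v *)
From HB Require Import structures.
From mathcomp Require Import all_boot all_order all_algebra finmap.
From mathcomp Require Import monalg.

Set Implicit Arguments.
Unset Strict Implicit.
Unset Printing Implicit Defensive.

Import GRing.Theory.
Local Open Scope ring_scope.

(* 'I_h : external vertices, 'I_n : internal vertices, 'I_e : edges. *)
Notation vertex h n := ('I_h + 'I_n)%type.

(* The cells of a graph as a one-dimensional complex.  The cells are also the
   elements of the orientation set. *)
Notation cell h n e := (vertex h n + 'I_e)%type.

(* Each edge is sent to the pair (source, target); an edge may have equal
   source and target, and several edges may have the same endpoints. *)
Notation graph h n e := {ffun 'I_e -> vertex h n * vertex h n}.

(* (f, false) is the half-edge at the source of f, (f, true) the one at its
   target. *)
Notation halfedge e := ('I_e * bool)%type.

Section Graph.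
Variables h n e : nat.
Implicit Types (g : graph h n e) (A : {set cell h n e}).

Definition endpoint g (x : halfedge e) : vertex h n :=
  if x.2 then (g x.1).2 else (g x.1).1.

(* A self-loop contributes two half-edges, hence 2 to the valence. *)
Definition star g (v : vertex h n) : {set halfedge e} :=
  [set x | endpoint g x == v].
Definition valence g v : nat := #|star g v|.

Definition incident g (v : vertex h n) (f : 'I_e) : bool :=
  (v == (g f).1) || (v == (g f).2).

(* A set A of cells stands for the union of its vertices and open edges, as a
   subspace of the topological realization of g; an edge in A whose endpoints
   are not in A is then a path component of its own. *)
Definition adj g A : rel (cell h n e) := fun c d =>
  [&& c \in A, d \in A &
      match c, d with
      | inl v, inr f | inr f, inl v => incident g v f
      | _, _ => false
      end].

Definition connected g A : bool :=
  [forall c in A, forall d in A, connect (adj g A) c d].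

(* First Betti number; meant for sets A containing the endpoints of their
   edges, for which the truncated subtraction is harmless. *)
Definition betti1 g A : nat :=
  (#|[set f : 'I_e | inr f \in A]| + n_comp (adj g A) A
   - #|[set v : vertex h n | inl v \in A]|)%N.

Definition is_tree g A : bool := connected g A && (betti1 g A == 0%N).

Definition tree_edge g (f : 'I_e) : bool :=
  let A := [set~ inr f] in
  let part (v : vertex h n) := [set c | connect (adj g A) (inl v) c] in
  ~~ connect (adj g A) (inl (g f).1) (inl (g f).2)
  && (is_tree g (part (g f).1) (+) is_tree g (part (g f).2)).

Definition frame g : {set cell h n e} :=
  [set c | match c with
           | inl v => [exists f, ~~ tree_edge g f && incident g v f]
           | inr f => ~~ tree_edge g f
           end].

Definition cut_vertex g A (v : vertex h n) : bool :=
  (inl v \in A) && ~~ connected g (A :\ inl v).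

Definition is_hair g (f : 'I_e) : bool :=
  tree_edge g f &&
  [exists b : bool,
    [&& valence g (endpoint g (f, b)) == 1%N,
        inl (endpoint g (f, ~~ b)) \in frame g &
        [forall f' : 'I_e,
          tree_edge g f' && incident g (endpoint g (f, ~~ b)) f'
          ==> (f' == f)]]].

(* Membership in the spanning set of the graph-complex E_pi^{m,N}. *)
Definition graph_ok g : bool :=
  [&& (0 < h)%N, connected g [set: cell h n e],
      [forall x : 'I_h, valence g (inl x) == 1%N] &
      [forall v : 'I_n, (3 <= valence g (inr v))%N]].

Definition two_loop_hairy_graph g : bool :=
  [&& graph_ok g, betti1 g [set: cell h n e] == 2%N,
      [forall v, ~~ cut_vertex g (frame g) v] &
      [forall f, tree_edge g f ==> is_hair g f]].

Definition defect g : nat := (\sum_(v < n) (valence g (inr v) - 3))%N.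

End Graph.

(* A graph whose edges are oriented by its source/target map, with a total
   order of its orientation set written as a list; that the list enumerates the
   orientation set is required in [admissible]. *)
Record ograph := OGraph {
  n_ext : nat;
  n_int : nat;
  n_edge : nat;
  ends : graph n_ext n_int n_edge;
  orient_order : seq (cell n_ext n_int n_edge)
}.

Section OGraphChoice.
Let code := {s : nat * nat * nat &
  (graph s.1.1 s.1.2 s.2 * seq (cell s.1.1 s.1.2 s.2))%type}.
Let enc (G : ograph) : code :=
  @Tagged _ (n_ext G, n_int G, n_edge G)
    (fun s : nat * nat * nat =>
       (graph s.1.1 s.1.2 s.2 * seq (cell s.1.1 s.1.2 s.2))%type)
    (ends G, orient_order G).
Let dec (c : code) : ograph := OGraph (tagged c).1 (tagged c).2.
Let encK : cancel enc dec. Proof. by case. Qed.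
HB.instance Definition _ := Countable.copy ograph (can_type encK).
End OGraphChoice.

Definition admissible (G : ograph) : bool :=
  [&& graph_ok (ends G), uniq (orient_order G) &
      [forall c, c \in orient_order G]].

Definition cell_map h n e h' n' e' (fx : 'I_h -> 'I_h') (fi : 'I_n -> 'I_n')
    (fe : 'I_e -> 'I_e') (c : cell h n e) : cell h' n' e' :=
  match c with
  | inl (inl x) => inl (inl (fx x))
  | inl (inr v) => inl (inr (fi v))
  | inr f => inr (fe f)
  end.

Definition vertex_map h n h' n' (fx : 'I_h -> 'I_h') (fi : 'I_n -> 'I_n')
    (v : vertex h n) : vertex h' n' :=
  match v with inl x => inl (fx x) | inr w => inr (fi w) end.

Definition oiso (G G' : ograph) : Prop :=
  exists (fx : 'I_(n_ext G) -> 'I_(n_ext G'))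
         (fi : 'I_(n_int G) -> 'I_(n_int G'))
         (fe : 'I_(n_edge G) -> 'I_(n_edge G')),
    [/\ bijective fx, bijective fi, bijective fe,
        forall f, ends G' (fe f) = (vertex_map fx fi (ends G f).1,
                                    vertex_map fx fi (ends G f).2)
      & orient_order G' = map (cell_map fx fi fe) (orient_order G)].

Definition flip (G : ograph) (f : 'I_(n_edge G)) : ograph :=
  OGraph [ffun f' => if f' == f then ((ends G f').2, (ends G f').1)
                     else ends G f'] (orient_order G).

Definition reorder (G : ograph) (t : seq (cell (n_ext G) (n_int G) (n_edge G))) :=
  OGraph (ends G) t.

Definition cell_degree (m N : nat) h n e (c : cell h n e) : int :=
  match c with
  | inl (inl _) => - m%:Z
  | inl (inr _) => - N%:Z
  | inr _ => N%:Z - 1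
  end.

(* Koszul sign of the permutation rearranging s into t: the product of
   (-1)^(|c||d|) over the pairs c, d whose relative order is reversed. *)
Definition koszul (m N : nat) h n e (s t : seq (cell h n e)) : rat :=
  \prod_(c : cell h n e)
    \prod_(d : cell h n e | (index c s < index d s)%N
                            && (index d t < index c t)%N)
      (-1) ^ (cell_degree m N c * cell_degree m N d).

(* Free vector space on the oriented graphs; E_pi^{m,N} is the quotient of the
   span of the admissible ones by [zero_class]. *)
Notation chain := {malg rat[ograph]}.

Definition gen (G : ograph) : chain := << 1 *g G >>.

Inductive relator (m N : nat) : chain -> Prop :=
| RelIso G G' : admissible G -> oiso G G' ->
    relator m N (gen G' - gen G)
| RelFlip G (f : 'I_(n_edge G)) : admissible G ->
    relator m N (gen (flip f) - (-1) ^+ N *: gen G)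
| RelOrder G (t : seq (cell (n_ext G) (n_int G) (n_edge G))) : admissible G ->
    perm_eq t (orient_order G) ->
    relator m N (gen (reorder t) - koszul m N (orient_order G) t *: gen G).

Definition zero_class (m N : nat) (x : chain) : Prop :=
  exists (r : nat) (c : 'I_r -> rat) (y : 'I_r -> chain),
    (forall i, relator m N (y i)) /\ x = \sum_i c i *: y i.

(* Replaces the internal vertex v by an edge; the half-edges in B are moved to
   the new vertex, the other ones stay at v.  The new internal vertex and the
   new edge are the elements ord0, the old ones are renumbered by [lift ord0]. *)
Definition split_graph (G : ograph) (v : 'I_(n_int G))
    (B : {set halfedge (n_edge G)}) :
    graph (n_ext G) (n_int G).+1 (n_edge G).+1 :=
  let move (x : halfedge (n_edge G)) : vertex (n_ext G) (n_int G).+1 :=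
    if x \in B then inr ord0
    else vertex_map id (lift ord0) (endpoint (ends G) x) in
  [ffun f => if unlift ord0 f is Some f' then (move (f', false), move (f', true))
             else (inr (lift ord0 v), inr ord0)].

Definition split_at (G : ograph) (v : 'I_(n_int G)) (B : {set halfedge (n_edge G)}) :
    ograph :=
  OGraph (split_graph v B)
    [:: inl (inr ord0), inr ord0
      & map (cell_map id (lift ord0) (lift ord0)) (orient_order G)].

Definition splitting (G : ograph) (v : 'I_(n_int G))
    (P : {set {set halfedge (n_edge G)}}) : bool :=
  [&& partition P (star (ends G) (inr v)), #|P| == 2%N &
      [forall B in P, (2 <= #|B|)%N]].

(* The block whose half-edges go to the new vertex is an arbitrary one of the
   two: modulo [zero_class] the result does not depend on it. *)
Definition moved_block e (P : {set {set halfedge e}}) : {set halfedge e} :=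
  odflt set0 [pick B in P].

Definition diff_gen (G : ograph) : chain :=
  \sum_(v < n_int G) \sum_(P | splitting v P) gen (split_at v (moved_block P)).

Definition diff (x : chain) : chain :=
  \sum_(G <- msupp x) x@_G *: diff_gen G.

(* Representatives of the elements of the Hodge degree k part of C_i. *)
Definition hairy_chain (i k : nat) (x : chain) : Prop :=
  forall G : ograph, G \in msupp x ->
    [/\ admissible G, two_loop_hairy_graph (ends G), defect (ends G) = i
      & n_ext G = k].

(* On defect 0 chains [diff] vanishes, as all internal vertices are trivalent,
   so that all of C_0 consists of cycles. *)
Definition hairy_cycle (m N i k : nat) (x : chain) : Prop :=
  hairy_chain i k x /\ zero_class m N (diff x).

Definition hairy_boundary (m N i k : nat) (x : chain) : Prop :=
  exists2 y, hairy_chain i.+1 k y & zero_class m N (x - diff y).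

(* The subspace Z modulo B has dimension d: some family of d elements of Z
   induces a basis of the quotient. *)
Definition quotient_dim (V : lmodType rat) (Z B : V -> Prop) (d : nat) : Prop :=
  exists x : 'I_d -> V,
    [/\ forall j, Z (x j),
        forall c : 'I_d -> rat, B (\sum_j c j *: x j) -> forall j, c j = 0
      & forall z, Z z -> exists c : 'I_d -> rat, B (z - \sum_j c j *: x j)].

(* The Hodge degree k part of H_i has dimension d. *)
Definition hairy_homology_dim (m N i k d : nat) : Prop :=
  quotient_dim (hairy_cycle m N i k) (hairy_boundary m N i k) d.

Definition ceil_div (a b : nat) : nat := ((a + b.-1) %/ b)%N.

(* Main.v *)
(* After the choice of its two end vertices, a two-loop hairy graph is a
   Theta-graph given by the numbers P, Q, R of edges on its three strands and by
   the presence of a hair at each end vertex; the inner vertices of the strands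
   carry one hair each.  For N even and m odd the graph vanishes in the quotient
   iff two odd strands have equal length, or it has equally decorated end
   vertices and 'C(P, 2) + 'C(Q, 2) + 'C(R, 2) is odd.  Hence C_i has a basis of
   sorted triples, and the differential adds 1 to P, Q or R with signs.

   Ordering triples by their largest entry, the map "add 1 to the largest entry"
   makes the matrix of C_2 -> C_1 triangular, so this map is injective, and, with
   a few exceptional triples, it exhibits a maximal triangular part of
   C_1 -> C_0.  The unmatched triples are close to (2 j, 2 j, z); for k = 2, 3
   modulo 4 they have defect 0, for k = 0, 1 defect 1, and the dimension of the
   homology is their number. *)
From mathcomp Require Import all_boot all_order all_algebra finmap.
From mathcomp Require Import monalg zify ring boolp.
Require Import Defs.
Set Implicit Arguments.
Unset Strict Implicit.
Unset Printing Implicit Defensive.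
Import GRing.Theory.
Local Open Scope ring_scope.

(** The relators readily show that classes agree, but not that they differ. Nonvanishing comes from
    linear forms, one per sorted triple, defined on all chains and zero on every relator. They exist
    because a parametrization of a graph is unique up to permuting strands and hairs and exchanging
    the end vertices, so that an orientation has an invariant sign. For the existence of a
    parametrization, the topological conditions (tree-type edges, hairs, cut vertices) have to be
    turned into three explicit walks.

    The period 4 has its origin in the parity of 'C(x, 2), which is that of (x - odd x) / 2: for
    fixed k, the nonvanishing condition in defects 0 and 2 prescribes the number of odd strands
    through k mod 4. For k = 2, 3 modulo 4 the map C_1 -> C_0 need not be onto; its rank is then
    bounded from above by the vanishing of C_2 -> C_1 -> C_0. The constant 12 arises as 1/4 - 1/6 =
    1/12: in an unmatched triple near (2 j, 2 j, z), positivity of z bounds j by about k / 4 from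
    above, and sortedness bounds it by about k / 6 from below. *)

(** * Congruence of chains modulo the relators, and linear extension *)

Section ZeroClass.
Variables m N : nat.

Lemma zero_class0 : zero_class m N 0.
Proof.
by exists 0%N, (fun _ => 0), (fun _ => 0); split; [case|rewrite big_ord0].
Qed.

Lemma zero_class_rel x : relator m N x -> zero_class m N x.
Proof.
move=> rx; exists 1%N, (fun _ => 1), (fun _ => x); split=> //.
by rewrite big_ord1 scale1r.
Qed.

Lemma zero_classZ c x : zero_class m N x -> zero_class m N (c *: x).
Proof.
case=> r [d [y [ry ->]]]; exists r, (fun i => c * d i), y; split=> //.
by rewrite scaler_sumr; apply: eq_bigr => i _; rewrite scalerA.
Qed.

Lemma zero_classD x y :
  zero_class m N x -> zero_class m N y -> zero_class m N (x + y).
Proof.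
case=> r [d [z [rz ->]]] [r' [d' [z' [rz' ->]]]].
exists (r + r')%N, (fun i => match split i with inl j => d j | inr j => d' j end),
  (fun i => match split i with inl j => z j | inr j => z' j end); split.
  by move=> i; case: (split i).
rewrite big_split_ord /=; congr (_ + _); apply: eq_bigr => i _.
  by rewrite (unsplitK (inl i)).
by rewrite (unsplitK (inr i)).
Qed.

Lemma zero_classN x : zero_class m N x -> zero_class m N (- x).
Proof. by move=> /(zero_classZ (-1)); rewrite scaleN1r. Qed.

Lemma zero_class_sum (I : eqType) (s : seq I) (P : pred I) (F : I -> chain) :
  (forall i, i \in s -> P i -> zero_class m N (F i)) ->
  zero_class m N (\sum_(i <- s | P i) F i).
Proof.
move=> zF; rewrite big_seq_cond.
elim/big_ind: _ => [|x y|i /andP[]]; [exact: zero_class0|exact: zero_classD|exact: zF].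
Qed.

Definition ceq (x y : chain) : Prop := zero_class m N (x - y).

Lemma ceq_refl x : ceq x x.
Proof. by rewrite /ceq subrr; apply: zero_class0. Qed.

Lemma ceq_sym x y : ceq x y -> ceq y x.
Proof. by move=> /zero_classN; rewrite opprB. Qed.

Lemma ceq_trans y x z : ceq x y -> ceq y z -> ceq x z.
Proof. by move=> xy /(zero_classD xy); rewrite addrA subrK. Qed.

Lemma ceqD x y x' y' : ceq x y -> ceq x' y' -> ceq (x + x') (y + y').
Proof. by move=> xy /(zero_classD xy); rewrite addrACA -opprD. Qed.

Lemma ceqZ c x y : ceq x y -> ceq (c *: x) (c *: y).
Proof. by move=> /(zero_classZ c); rewrite scalerBr. Qed.

Lemma ceq_sum (I : eqType) (s : seq I) (P : pred I) (F F' : I -> chain) :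
  (forall i, i \in s -> P i -> ceq (F i) (F' i)) ->
  ceq (\sum_(i <- s | P i) F i) (\sum_(i <- s | P i) F' i).
Proof. by move=> FF; rewrite /ceq -sumrB; apply: zero_class_sum. Qed.

Lemma ceq_zero x y : ceq x y -> zero_class m N y -> zero_class m N x.
Proof. by move=> xy /(zero_classD xy); rewrite subrK. Qed.

End ZeroClass.

Section LinearExtension.
Variable V : lmodType rat.
Variable f : ograph -> V.

(** [diff] is convertible to [lext diff_gen], and the coordinate forms are [lext] with values in
    [rat^o], so that linearity is proved once for both. *)
Definition lext (x : chain) : V := \sum_(G <- msupp x) x@_G *: f G.

Lemma lext_sub (x : chain) (A : {fset ograph}) :
  (msupp x `<=` A)%fset -> lext x = \sum_(G <- A) x@_G *: f G.
Proof.
move=> sA; rewrite /lext (big_fset_incl _ sA) // => G _ /mcoeff_outdom ->.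
by rewrite scale0r.
Qed.

Lemma lextD x y : lext (x + y) = lext x + lext y.
Proof.
pose A := (msupp x `|` msupp y)%fset.
rewrite (@lext_sub x A) ?fsubsetUl // (@lext_sub y A) ?fsubsetUr //.
rewrite (@lext_sub _ A) ?msuppD_le // -big_split /=.
by apply: eq_bigr => G _; rewrite mcoeffD scalerDl.
Qed.

Lemma lextZ c x : lext (c *: x) = c *: lext x.
Proof.
rewrite (@lext_sub (c *: x) (msupp x)) ?msuppZ_le // /lext scaler_sumr.
by apply: eq_bigr => G _; rewrite mcoeffZ scalerA.
Qed.

Lemma lext0 : lext 0 = 0.
Proof. by rewrite /lext msupp0 big_seq_fset0. Qed.

Lemma lextB x y : lext (x - y) = lext x - lext y.
Proof. by rewrite -(scaleN1r y) lextD lextZ scaleN1r. Qed.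

Lemma lext_sum (I : Type) (s : seq I) (P : pred I) (F : I -> chain) :
  lext (\sum_(i <- s | P i) F i) = \sum_(i <- s | P i) lext (F i).
Proof. by elim/big_rec2: _ => [|i x y _ <-]; [exact: lext0|exact: lextD]. Qed.

Lemma lext_gen G : lext (gen G) = f G.
Proof.
by rewrite (@lext_sub _ [fset G]%fset) ?msuppU_le // big_seq_fset1 mcoeffUU scale1r.
Qed.

End LinearExtension.

(** * Inversion signs *)

(** [xorb] proves identities between sums modulo 2: summands that are not variables are generalized,
    then all variables are destructed. *)
Ltac xor_atom x :=
  lazymatch x with
  | addb _ _ => fail
  | true => fail
  | false => fail
  | _ => tryif is_var x then fail else (let v := fresh "v" in generalize x; intro v)
  end.

Ltac xorb :=
  repeat match goal with
  | |- context [addb ?x ?y] => first [xor_atom x | xor_atom y]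
  | |- @eq bool ?x ?y => first [xor_atom x | xor_atom y]
  end;
  repeat match goal with
  | |- context [addb ?x ?y] => first [is_var x; destruct x | is_var y; destruct y]
  | |- @eq bool ?x ?y => first [is_var x; destruct x | is_var y; destruct y]
  end; reflexivity.

Section InversionSign.
Variable T : eqType.
Implicit Types (r : T -> nat) (s t : seq T).

Fixpoint inv_parity r s : bool :=
  if s is x :: s' then odd (count (fun y => r y < r x)%N s') (+) inv_parity r s'
  else false.

(** Inversions of a concatenation lie inside one of the two parts or between them; only the latter
    depend on the relative position of the parts. *)
Fixpoint cross_parity r s t : bool :=
  if s is x :: s' then odd (count (fun y => r y < r x)%N t) (+) cross_parity r s' t
  else false.

Lemma inv_parity_cat r s t : inv_parity r (s ++ t) = inv_parity r s (+) inv_parity r t (+) cross_parity r s t.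
Proof.
elim: s => [|x s /= ->]; first by rewrite /= addbF.
by rewrite count_cat oddD; xorb.
Qed.

Lemma cross_parity_catl r s1 s2 t : cross_parity r (s1 ++ s2) t = cross_parity r s1 t (+) cross_parity r s2 t.
Proof. by elim: s1 => //= x s1 ->; rewrite addbA. Qed.

Lemma cross_parity_catr r s t1 t2 : cross_parity r s (t1 ++ t2) = cross_parity r s t1 (+) cross_parity r s t2.
Proof. by elim: s => //= x s ->; rewrite count_cat oddD addbACA. Qed.

Lemma cross_parity_consr r s x t :
  cross_parity r s (x :: t) = odd (count (fun y => r x < r y)%N s) (+) cross_parity r s t.
Proof.
elim: s => //= y s ->; rewrite !oddD; by xorb.
Qed.

Lemma cross_parity_perml r s1 s2 t : perm_eq s1 s2 -> cross_parity r s1 t = cross_parity r s2 t.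
Proof.
by apply: (catCA_perm_subst (F := fun s => cross_parity r s t)) => a b c;
  rewrite !cross_parity_catl addbCA.
Qed.

Lemma cross_parity_permr r s t1 t2 : perm_eq t1 t2 -> cross_parity r s t1 = cross_parity r s t2.
Proof. by elim: s => //= x s IH p; rewrite IH // (permP p). Qed.

Lemma count_lt_gt r x s : {in s, forall y, r x != r y} ->
  (count (fun y => r y < r x) s + count (fun y => r x < r y) s = size s)%N.
Proof.
elim: s => //= y s IH H; rewrite -IH; last by move=> z zs; apply: H; rewrite inE zs orbT.
by have := H y (mem_head _ _); lia.
Qed.

(** A pair with one element in each block is an inversion for exactly one of the two orders of the
    blocks. *)
Lemma cross_parityC r s t : {in s & t, forall x y, r x != r y} ->
  cross_parity r t s = cross_parity r s t (+) (odd (size s) && odd (size t)).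
Proof.
elim: s => [|x s IH] H /=; first by elim: t {H}.
rewrite cross_parity_consr IH; last by move=> y z ys; apply: H; rewrite inE ys orbT.
have := @count_lt_gt r x t (fun y => H x y (mem_head _ _)).
move/(congr1 odd); rewrite oddD => <-.
by case: (odd (size s)); rewrite /= ?andbF; xorb.
Qed.

Definition rinj r s := {in s &, forall x y, x != y -> r x != r y}.

Lemma inv_parity_swap r s t : uniq (s ++ t) -> rinj r (s ++ t) ->
  inv_parity r (t ++ s) = inv_parity r (s ++ t) (+) (odd (size s) && odd (size t)).
Proof.
rewrite cat_uniq => /and3P[_ /hasPn st _] rI; rewrite !inv_parity_cat cross_parityC.
  by rewrite (addbC (inv_parity r t)) addbA.
move=> x y xs yt; apply: rI; rewrite ?mem_cat ?xs ?yt ?orbT //.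
by apply: contraTneq xs => ->; apply: st.
Qed.

Lemma inv_parity_rev r s : uniq s -> rinj r s ->
  inv_parity r (rev s) = inv_parity r s (+) odd 'C(size s, 2).
Proof.
elim: s => // x s IH /= /andP[xs us] rI.
rewrite rev_cons -cats1 inv_parity_cat IH //; last first.
  by move=> y z ys zs; apply: rI; rewrite inE (ys, zs) orbT.
have rx y : y \in s -> r x != r y.
  move=> ys; apply: rI; rewrite ?mem_head ?inE ?ys ?orbT //.
  by apply: contraNneq xs => ->.
rewrite /= (cross_parity_perml r _ (permEl (perm_rev s))) (@cross_parityC r [:: x] s) /=; last first.
  by move=> y z; rewrite inE => /eqP ->; apply: rx.
rewrite binS bin1 oddD !addbF.
by rewrite /=; xorb.
Qed.

End InversionSign.

Section InversionSignSort.
Variable T : eqType.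
Implicit Types (r : T -> nat) (s t l : seq T).

(** Blocks of even size commute without sign. This is applied to the hairs, each of which
    contributes an edge and an external vertex. *)
Lemma inv_parity_flatten_perm (I : eqType) (f : I -> seq T) r (s t : seq I) :
  injective r -> (forall i, ~~ odd (size (f i))) ->
  uniq (flatten (map f s)) -> perm_eq s t ->
  inv_parity r (flatten (map f s)) = inv_parity r (flatten (map f t)).
Proof.
move=> rI ev us st.
(* [catCA_perm_subst] asks for a function invariant without side conditions, so distinctness is made
   part of the value. *)
pose F (u : seq I) := uniq (flatten (map f u)) && inv_parity r (flatten (map f u)).
suff E : F s = F t.
  by move: E; rewrite /F -(perm_uniq (perm_flatten (perm_map f st))) us.
have even_sz u : ~~ odd (size (flatten (map f u))).
  by elim: u => //= i u IH; rewrite size_cat oddD (negbTE (ev i)) (negbTE IH).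
move: st; apply: (catCA_perm_subst (F := F)) => a b c; rewrite /F !map_cat !flatten_cat.
set A := flatten (map f a); set B := flatten (map f b); set C := flatten (map f c).
rewrite (perm_uniq (permEl (perm_catCA A B C))).
case: (boolP (uniq _)) => //=; rewrite catA cat_uniq => /and3P[+ _ _].
rewrite cat_uniq => /and3P[_ /hasPn AB _].
rewrite catA !inv_parity_cat !cross_parity_catl; congr (_ (+) _); last by rewrite addbC.
congr (_ (+) _); rewrite (addbC (inv_parity r A)); congr (_ (+) _).
rewrite (@cross_parityC _ r B A) ?(negbTE (even_sz b)) ?addbF // => x y xb ya.
by apply: contraTneq xb => /rI ->; apply: AB.
Qed.

Lemma inv_parity_map (T' : eqType) (f : T' -> T) r (s : seq T') :
  inv_parity r (map f s) = inv_parity (r \o f) s.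
Proof. by elim: s => //= x s ->; rewrite count_map. Qed.

Lemma eq_isgn_lt r r' s :
  {in s &, forall x y, (r x < r y)%N = (r' x < r' y)%N} -> inv_parity r s = inv_parity r' s.
Proof.
elim: s => //= x s IH H; rewrite IH; last first.
  by move=> y z ys zs; apply: H; rewrite inE ?ys ?zs orbT.
congr (odd _ (+) _); apply: eq_in_count => y ys.
by apply: H; rewrite inE ?eqxx ?ys ?orbT.
Qed.

(** Both sides count modulo 2 the elements of [l] whose order relative to [x] is not the same for
    [r] and [r']. *)
Lemma count_inv r r' x l :
  {in l, forall y, r x != r y} -> {in l, forall y, r' x != r' y} ->
  odd (count (fun d => (r x < r d)%N && (r' d < r' x)%N) l) (+)
  odd (count (fun d => (r d < r x)%N && (r' x < r' d)%N) l) =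
  odd (count (fun d => r d < r x)%N l) (+) odd (count (fun d => r' d < r' x)%N l).
Proof.
elim: l => //= y l IH H H'.
have {IH}E := IH (fun z zl => H z (@mem_behead _ (y :: l) _ zl))
                 (fun z zl => H' z (@mem_behead _ (y :: l) _ zl)).
rewrite !oddD addbACA E [RHS]addbACA; congr (_ (+) _); move: (H y (mem_head _ _)) (H' y (mem_head _ _)).
by case: (ltngtP (r x) (r y)); case: (ltngtP (r' x) (r' y)).
Qed.

(** Every unordered pair on which [r] and [r'] disagree gives one factor -1, and the number of these
    pairs has the parity of the sum of both inversion numbers. *)
Lemma prod_inv r r' l :
  uniq l -> {in l &, injective r} -> {in l &, injective r'} ->
  (\prod_(c <- l) \prod_(d <- l | (r c < r d)%N && (r' d < r' c)%N) (-1) : rat) =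
  (-1) ^+ (inv_parity r l (+) inv_parity r' l).
Proof.
have big_count (P : pred T) s : \prod_(d <- s | P d) (-1) = (-1) ^+ count P s :> rat.
  by rewrite big_const_seq; elim: (count P s) => //= n ->; rewrite exprS.
elim: l => [|x l IH] /=; first by rewrite big_nil.
case/andP=> xl ul rI rI'; rewrite big_cons big_cons !ltnn /=.
rewrite [X in _ * X = _](eq_bigr (fun c =>
    (if (r c < r x)%N && (r' x < r' c)%N then -1 else 1) *
   \prod_(j <- l | (r c < r j)%N && (r' j < r' c)%N) (-1))); last first.
  by move=> c _; rewrite big_cons; case: ifP; rewrite ?mul1r.
rewrite big_split /= -big_mkcond IH //; first last.
- by move=> a b al bl; apply: rI'; rewrite inE ?al ?bl orbT.
- by move=> a b al bl; apply: rI; rewrite inE ?al ?bl orbT.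
rewrite !big_count mulrA -signr_odd -(signr_odd _ (count (fun i => _ && _) _)).
rewrite -!signr_addb; congr (_ ^+ nat_of_bool _).
rewrite count_inv; first by xorb.
- by move=> y yl; apply: contraNneq xl => /rI -> //; rewrite inE ?eqxx ?yl ?orbT.
- by move=> y yl; apply: contraNneq xl => /rI' -> //; rewrite inE ?eqxx ?yl ?orbT.
Qed.

End InversionSignSort.

Section Koszul.
Variables (m N : nat) (N_gt0 : (0 < N)%N) (N_even : ~~ odd N) (m_odd : odd m).
Variables h n e : nat.
Notation cell := (cell h n e).

Definition odd_cell (c : cell) : bool :=
  match c with inl (inr _) => false | _ => true end.

Lemma signrz (z : int) : (-1 : rat) ^ z = (-1) ^+ odd `|z|.
Proof.
by rewrite expN1r signr_odd.
Qed.

Lemma odd_cell_degree (c : cell) : odd `|cell_degree m N c| = odd_cell c.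
Proof.
case: c => [[x|v]|f] /=; rewrite ?abszN ?absz_nat ?m_odd ?(negbTE N_even) //.
by rewrite -predn_int // absz_nat; case: N N_gt0 N_even => //= k _ /negPn.
Qed.

(** Pairs with a cell of even degree contribute 1, so the Koszul sign is the sign of a permutation
    of the odd cells. Through the reference list [l] it becomes a product of two signs, each
    depending on one order only; [l] will be read off from a parametrization. *)
Lemma koszulE (s t : seq cell) (l : seq cell) :
  (forall c, c \in s) -> (forall c, c \in t) -> uniq l -> l =i odd_cell ->
  koszul m N s t = (-1) ^+ (inv_parity (index^~ s) l (+) inv_parity (index^~ t) l).
Proof.
move=> sall tall ul lE.
have iI (u : seq cell) : (forall c, c \in u) -> {in l &, injective (index^~ u)}.
  by move=> uall c d _ _ E; rewrite -(nth_index c (uall c)) E nth_index.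
rewrite -(prod_inv ul (iI s sall) (iI t tall)) /koszul.
rewrite (bigID [pred c | c \in l]) /= [X in _ * X]big1 ?mulr1; last first.
  move=> c cl; rewrite big1 // => d _.
  by rewrite signrz abszM oddM !odd_cell_degree -[odd_cell c]lE (negbTE cl).
rewrite -big_uniq //; apply: eq_big_seq => c cl.
rewrite (bigID [pred d | d \in l]) /= [X in _ * X]big1 ?mulr1; last first.
  move=> d /andP[_ dl].
  by rewrite signrz abszM oddM !odd_cell_degree -[odd_cell d]lE (negbTE dl) andbF.
rewrite [RHS]big_mkcond big_uniq //= -[RHS]big_mkcondr /=; apply: eq_big.
  by move=> d; rewrite andbC.
move=> d /andP[_ dl].
by rewrite signrz abszM oddM !odd_cell_degree -![odd_cell _]lE cl dl.
Qed.

End Koszul.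

Lemma perm_enum_bij (k k' : nat) (f : 'I_k -> 'I_k') :
  bijective f -> perm_eq (map f (enum 'I_k)) (enum 'I_k').
Proof.
move=> [f' fK f'K]; apply: uniq_perm; rewrite ?enum_uniq //.
  by rewrite map_inj_uniq ?enum_uniq //; apply: can_inj fK.
by move=> x; rewrite mem_enum -(f'K x) mem_map ?mem_enum //; apply: can_inj fK.
Qed.

(** * Theta-graphs *)

Section Dart.
Variable e : nat.
Implicit Types (d : halfedge e) (l : seq (halfedge e)).

Definition rdart d : halfedge e := (d.1, ~~ d.2).
Definition rstrand l := rev (map rdart l).

Lemma rdartK : involutive rdart.
Proof. by case=> f b; rewrite /rdart /= negbK. Qed.

Lemma rdart_neq d : rdart d != d.
Proof. by case: d => f b; rewrite /rdart xpair_eqE eqxx /=; case: b. Qed.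

Lemma size_rstrand l : size (rstrand l) = size l.
Proof. by rewrite size_rev size_map. Qed.

Lemma fst_rstrand l : map fst (rstrand l) = rev (map fst l).
Proof. by rewrite /rstrand map_rev -map_comp. Qed.

Lemma rstrand_nil l : (rstrand l == [::]) = (l == [::]).
Proof. by rewrite -!size_eq0 size_rstrand. Qed.

Lemma dart_edge d d' : d.1 = d'.1 -> d' = d \/ d' = rdart d.
Proof.
by case: d d' => f b [f' b'] /= ->; case: b b' => [] [];
  rewrite /rdart /=; auto.
Qed.

End Dart.

Section Theta.
Variables h n e : nat.
Implicit Types (g : graph h n e) (x y u w : vertex h n) (d : halfedge e).
Implicit Types (l hs : seq (halfedge e)) (ls : seq (seq (halfedge e))).

Definition tgt g d := endpoint g (rdart d).

Fixpoint walk g x l y : bool :=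
  if l is d :: l' then (endpoint g d == x) && walk g (tgt g d) l' y else x == y.

Definition inner g l := map (endpoint g) (behead l).

(* A parametrization of a two-loop hairy graph: ls are the three strands of its
   frame, hs its hairs, directed away from the external vertices, and the
   booleans a and b tell whether the end vertices u and w of the strands carry
   a hair. *)
Record theta g u w ls hs (a b : bool) : Prop := Theta {
  th_size : size ls = 3%N;
  th_walk : {in ls, forall l, l != [::] /\ walk g u l w};
  th_int : perm_eq (u :: w :: flatten (map (inner g) ls)) (map inr (enum 'I_n));
  th_edge : perm_eq (map fst (flatten ls ++ hs)) (enum 'I_e);
  th_ext : perm_eq (map (endpoint g) hs) (map inl (enum 'I_h));
  th_hair : perm_eq (map (tgt g) hs)
              (nseq a u ++ nseq b w ++ flatten (map (inner g) ls)) }.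

Lemma walk_src g x l y : l != [::] -> walk g x l y ->
  map (endpoint g) l = x :: inner g l.
Proof. by case: l => // d l _ /= /andP[/eqP ->]. Qed.

Lemma walk_tgt g x l y : l != [::] -> walk g x l y ->
  map (tgt g) l = rcons (inner g l) y.
Proof.
elim: l x => // d [|d' l] IH x _ /=; first by case/andP=> _ /eqP ->.
case/andP=> _ W; have /andP[/eqP E _] := W.
by rewrite [tgt g d' :: _](IH (tgt g d)) //= E.
Qed.

Lemma walk_cat g x l l' y :
  walk g x (l ++ l') y = walk g x l (last x (map (tgt g) l)) &&
                         walk g (last x (map (tgt g) l)) l' y.
Proof.
by elim: l x => /= [|d l IH] x; rewrite ?eqxx // IH andbA.
Qed.

Lemma walk_last g x l y : walk g x l y -> last x (map (tgt g) l) = y.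
Proof. by elim: l x => [|d l IH] x /= => [/eqP|/andP[_ /IH]]. Qed.

Lemma walk_rev g x l y : walk g x l y -> walk g y (rstrand l) x.
Proof.
elim: l x => [|d l IH] x /=; first by rewrite eq_sym.
case/andP=> /eqP dx /IH; rewrite /rstrand map_cons rev_cons -cats1 walk_cat => W.
by rewrite (walk_last W) W /= eqxx /tgt rdartK dx /=.
Qed.

Lemma inner_rev g x l y : l != [::] -> walk g x l y ->
  inner g (rstrand l) = rev (inner g l).
Proof.
move=> l0 W; rewrite /inner -[map _ (behead _)]behead_map /rstrand map_rev -map_comp.
by rewrite [map _ l](walk_tgt l0 W) rev_rcons.
Qed.

Lemma theta_perm g u w ls ls' hs hs' a b : perm_eq ls ls' -> perm_eq hs hs' ->
  theta g u w ls hs a b -> theta g u w ls' hs' a b.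
Proof.
move=> pls phs [Ts Tw Ti Te Tx Th].
have pI : perm_eq (flatten (map (inner g) ls)) (flatten (map (inner g) ls')).
  exact/perm_flatten/perm_map.
split.
- by rewrite -(perm_size pls).
- by move=> l; rewrite -(perm_mem pls); apply: Tw.
- by apply: perm_trans Ti; rewrite !perm_cons perm_sym.
- apply: perm_trans Te; rewrite perm_sym perm_map // perm_cat //.
  exact: perm_flatten.
- by apply: perm_trans Tx; rewrite perm_sym perm_map.
- apply: perm_trans (perm_trans Th _); first by rewrite perm_sym perm_map.
  by rewrite !perm_cat2l.
Qed.

Lemma theta_flip g u w ls hs a b :
  theta g u w ls hs a b -> theta g w u (map (@rstrand e) ls) hs b a.
Proof.
case=> [Ts Tw Ti Te Tx Th].
have pI : perm_eq (flatten (map (inner g) (map (@rstrand e) ls)))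
                  (flatten (map (inner g) ls)).
  have : {in ls, forall l, l != [::] /\ walk g u l w} by [].
  elim: (ls) => //= l s IH H; apply: perm_cat; last first.
    by apply: IH => l' l's; apply: H; rewrite inE l's orbT.
  by have [l0 W] := H l (mem_head _ _); rewrite (inner_rev l0 W) perm_rev.
split=> //; first by rewrite size_map.
- move=> _ /mapP[l lls ->]; rewrite rstrand_nil.
  by have [-> /walk_rev ->] := Tw l lls.
- apply: perm_trans Ti; apply: perm_trans (permEl (perm_catCA [:: w] [:: u] _)) _.
  by rewrite !perm_cons.
- apply: perm_trans Te; rewrite !map_cat perm_cat2r.
  by elim: (ls) => //= l s IH; rewrite !map_cat fst_rstrand perm_cat // perm_rev.
- by apply: (perm_trans Th); rewrite perm_catCA !perm_cat2l perm_sym.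
Qed.

(* As N is even and m is odd, exactly the edges and the external vertices have
   odd degree, so that only their relative order matters.  A hair contributes
   two adjacent odd elements, hence the order of the hairs is irrelevant. *)
Definition orient_list g ls hs : seq (cell h n e) :=
  map (fun d => inr d.1) (flatten ls) ++
  flatten (map (fun d => [:: inr d.1; inl (endpoint g d)]) hs).

Lemma sgl_perm g ls hs :
  perm_eq (orient_list g ls hs)
    (map inr (map fst (flatten ls ++ hs)) ++ map inl (map (endpoint g) hs)).
Proof.
rewrite /orient_list !map_cat -!map_comp -catA perm_cat2l.
elim: hs => //= d hs IH; rewrite perm_cons -cat1s -[_ :: map _ _]cat1s.
by rewrite perm_sym perm_catCA perm_cons perm_sym.
Qed.

Lemma sgl_uniq g u w ls hs a b :
  theta g u w ls hs a b -> uniq (orient_list g ls hs).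
Proof.
move=> T; rewrite (perm_uniq (sgl_perm _ _ _)) cat_uniq.
rewrite map_inj_uniq ?(perm_uniq (th_edge T)) ?enum_uniq; last by move=> ? ? [].
rewrite map_inj_uniq ?(perm_uniq (th_ext T)); last by move=> ? ? [].
rewrite map_inj_uniq ?enum_uniq ?andbT /=; last by move=> ? ? [].
by apply/hasPn => _ /mapP[x _ ->]; apply/negP => /mapP[].
Qed.

Lemma mem_sgl g u w ls hs a b :
  theta g u w ls hs a b -> orient_list g ls hs =i @odd_cell h n e.
Proof.
move=> T c; rewrite (perm_mem (sgl_perm _ _ _)) mem_cat.
case: c => [[x|v]|f]; rewrite [RHS]/= .
- apply/orP; right; apply/map_f; rewrite (perm_mem (th_ext T)).
  by apply/map_f; rewrite mem_enum.
- apply/negP => /orP[/mapP[]//|/mapP[y]]; rewrite (perm_mem (th_ext T)).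
  by case/mapP=> z _ -> [].
- by apply/orP; left; apply/map_f; rewrite (perm_mem (th_edge T)) mem_enum.
Qed.

End Theta.

Section ThetaMap.
Variables (h n e h' n' e' : nat) (g : graph h n e) (g' : graph h' n' e').
Variables (fx : 'I_h -> 'I_h') (fi : 'I_n -> 'I_n') (fe : 'I_e -> 'I_e').
Variable tw : 'I_e -> bool.

(** The twist [tw] lets the same transport lemmas serve isomorphisms, with no twist, and reversals
    of edges, with identity maps. *)
Definition dmap (d : halfedge e) : halfedge e' := (fe d.1, d.2 (+) tw d.1).

Hypotheses (bfx : bijective fx) (bfi : bijective fi) (bfe : bijective fe).
Hypothesis gE : forall d, endpoint g' (dmap d) = vertex_map fx fi (endpoint g d).
Let V := vertex_map fx fi.

Lemma rdart_dmap d : rdart (dmap d) = dmap (rdart d).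
Proof. by rewrite /rdart /dmap /= addNb. Qed.

Lemma tgt_dmap d : tgt g' (dmap d) = V (tgt g d).
Proof. by rewrite /tgt rdart_dmap gE. Qed.

Lemma inner_dmap l : inner g' (map dmap l) = map V (inner g l).
Proof.
by rewrite /inner behead_map -!map_comp; apply: eq_map => d; apply: gE.
Qed.

Lemma walk_dmap x l y : walk g x l y -> walk g' (V x) (map dmap l) (V y).
Proof.
elim: l x => [|d l IH] x /=; first by move=> /eqP ->.
by case/andP=> /eqP <- /IH; rewrite gE eqxx tgt_dmap.
Qed.

Lemma theta_map u w ls hs a b : theta g u w ls hs a b ->
  theta g' (V u) (V w) (map (map dmap) ls) (map dmap hs) a b.
Proof.
case=> [Ts Tw Ti Te Tx Th].
have EI : flatten (map (inner g') (map (map dmap) ls)) =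
          map V (flatten (map (inner g) ls)).
  rewrite map_flatten -!map_comp; congr flatten.
  by apply: eq_map => l; apply: inner_dmap.
split.
- by rewrite size_map.
- move=> _ /mapP[l /Tw[l0 W] ->]; split; last exact: walk_dmap.
  by rewrite -size_eq0 size_map size_eq0.
- rewrite EI -!map_cons (perm_trans (perm_map V Ti)) // -map_comp.
  rewrite (map_comp (@inr 'I_h' 'I_n') fi).
  by apply: perm_map; apply: perm_enum_bij.
- rewrite -map_flatten -map_cat -map_comp.
  rewrite (map_comp fe fst) (perm_trans (perm_map fe Te)) //.
  exact: perm_enum_bij.
- rewrite -map_comp (eq_map (g := V \o endpoint g)); last by move=> d; apply: gE.
  rewrite map_comp (perm_trans (perm_map V Tx)) // -map_comp.
  rewrite (map_comp (@inl 'I_h' 'I_n') fx).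
  by apply: perm_map; apply: perm_enum_bij.
- rewrite -map_comp (eq_map (g := V \o tgt g)); last by move=> d; apply: tgt_dmap.
  rewrite map_comp (perm_trans (perm_map V Th)) // !map_cat !map_nseq.
  by rewrite !perm_cat2l EI.
Qed.

Lemma sgl_dmap ls hs :
  orient_list g' (map (map dmap) ls) (map dmap hs) =
  map (cell_map fx fi fe) (orient_list g ls hs).
Proof.
rewrite /orient_list map_cat; congr (_ ++ _); first by rewrite -map_flatten -!map_comp.
rewrite map_flatten -!map_comp; congr flatten; apply: eq_map => d /=; rewrite gE.
by case: (endpoint g d).
Qed.

End ThetaMap.

Lemma cell_map_inj h n e h' n' e' (fx : 'I_h -> 'I_h') (fi : 'I_n -> 'I_n')
    (fe : 'I_e -> 'I_e') :
  injective fx -> injective fi -> injective fe -> injective (cell_map fx fi fe).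
Proof.
move=> ix ii ie [[x|v]|f] [[x'|v']|f'] //= [].
- by move/ix ->.
- by move/ii ->.
- by move/ie ->.
Qed.

(** The orientation relative to a parametrization: the order of the odd cells in [orient_order] is
    compared with their order along strands and hairs. All later sign computations are changes of
    this Boolean. *)
Definition strand_sign (G : ograph) ls hs : bool :=
  inv_parity (index^~ (orient_order G)) (orient_list (ends G) ls hs).

Lemma uniq_map_inj (X Y : eqType) (f : X -> Y) (s : seq X) :
  uniq (map f s) -> {in s &, injective f}.
Proof.
elim: s => // x s IH /= /andP[xs us] y z; rewrite !inE.
case/predU1P=> [->|ys] /predU1P[->|zs] E //.
- by case/mapP: xs; exists z.
- by case/mapP: xs; exists y.
- exact: IH.
Qed.

(** * Connectivity, frame and cut vertices of Theta-graphs *)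

Section Topology.
Variables h n e : nat.
Implicit Types (g : graph h n e) (A : {set cell h n e}) (d : halfedge e).

Lemma adj_sym g A : symmetric (adj g A).
Proof.
by move=> [v|f] [v'|f']; rewrite /adj; case: (_ \in A); case: (_ \in A).
Qed.

Lemma connect_adjC g A : connect_sym (adj g A).
Proof. by move=> c d; apply: (sym_connect_sym (@adj_sym g A)). Qed.

Lemma incidentP g v f :
  reflect (exists b, endpoint g (f, b) = v) (incident g v f).
Proof.
apply: (iffP orP) => [[]/eqP ->|[[] <-]]; rewrite /endpoint /= ?eqxx; auto.
  by exists false.
by exists true.
Qed.

Lemma incident_endpoint g d : incident g (endpoint g d) d.1.
Proof. by apply/incidentP; exists d.2; case: d. Qed.

Lemma adj_endpoint g A d :
  inl (endpoint g d) \in A -> inr d.1 \in A ->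
  adj g A (inl (endpoint g d)) (inr d.1).
Proof. by move=> vA fA; rewrite /adj vA fA incident_endpoint. Qed.

Lemma adj_tgt g A d :
  inl (tgt g d) \in A -> inr d.1 \in A -> adj g A (inr d.1) (inl (tgt g d)).
Proof. by move=> vA fA; rewrite adj_sym (@adj_endpoint g A (rdart d)). Qed.

Lemma connect_in g A c (d : cell h n e) : c \in A -> connect (adj g A) c d -> d \in A.
Proof.
move=> cA /connectP[p + ->]; elim: p c cA => //= c' p IH c cA /andP[/and3P[_ c'A _]].
exact: IH.
Qed.

Lemma connectedP g A c : c \in A ->
  reflect {in A, forall d : cell h n e, connect (adj g A) c d} (connected g A).
Proof.
move=> cA; apply: (iffP forall_inP) => [H d dA|H d dA].
  by have /forall_inP := H c cA; apply.
apply/forall_inP => d' d'A; apply: connect_trans (H _ d'A).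
by rewrite connect_adjC; apply: H.
Qed.

Lemma n_comp_connected g A c :
  c \in A -> connected g A -> n_comp (adj g A) A = 1%N.
Proof.
move=> cA /(connectedP g cA) H; rewrite -(n_comp_connect (@connect_adjC g A) c).
apply: eq_n_comp_r => d; apply/idP/idP; first exact: H.
exact: connect_in.
Qed.

Lemma walk_conn g A x l y : walk g x l y -> inl y \in A ->
  {in l, forall d, inl (endpoint g d) \in A /\ inr d.1 \in A} ->
  connect (adj g A) (inl x) (inl y).
Proof.
move=> + yA; elim: l x => [|d l IH] x /=; first by move=> /eqP ->.
case/andP=> /eqP <- W H; have [xA fA] := H d (mem_head _ _).
have tA : inl (tgt g d) \in A.
  case: l W {IH} H => [/eqP -> //|d' l /= /andP[/eqP <- _] H].
  by have [] := H d' _; rewrite ?inE ?eqxx ?orbT.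
apply: connect_trans (connect1 (adj_endpoint xA fA)) _.
apply: connect_trans (connect1 (adj_tgt tA fA)) _.
by apply: IH => // d' d'l; apply: H; rewrite inE d'l orbT.
Qed.

(** [ds] contains one dart of each edge, so [ds] and its reversals list every half-edge once. *)
Lemma card_halfedge (P : pred (halfedge e)) (ds : seq (halfedge e)) :
  perm_eq (map fst ds) (enum 'I_e) ->
  #|[set x | P x]| = (count P ds + count P (map (@rdart e) ds))%N.
Proof.
move=> pds; have -> : #|[set x | P x]| = count P (enum {: halfedge e}).
  by rewrite enumT cardsE cardE /enum_mem size_filter; apply: eq_count.
rewrite -count_cat; apply/permP.
have uds : uniq (map fst ds) by rewrite (perm_uniq pds) enum_uniq.
apply: uniq_perm; first by rewrite enum_uniq.
  rewrite cat_uniq (map_uniq uds) (map_inj_uniq (can_inj (@rdartK e))).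
  rewrite (map_uniq uds) andbT; apply/hasPn => _ /mapP[d dds ->].
  apply/negP => d'ds; have /eqP[] := rdart_neq d.
  exact: (uniq_map_inj uds d'ds dds).
move=> x; rewrite mem_enum inE mem_cat; symmetry; apply/idP.
have : x.1 \in map fst ds by rewrite (perm_mem pds) mem_enum.
case/mapP=> d dds /esym/dart_edge[]->; first by rewrite dds.
by rewrite map_f ?orbT.
Qed.

End Topology.

Lemma count_map_enum (k : nat) (V : eqType) (f : 'I_k -> V) x :
  injective f -> count_mem (f x) (map f (enum 'I_k)) = 1%N.
Proof.
move=> fI; rewrite count_uniq_mem; last by rewrite map_inj_uniq // enum_uniq.
by rewrite (map_f f (mem_enum _ x)).
Qed.

Lemma count_map_neq (k : nat) (V : eqType) (f : 'I_k -> V) v :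
  (forall x, f x != v) -> count_mem v (map f (enum 'I_k)) = 0%N.
Proof.
by move=> H; apply/count_memPn/mapP => -[x _ E]; have := H x; rewrite E eqxx.
Qed.

Section ThetaFacts.
Variables h n e : nat.
Variables (g : graph h n e) (u w : vertex h n) (ls : seq (seq (halfedge e))).
Variables (hs : seq (halfedge e)) (a b : bool).
Hypothesis T : theta g u w ls hs a b.
Notation I := (flatten (map (inner g) ls)).

Definition is_int (v : vertex h n) := if v is inr _ then true else false.

Lemma theta_intE v : is_int v = [|| v == u, v == w | v \in I].
Proof.
rewrite -2!in_cons (perm_mem (th_int T)); case: v => [x|v] /=.
  by apply/esym/negP => /mapP[].
by apply/esym/map_f; rewrite mem_enum.
Qed.

Lemma theta_int_uniq : uniq (u :: w :: I).
Proof.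
by rewrite (perm_uniq (th_int T)) map_inj_uniq ?enum_uniq // => ? ? [].
Qed.

Lemma theta_edge_uniq : uniq (map fst (flatten ls ++ hs)).
Proof. by rewrite (perm_uniq (th_edge T)) enum_uniq. Qed.

Lemma theta_edge_inj : {in flatten ls ++ hs &, injective (@fst 'I_e bool)}.
Proof. exact: uniq_map_inj theta_edge_uniq. Qed.

Lemma theta_edgeP f : exists2 d, d \in flatten ls ++ hs & d.1 = f.
Proof.
have : f \in map fst (flatten ls ++ hs) by rewrite (perm_mem (th_edge T)) mem_enum.
by case/mapP=> d dds ->; exists d.
Qed.

Lemma theta_src_perm : perm_eq (map (endpoint g) (flatten ls)) (nseq 3%N u ++ I).
Proof.
rewrite -(th_size T); have := th_walk T.
elim: (ls) => //= l s IH H.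
have [l0 W] := H l (mem_head _ _); rewrite map_cat (walk_src l0 W) perm_cons.
rewrite perm_sym perm_catCA perm_cat2l perm_sym.
by apply: IH => l' l's; apply: H; rewrite inE l's orbT.
Qed.

Lemma theta_tgt_perm : perm_eq (map (tgt g) (flatten ls)) (nseq 3%N w ++ I).
Proof.
rewrite -(th_size T); have := th_walk T.
elim: (ls) => //= l s IH H.
have [l0 W] := H l (mem_head _ _); rewrite map_cat (walk_tgt l0 W) -cats1 -catA.
rewrite perm_catCA /= perm_cons.
rewrite perm_sym perm_catCA perm_cat2l perm_sym.
by apply: IH => l' l's; apply: H; rewrite inE l's orbT.
Qed.

Lemma theta_frame_int d : d \in flatten ls -> is_int (endpoint g d) /\ is_int (tgt g d).
Proof.
move=> dls; rewrite !theta_intE; split.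
  have := map_f (endpoint g) dls; rewrite (perm_mem theta_src_perm) mem_cat.
  by rewrite mem_nseq /= => /orP[]->; rewrite ?orbT.
have := map_f (tgt g) dls; rewrite (perm_mem theta_tgt_perm) mem_cat.
by rewrite mem_nseq /= => /orP[]->; rewrite ?orbT.
Qed.

Lemma theta_hair_ext d : d \in hs -> ~~ is_int (endpoint g d) /\ is_int (tgt g d).
Proof.
move=> dhs; rewrite [is_int (tgt _ _)]theta_intE.
have := map_f (endpoint g) dhs; rewrite (perm_mem (th_ext T)) => /mapP[x _ ->].
have := map_f (tgt g) dhs; rewrite (perm_mem (th_hair T)) !mem_cat.
by rewrite !mem_nseq => /or3P[/andP[_ ->]|/andP[_ ->]|->]; rewrite ?orbT.
Qed.

(** The valence of [v] is its multiplicity in the lists of sources and targets of strands and hairs,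
    all four of which are known up to order from [theta]. *)
Lemma theta_valence v : valence g v =
  if is_int v then (3 + (a && (u == v)) + (b && (w == v)))%N else 1%N.
Proof.
rewrite /valence /star (card_halfedge (fun x => endpoint g x == v) (th_edge T)).
have E f (s : seq (halfedge e)) :
  count (fun x => f x == v) s = count_mem v (map f s) by rewrite count_map.
rewrite !(E (endpoint g)).
have R s : map (endpoint g) (map (@rdart e) s) = map (tgt g) s by rewrite -map_comp.
rewrite R !map_cat !count_cat.
rewrite (permP theta_src_perm) (permP theta_tgt_perm).
rewrite (permP (th_ext T)) (permP (th_hair T)) !count_cat !count_nseq.
have := permP (th_int T) (pred1 v).
rewrite /= -[count (fun x => x == v)]/(count (pred1 v)).
case: v {E} => [x|v].
  rewrite [count_mem _ (map inr _)]count_map_neq // count_map_enum; last by move=> ? ? [].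
  by rewrite /=; lia.
rewrite [count_mem _ (map inl _)]count_map_neq // count_map_enum; last by move=> ? ? [].
by rewrite /=; case: (a); case: (b); rewrite /=; lia.
Qed.

Lemma theta_n : n = (size I).+2.
Proof. by have := perm_size (th_int T); rewrite /= size_map size_enum_ord. Qed.

Lemma theta_size_hs : size hs = h.
Proof. by have := perm_size (th_ext T); rewrite 2!size_map size_enum_ord. Qed.

Lemma theta_h : h = (a + b + size I)%N.
Proof.
rewrite -addnA; have := perm_size (th_hair T).
by rewrite size_map theta_size_hs !size_cat !size_nseq.
Qed.

(** The strands have three more edges than interior vertices, there are two end vertices, and each
    external vertex has one hair. The Euler characteristic is thus -1, whence the first Betti number
    2. *)
Lemma theta_e : e = (h + n + 1)%N.
Proof.
have := perm_size (th_edge T); rewrite size_map size_enum_ord size_cat theta_size_hs.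
have := perm_size theta_src_perm; rewrite size_map size_cat size_nseq.
move=> E1 E2; have := theta_n; move: E1 E2; set i := size I.
by set k := size (flatten ls); lia.
Qed.

Lemma theta_defect : defect g = (a + b)%N.
Proof.
rewrite /defect.
under eq_bigr => v _ do rewrite theta_valence /= -addnA addnC addnK.
have int1 (x : vertex h n) (c : bool) : is_int x ->
    (\sum_(v < n) (c && (x == inr v)) = c)%N.
  case: x => // x _; rewrite (bigD1 x) //= big1 ?addn0 ?eqxx ?andbT // => v /negbTE vx.
  by rewrite -[inr x == _]/(x == v) eq_sym vx andbF.
by rewrite big_split /= !int1 // theta_intE eqxx ?orbT.
Qed.

End ThetaFacts.

Lemma walk_shift h n e (g : graph h n e) x l y :
  walk g x l y -> x :: map (tgt g) l = rcons (map (endpoint g) l) y.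
Proof.
elim: l x => [|d l IH] x /=; first by move=> /eqP ->.
by case/andP=> /eqP <- /IH ->.
Qed.

Section ThetaConnected.
Variables h n e : nat.
Variables (g : graph h n e) (u w : vertex h n) (ls : seq (seq (halfedge e))).
Variables (hs : seq (halfedge e)) (a b : bool).
Hypothesis T : theta g u w ls hs a b.
Implicit Type A : {set cell h n e}.

Lemma theta_split l d : l \in ls -> d \in l -> exists l1 l2,
  [/\ l = l1 ++ d :: l2, walk g u l1 (endpoint g d) & walk g (tgt g d) l2 w].
Proof.
move=> lls dl; have [_] := th_walk T lls.
case/splitPr: dl => l1 l2; rewrite walk_cat /= => /and3P[W1 /eqP E W2].
by exists l1, l2; split; rewrite // E.
Qed.

Lemma theta_to_front l : l \in ls -> exists l' l'',
  perm_eq ls [:: l; l'; l''] /\ theta g u w [:: l; l'; l''] hs a b.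
Proof.
move=> /perm_to_rem p; have := perm_size p; rewrite (th_size T).
case: (rem l ls) p => [|l' [|l'' []]] // p _; exists l', l''; split=> //.
exact: theta_perm T.
Qed.

Lemma theta_strand_uniq l : l \in ls -> uniq (rcons (u :: inner g l) w).
Proof.
case/theta_to_front=> l' [l'' [_ /theta_int_uniq]].
rewrite rcons_cons /= rcons_uniq mem_rcons !inE /= !cat_uniq !mem_cat !negb_or.
by case/and3P=> /and3P[-> -> _] /andP[-> _] /andP[-> _].
Qed.

(** The vertices up to the source of [d] and those from the target of [d] on are disjoint, so a
    vertex removed from the strand leaves one side of [d] intact. *)
Lemma theta_strand_split_uniq l1 d l2 : l1 ++ d :: l2 \in ls ->
  uniq (map (endpoint g) (rcons l1 d) ++ map (tgt g) (d :: l2)).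
Proof.
move=> lls; have := theta_strand_uniq lls; have [l0 W] := th_walk T lls.
rewrite rcons_cons -(walk_tgt l0 W) map_cat -cat_cons.
suff -> : u :: map (tgt g) l1 = map (endpoint g) (rcons l1 d) by [].
move: W; rewrite walk_cat /= => /and3P[/walk_shift -> /eqP E _].
by rewrite map_rcons E.
Qed.

Lemma mem_strand_frame l d : l \in ls -> d \in l -> d \in flatten ls.
Proof. by move=> lls dl; apply/flattenP; exists l. Qed.

Lemma theta_strand_int l d : l \in ls -> d \in l ->
  is_int (endpoint g d) /\ is_int (tgt g d).
Proof. by move=> lls dl; apply: (theta_frame_int T); apply: mem_strand_frame dl. Qed.

Lemma theta_u_int : is_int u.
Proof. by rewrite (theta_intE T) eqxx. Qed.

Lemma theta_w_int : is_int w.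
Proof. by rewrite (theta_intE T) eqxx orbT. Qed.

Lemma theta_strand1 : exists l, l \in ls.
Proof. by have := th_size T; case: (ls) => // l; exists l; rewrite mem_head. Qed.

Lemma theta_int_strand v : is_int v ->
  exists l d, [/\ l \in ls, d \in l & v = endpoint g d \/ v = tgt g d].
Proof.
rewrite (theta_intE T) => /or3P[/eqP->|/eqP->|/flattenP[_ /mapP[l lls ->]]].
- have [l lls] := theta_strand1; have [l0 W] := th_walk T lls.
  case: l l0 W lls => // d l _ /= /andP[/eqP <- _] lls.
  by exists (d :: l), d; rewrite mem_head; split=> //; left.
- have [l lls] := theta_strand1; have [l0 W] := th_walk T lls.
  case/lastP: l l0 W lls => // l d _ W lls; exists (rcons l d), d.
  rewrite mem_rcons mem_head; split=> //; right.
  by rewrite -(walk_last W) map_rcons last_rcons.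
- case/mapP=> d dl ->; exists l, d; split=> //; last by left.
  exact: mem_behead dl.
Qed.

Lemma theta_conn A l d :
  (forall v, is_int v -> inl v \in A) ->
  {in flatten ls, forall d, inr d.1 \in A} -> l \in ls -> d \in l ->
  connect (adj g A) (inl u) (inl (endpoint g d)).
Proof.
move=> vA fA lls dl; have [dI _] := theta_strand_int lls dl.
have [l1 [l2 [E W _]]] := theta_split lls dl.
apply: (walk_conn W); first exact: vA.
move=> d' d'l1; have d'l : d' \in l by rewrite E mem_cat d'l1.
have [d'I _] := theta_strand_int lls d'l; split; first exact: vA.
by apply: fA; apply: mem_strand_frame d'l.
Qed.

Lemma theta_conn_edge A d :
  (forall v, is_int v -> inl v \in A) ->
  {in flatten ls, forall d, inr d.1 \in A} ->
  d \in flatten ls -> connect (adj g A) (inl u) (inr d.1).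
Proof.
move=> vA fA dls; have /flattenP[l lls dl] := dls.
apply: connect_trans (theta_conn vA fA lls dl) _.
have [dI _] := theta_strand_int lls dl.
by apply/connect1/adj_endpoint; rewrite ?vA ?fA.
Qed.

Lemma theta_conn_int A v :
  (forall v, is_int v -> inl v \in A) ->
  {in flatten ls, forall d, inr d.1 \in A} ->
  is_int v -> connect (adj g A) (inl u) (inl v).
Proof.
move=> vA fA /theta_int_strand[l [d [lls dl [->|->]]]]; first exact: theta_conn dl.
have dls := mem_strand_frame lls dl.
apply: connect_trans (theta_conn_edge vA fA dls) _.
have [_ dI] := theta_strand_int lls dl.
by apply/connect1/adj_tgt; rewrite ?vA ?fA.
Qed.

Lemma theta_conn_hair A d :
  (forall v, is_int v -> inl v \in A) ->
  {in flatten ls, forall d, inr d.1 \in A} ->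
  d \in hs -> inr d.1 \in A -> connect (adj g A) (inl u) (inr d.1).
Proof.
move=> vA fA dhs dA; have [_ dI] := theta_hair_ext T dhs.
apply: connect_trans (theta_conn_int vA fA dI) _.
by rewrite connect_adjC; apply/connect1/adj_tgt; rewrite ?vA.
Qed.

Lemma theta_ext_hair x : exists2 d, d \in hs & endpoint g d = inl x.
Proof.
have : inl x \in map (endpoint g) hs.
  by rewrite (perm_mem (th_ext T)) map_f ?mem_enum.
by case/mapP=> d dhs ->; exists d.
Qed.

Lemma theta_connected : connected g [set: cell h n e].
Proof.
have vA v : is_int v -> inl v \in [set: cell h n e] by rewrite inE.
have fA : {in flatten ls, forall d, inr d.1 \in [set: cell h n e]} by move=> d _; rewrite inE.
apply/(@connectedP _ _ _ _ _ (inl u)) => [|[[x|v]|f] _]; first by rewrite inE.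
- have [d dhs dx] := theta_ext_hair x.
  apply: connect_trans (theta_conn_hair vA fA dhs _) _; rewrite ?inE //.
  by rewrite connect_adjC -dx; apply/connect1/adj_endpoint; rewrite inE.
- exact: (theta_conn_int vA fA).
- have [d + <-] := theta_edgeP T f; rewrite mem_cat => /orP[dls|dhs].
    exact: theta_conn_edge.
  by apply: theta_conn_hair => //; rewrite inE.
Qed.

Lemma theta_graph_ok : (0 < h)%N -> graph_ok g.
Proof.
move=> h0; rewrite /graph_ok h0 theta_connected /=; apply/andP; split.
  by apply/forallP => x; rewrite (theta_valence T).
by apply/forallP => v; rewrite (theta_valence T) /= -addnA leq_addr.
Qed.

Lemma theta_betti1 : betti1 g [set: cell h n e] = 2%N.
Proof.
rewrite /betti1 (@n_comp_connected _ _ _ _ _ (inl u)) ?inE // ?theta_connected //.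
have -> : [set f | inr f \in [set: cell h n e]] = [set: 'I_e].
  by apply/setP => f; rewrite !inE.
have -> : [set v | inl v \in [set: cell h n e]] = [set: vertex h n].
  by apply/setP => v; rewrite !inE.
rewrite !cardsT card_sum !card_ord.
by have := theta_e T; lia.
Qed.

Lemma theta_frame_edge d l d' : l \in ls -> d \in l -> d' \in flatten ls ++ hs ->
  d.1 = d'.1 -> d = d'.
Proof.
move=> lls dl d'ds E.
apply: (theta_edge_inj T) d'ds E.
by rewrite mem_cat (mem_strand_frame lls dl).
Qed.

(** The ends of a strand edge stay connected without it: back along its strand to [u], along another
    strand to [w], and back from there to the other end. *)
Lemma tree_edge_frame d : d \in flatten ls -> ~~ tree_edge g d.1.
Proof.
move=> dls; have /flattenP[l lls dl] := dls; rewrite negb_and negbK; apply/orP; left.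
set A := [set~ _].
suff C : connect (adj g A) (inl (endpoint g d)) (inl (tgt g d)).
  move: C; rewrite {}/A; case: d {dls dl} => f []; rewrite /tgt /rdart /endpoint //=.
  by rewrite connect_adjC.
have [l' [l'' [pls T']]] := theta_to_front lls.
have l'ls : l' \in ls by rewrite (perm_mem pls) !inE eqxx orbT.
have [_ W'] := th_walk T l'ls.
have [l1 [l2 [E W1 W2]]] := theta_split lls dl.
have vA v : inl v \in A by rewrite !inE.
have fU : uniq (map fst (l ++ l')).
  have EF : flatten [:: l; l'; l''] ++ hs = (l ++ l') ++ (l'' ++ hs).
    by rewrite /= cats0 !catA.
  by have := theta_edge_uniq T'; rewrite EF map_cat cat_uniq => /andP[].
have fA d' : d' \in l ++ l' -> d' != d -> d'.1 != d.1.
  move=> d'l d'd; apply: contraNneq d'd => E'.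
  have d'ds : d' \in flatten ls ++ hs.
    move: d'l; rewrite !mem_cat => /orP[] d'l; first by rewrite (mem_strand_frame lls d'l).
    by rewrite (mem_strand_frame l'ls d'l).
  by rewrite (theta_frame_edge lls dl d'ds (esym E')).
have lU : uniq (l ++ l') := map_uniq fU.
have sub s x y : walk g x s y -> {subset s <= l ++ l'} -> d \notin s ->
    connect (adj g A) (inl x) (inl y).
  move=> W sl ds; apply: (walk_conn W) => // d' d's; split=> //.
  by rewrite !inE; apply: fA; [apply: sl | apply: contraNneq ds => <-].
move: lU; rewrite E -catA cat_uniq /= mem_cat !negb_or.
case/and3P=> _ /andP[dl1 _] /andP[/andP[dl2 dl'] _].
have C1 := sub _ _ _ W1 _ dl1; have C2 := sub _ _ _ W2 _ dl2.
have C3 := sub _ _ _ W' _ dl'.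
apply: connect_trans (_ : connect _ _ (inl u)) _.
  by rewrite connect_adjC; apply: C1 => x; rewrite E !mem_cat => ->.
apply: connect_trans (_ : connect _ _ (inl w)) _.
  by apply: C3 => x; rewrite mem_cat orbC => ->.
rewrite connect_adjC; apply: C2 => x; rewrite E !mem_cat inE => ->.
by rewrite !orbT.
Qed.

End ThetaConnected.

Lemma tree_edgeE h n e (g : graph h n e) (d : halfedge e) :
  let A := [set~ inr d.1] in
  let part v := [set c | connect (adj g A) (inl v) c] in
  tree_edge g d.1 = ~~ connect (adj g A) (inl (endpoint g d)) (inl (tgt g d))
    && (is_tree g (part (endpoint g d)) (+) is_tree g (part (tgt g d))).
Proof.
case: d => f [] /=; rewrite /tree_edge /tgt /rdart /endpoint //=.
by rewrite connect_adjC addbC.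
Qed.

Lemma cycle_not_tree h n e (g : graph h n e) (A : {set cell h n e}) :
  (#|[set v : vertex h n | inl v \in A]| < #|[set f : 'I_e | inr f \in A]|)%N ->
  ~~ is_tree g A.
Proof.
by move=> H; rewrite negb_and /betti1 orbC -lt0n subn_gt0 (leq_trans H) ?leq_addr.
Qed.

Section ThetaFrame.
Variables h n e : nat.
Variables (g : graph h n e) (u w : vertex h n) (ls : seq (seq (halfedge e))).
Variables (hs : seq (halfedge e)) (a b : bool).
Hypothesis T : theta g u w ls hs a b.
Implicit Type A : {set cell h n e}.

Lemma theta_ext_unique d y : d \in hs -> endpoint g y = endpoint g d -> y = d.
Proof.
move=> dhs E; have [/negbTE xE _] := theta_hair_ext T dhs.
have := theta_valence T (endpoint g d); rewrite xE => /eqP/cards1P[z Ez].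
have : y \in [set z] by rewrite -Ez inE E.
have : d \in [set z] by rewrite -Ez inE.
by rewrite !inE => /eqP -> /eqP.
Qed.

Lemma theta_ext_part d c : d \in hs ->
  connect (adj g [set~ inr d.1]) (inl (endpoint g d)) c -> c = inl (endpoint g d).
Proof.
move=> dhs /connectP[[|c' p] /= + ->] //; case/andP=> /and3P[_].
case: c' => // f; rewrite !inE => fd /incidentP[b' /(theta_ext_unique dhs) E].
by rewrite -E eqxx in fd.
Qed.

(** One side is the external vertex alone. The other side has at most h + n - 1 vertices and at
    least e - 1 = h + n edges, so it contains a cycle. *)
Lemma tree_edge_hair d : d \in hs -> tree_edge g d.1.
Proof.
move=> dhs; have [dE dI] := theta_hair_ext T dhs; rewrite tree_edgeE.
set A := [set~ _]; have x_part := theta_ext_part dhs.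
have vA v : inl v \in A by rewrite !inE.
have edgeA d' : d' \in flatten ls ++ hs -> d' != d -> inr d'.1 \in A.
  move=> d'ds d'd; rewrite !inE; apply: contraNneq d'd => -[E]; apply/eqP.
  by apply: (theta_edge_inj T) E => //; rewrite mem_cat dhs orbT.
have fA : {in flatten ls, forall d, inr d.1 \in A}.
  move=> d' d'ls; apply: edgeA; first by rewrite mem_cat d'ls.
  by apply: contraNneq dE => <-; have [] := theta_frame_int T d'ls.
have conn v : is_int v -> connect (adj g A) (inl u) (inl v).
  by apply: (theta_conn_int T).
apply/andP; split.
  by apply/negP => /x_part[] E; rewrite E in dI; rewrite dI in dE.
have -> : is_tree g [set c | connect (adj g A) (inl (endpoint g d)) c].
  set P := [set c | _]; have PE : P = [set inl (endpoint g d)].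
    apply/setP => c; rewrite !inE; apply/idP/eqP => [/x_part //|->].
    exact: connect0.
  have cP : connected g P.
    rewrite PE; apply/(@connectedP _ _ _ _ _ (inl (endpoint g d))) => [|c]; rewrite inE //.
    by move=> /eqP ->; apply: connect0.
  have dP : inl (endpoint g d) \in P by rewrite PE inE.
  rewrite /is_tree cP /betti1 (n_comp_connected dP cP) PE.
  rewrite (_ : [set f | _] = set0); last by apply/setP => f; rewrite !inE.
  rewrite (_ : [set v | _] = [set endpoint g d]); last by apply/setP => v; rewrite !inE.
  by rewrite cards0 cards1.
rewrite addTb; apply: cycle_not_tree.
set P := [set c | _].
have vP : [set v | inl v \in P] \subset [set~ endpoint g d].
  apply/subsetP => v; rewrite !inE => C; apply/eqP => E.
  move: C; rewrite E connect_adjC => /x_part[] E'.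
  by rewrite E' in dI; rewrite dI in dE.
have fP : [set~ d.1] \subset [set f | inr f \in P].
  apply/subsetP => f; rewrite !inE => fd.
  have uP : connect (adj g A) (inl (tgt g d)) (inl u).
    by rewrite connect_adjC; apply: conn.
  apply: connect_trans uP _.
  have [d' + E] := theta_edgeP T f; rewrite -E mem_cat => /orP[d'ls|d'hs].
    exact: (theta_conn_edge T).
  by apply: (theta_conn_hair T) => //; rewrite !inE E.
apply: leq_ltn_trans (subset_leq_card vP) (leq_trans _ (subset_leq_card fP)).
rewrite !cardsC1 card_sum !card_ord.
have := theta_n T; have := theta_e T; set i := size _; lia.
Qed.

Lemma theta_tree_edge f : tree_edge g f = (f \in map fst hs).
Proof.
have [d + <-] := theta_edgeP T f; rewrite mem_cat => /orP[dls|dhs]; last first.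
  by rewrite tree_edge_hair // map_f.
rewrite (negbTE (tree_edge_frame T dls)); apply/esym/negP => fhs.
have := theta_edge_uniq T; rewrite map_cat cat_uniq => /and3P[_ /hasPn/(_ _ fhs)].
by rewrite /= map_f.
Qed.

Lemma theta_mem_frame c : c \in frame g =
  match c with inl v => is_int v | inr f => f \in map fst (flatten ls) end.
Proof.
have E f : ~~ tree_edge g f = (f \in map fst (flatten ls)).
  have [d + <-] := theta_edgeP T f; rewrite mem_cat => /orP[dls|dhs].
    by rewrite (tree_edge_frame T dls) map_f.
  rewrite tree_edge_hair //; apply/esym/negP => fls.
  have := theta_edge_uniq T; rewrite map_cat cat_uniq => /and3P[_ /hasPn H _].
  by have := H d.1 (map_f _ dhs); rewrite /= fls.
rewrite inE; case: c => [v|f]; last exact: E.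
apply/existsP/idP => [[f]|/(theta_int_strand T)[l [d [lls dl vd]]]].
  rewrite E => /andP[/mapP[d dls ->] /incidentP[c <-]].
  have [I1 I2] := theta_frame_int T dls.
  have : d.1 = (d.1, c).1 by [].
  by case/dart_edge=> ->.
exists d.1; rewrite E map_f ?(mem_strand_frame lls) //=.
by case: vd => ->; [|rewrite -[d.1]/(rdart d).1]; apply: incident_endpoint.
Qed.

Lemma theta_hair_inj : {in hs &, injective (tgt g)}.
Proof.
apply: uniq_map_inj; rewrite (perm_uniq (th_hair T)).
have := theta_int_uniq T; rewrite /= inE negb_or => /and3P[/andP[uw uI] wI I_uniq].
by case: (a); case: (b); rewrite /= ?inE ?negb_or ?uw ?uI ?wI ?I_uniq.
Qed.

Lemma theta_hair_is_hair f : tree_edge g f -> is_hair g f.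
Proof.
move=> fT; rewrite /is_hair fT; move: fT; rewrite theta_tree_edge => /mapP[d dhs ->].
have [dE dI] := theta_hair_ext T dhs.
apply/existsP; exists d.2; rewrite -surjective_pairing (theta_valence T).
rewrite (negbTE dE) eqxx theta_mem_frame dI /=.
apply/forallP => f'; apply/implyP; rewrite theta_tree_edge.
case/andP=> /mapP[d' d'hs ->] /incidentP[c E].
have E' : tgt g d = tgt g d'.
  rewrite -[LHS]E; have : d'.1 = (d'.1, c).1 by [].
  case/dart_edge=> Ed; rewrite Ed // in E *.
  have [/negP[]] := theta_hair_ext T d'hs; rewrite -[is_int _]/(is_int (endpoint g d')).
  by rewrite E.
by rewrite (theta_hair_inj d'hs dhs (esym E')).
Qed.

End ThetaFrame.

Section ThetaCutVertex.
Variables h n e : nat.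
Variables (g : graph h n e) (u w : vertex h n) (ls : seq (seq (halfedge e))).
Variables (hs : seq (halfedge e)) (a b : bool).
Hypothesis T : theta g u w ls hs a b.

Lemma theta_avoid v : exists2 l, l \in ls & v \notin inner g l.
Proof.
have [l lls] := theta_strand1 T.
have [l' [l'' [pls T']]] := theta_to_front T lls.
have [vl|] := boolP (v \in inner g l); last by exists l.
exists l'; first by rewrite (perm_mem pls) !inE eqxx orbT.
have := theta_int_uniq T'; rewrite /= => /and3P[_ _].
rewrite cat_uniq => /and3P[_ /hasPn H _]; apply/negP => vl'.
by have := H v; rewrite mem_cat vl' /= vl => /(_ isT).
Qed.

(** Each strand edge is joined to an end vertex different from [v] along the side of its strand that
    avoids [v]. If both end vertices survive, a strand avoiding [v] joins them. *)
Lemma theta_no_cut_vertex v : ~~ cut_vertex g (frame g) v.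
Proof.
rewrite negb_and negbK; have [vF|//] := boolP (inl v \in frame g); rewrite orFb.
set A := _ :\ _.
have vA x : is_int x -> x != v -> inl x \in A.
  by move=> xI xv; rewrite in_setD1 (theta_mem_frame T) xI andbT.
have fA d : d \in flatten ls -> inr d.1 \in A.
  by move=> dls; rewrite in_setD1 (theta_mem_frame T) /= map_f.
have := theta_int_uniq T; rewrite /= inE negb_or => /and3P[/andP[uw uI] wI _].
have conn_uw : v != u -> v != w -> connect (adj g A) (inl u) (inl w).
  move=> vu vw; have [l lls vl] := theta_avoid v.
  have [l0 W] := th_walk T lls; apply: (walk_conn W).
    by apply: vA; [apply: (theta_w_int T)|rewrite eq_sym].
  move=> d dl; split; last by apply: fA; apply: mem_strand_frame dl.
  apply: vA; first by have [] := theta_strand_int T lls dl.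
  apply: contraNneq vl => Ev; rewrite -Ev.
  have := map_f (endpoint g) dl; rewrite (walk_src l0 W) inE => /predU1P[E|//].
  by case/eqP: vu; rewrite -Ev.
(* An end vertex other than [v], from which all of the frame without [v] will be reached. *)
pose c0 : cell h n e := if v == u then inl w else inl u.
have c0u : v != u -> c0 = inl u by rewrite /c0 => /negbTE ->.
have c0w : v != w -> connect (adj g A) c0 (inl w).
  by rewrite /c0; case: (v =P u) => [_ _|/eqP vu vw]; [apply: connect0|apply: conn_uw].
have c0A : c0 \in A.
  rewrite /c0; case: (v =P u) => [vu|/eqP vu].
    by apply: vA; [apply: (theta_w_int T)|rewrite vu eq_sym].
  by apply: vA; [apply: (theta_u_int T)|rewrite eq_sym].
have edge d : d \in flatten ls -> connect (adj g A) c0 (inr d.1).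
  move=> dls; have /flattenP[l lls dl] := dls.
  have [l1 [l2 [E W1 W2]]] := theta_split T lls dl.
  have : uniq (map (endpoint g) (rcons l1 d) ++ map (tgt g) (d :: l2)).
    by apply: (theta_strand_split_uniq T); rewrite -E.
  rewrite cat_uniq => /and3P[_ /hasPn disj _].
  have dI := theta_strand_int T lls dl.
  have [vs|vs] := boolP (v \in map (endpoint g) (rcons l1 d)).
    have vt : v \notin map (tgt g) (d :: l2).
      by apply/negP => vt; have := disj v vt; rewrite /= vs.
    have tv d' : d' \in d :: l2 -> tgt g d' != v.
      by move=> d'l; apply: contraNneq vt => <-; apply: map_f.
    have vw : v != w.
      have := walk_last W2; rewrite last_map => <-.
      by rewrite eq_sym; apply: tv; apply: mem_last.
    apply: connect_trans (c0w vw) (connect_trans (walk_conn (walk_rev W2) _ _) _).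
    - by apply: vA; [have [] := dI|apply: tv; rewrite mem_head].
    - move=> d'; rewrite mem_rev => /mapP[d'' d''l ->].
      have d''L : d'' \in l by rewrite E mem_cat inE d''l !orbT.
      split; last by apply: (fA d''); apply: mem_strand_frame d''L.
      apply: vA; first by have [] := theta_strand_int T lls d''L.
      by apply: tv; rewrite inE d''l orbT.
    - rewrite connect_adjC; apply/connect1/adj_tgt; last exact: fA.
      by apply: vA; [have [] := dI|apply: tv; rewrite mem_head].
  have sv d' : d' \in rcons l1 d -> endpoint g d' != v.
    by move=> d'l; apply: contraNneq vs => <-; apply: map_f.
  have vu : v != u.
    have [l0 W] := th_walk T lls; rewrite eq_sym.
    case: (l1) (W1) sv => [|d1 l1'] /=.
      by move=> /eqP -> sv; apply: sv; rewrite mem_head.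
    by case/andP=> /eqP <- _ sv; apply: sv; rewrite mem_head.
  rewrite c0u //; apply: connect_trans (walk_conn W1 _ _) _.
  - by apply: vA; [have [] := dI|apply: sv; rewrite mem_rcons mem_head].
  - move=> d' d'l; have d'L : d' \in l by rewrite E mem_cat d'l.
    split; last by apply: fA; apply: mem_strand_frame d'L.
    apply: vA; first by have [] := theta_strand_int T lls d'L.
    by apply: sv; rewrite mem_rcons inE d'l orbT.
  - apply/connect1/adj_endpoint; last exact: fA.
    by apply: vA; [have [] := dI|apply: sv; rewrite mem_rcons mem_head].
apply/(@connectedP _ _ _ _ _ c0) => // -[x|f]; rewrite in_setD1 (theta_mem_frame T).
  case/andP=> xv xI; have xA := vA x xI xv.
  have [l [d [lls dl xd]]] := theta_int_strand T xI.
  have dls := mem_strand_frame lls dl.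
  apply: connect_trans (edge d dls) _.
  case: xd => E; rewrite E; rewrite E in xA; last exact/connect1/adj_tgt/fA.
  by rewrite connect_adjC; apply/connect1/adj_endpoint/fA.
by case/andP=> _ /mapP[d dls ->]; apply: edge.
Qed.

Lemma theta_two_loop_hairy : (0 < h)%N -> two_loop_hairy_graph g.
Proof.
move=> h0; rewrite /two_loop_hairy_graph (theta_graph_ok T h0) (theta_betti1 T) /=.
apply/andP; split; first by apply/forallP => v; apply: theta_no_cut_vertex.
by apply/forallP => f; apply/implyP; apply: (theta_hair_is_hair T).
Qed.

End ThetaCutVertex.

(** * Finding the strands of a two-loop hairy graph *)

Section Walks.
Variables h n e : nat.
Variable g : graph h n e.
Implicit Types (d : halfedge e) (l : seq (halfedge e)) (x y u v : vertex h n).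

Lemma connect_closed (R : rel (cell h n e)) (S : pred (cell h n e)) c c' :
  (forall c1 c2, R c1 c2 -> S c1 -> S c2) -> connect R c c' -> S c -> S c'.
Proof.
move=> H /connectP[p + ->]; elim: p c => //= c1 p IH c /andP[/H cc1 /IH{}IH].
by move=> /cc1.
Qed.

Lemma walk_consec x l1 d d' l2 y :
  walk g x (l1 ++ d :: d' :: l2) y -> endpoint g d' = tgt g d.
Proof. by rewrite walk_cat /= => /and4P[_ _ /eqP]. Qed.

Lemma walk_head x d l y : walk g x (d :: l) y -> endpoint g d = x.
Proof. by case/andP=> /eqP. Qed.

Lemma walk_next x l y d : walk g x l y -> uniq (map fst l) -> d \in l ->
  (tgt g d = y /\ last d l = d) \/
  (exists d', [/\ d' \in behead l, endpoint g d' = tgt g d & d'.1 != d.1]).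
Proof.
move=> W U /splitPr dl; case: dl W U => l1 [|d' l2] W U.
  by left; rewrite -(walk_last W) map_cat !last_cat.
right; exists d'; split; first by case: (l1) => [|? ?]; rewrite /= ?mem_cat !inE eqxx ?orbT.
  exact: walk_consec W.
move: U; rewrite map_cat cat_uniq => /and3P[_ _ /= /and3P[]].
by rewrite inE negb_or eq_sym => /andP[].
Qed.

Lemma walk_prev x l y d : walk g x l y -> uniq (map fst l) -> d \in behead l ->
  exists d', [/\ d' \in l, tgt g d' = endpoint g d, d'.1 != d.1 & last d l != d'].
Proof.
case: l => // d0 l; rewrite [behead _]/= => + + /splitPr dl.
case: dl => l1 l2; case/lastP: l1 => [|l1 d'] W U.
  exists d0; rewrite mem_head; split=> //; first by have /andP[_ /andP[/eqP]] := W.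
    by move: U; rewrite /= inE negb_or => /andP[/andP[]].
  apply: contraTneq U => /= E; rewrite -E (_ : (last d l2).1 \in _) //.
  by rewrite -map_cons map_f // mem_last.
exists d'; have Wc : endpoint g d = tgt g d'.
  by apply: (@walk_consec x (d0 :: l1) _ _ l2 y); rewrite /= -cat_rcons.
split=> //; first by rewrite inE mem_cat mem_rcons mem_head orbT.
  move: U; rewrite cat_rcons -cat_cons map_cat cat_uniq => /and3P[_ _ /=].
  by rewrite inE negb_or => /andP[/andP[]].
move: U; rewrite -[d0 :: _]cat_cons -rcons_cons cat_rcons map_cat cat_uniq.
case/and3P=> _ _; rewrite [last _ _]last_cat /= => /andP[+ _].
by apply: contraNneq => <-; rewrite -map_cons map_f // mem_last.
Qed.

Lemma walk_last_dart x l y d : l != [::] -> walk g x l y -> tgt g (last d l) = y.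
Proof.
by case: l => // d0 l _ W; rewrite -(walk_last W) /= last_map.
Qed.

Variable F : pred 'I_e.

Definition fd v : {set halfedge e} := [set d | (endpoint g d == v) && F d.1].

Lemma mem_fd d : F d.1 -> d \in fd (endpoint g d).
Proof. by rewrite inE eqxx. Qed.

Lemma mem_fd_tgt d : F d.1 -> rdart d \in fd (tgt g d).
Proof. by rewrite inE eqxx. Qed.

Lemma fd2P v d1 d2 d : #|fd v| = 2%N -> d1 \in fd v -> d2 \in fd v ->
  d1 != d2 -> d \in fd v -> d = d1 \/ d = d2.
Proof.
move=> c2 v1 v2 ne vd; have : [set d1; d2] == fd v.
  by rewrite eqEcard c2 cards2 ne andbT; apply/subsetP => x; rewrite !inE => /orP[]/eqP->;
    [move: v1|move: v2]; rewrite inE.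
move/eqP=> E; move: vd; rewrite -E !inE => /orP[]/eqP; auto.
Qed.

(* F selects the edges of the frame, so that fd v is the set of frame
   half-edges at v. *)
Definition good u l v := [/\ walk g u l v, uniq (map fst l),
  {in l, forall d, F d.1} & {in behead l, forall d, #|fd (endpoint g d)| = 2%N}].

(** At a vertex of frame valence 2 the walk has exactly one way on. An edge used before cannot recur
    there: its neighbour on the walk would be a third frame half-edge at [v], or [v] would be [u],
    whose frame valence is larger. *)
Lemma good_extend u l v : l != [::] -> (2 < #|fd u|)%N -> #|fd v| = 2%N ->
  good u l v -> exists d, good u (rcons l d) (tgt g d).
Proof.
move=> l0 su sv [W U lF l2].
case/lastP: l l0 W U lF l2 => // l z _ W U lF l2.
have zv : tgt g z = v by rewrite -(walk_last W) map_rcons last_rcons.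
have zl : z \in rcons l z by rewrite mem_rcons mem_head.
have rz : rdart z \in fd v by rewrite -zv mem_fd_tgt ?lF.
have : (0 < #|fd v :\ rdart z|)%N by have := cardsD1 (rdart z) (fd v); rewrite rz sv add1n => -[] <-.
case/card_gt0P=> x; rewrite in_setD1 => /andP[xz xv].
have [xE xF] : endpoint g x = v /\ F x.1 by move: xv; rewrite inE => /andP[/eqP].
exists x; split; last first.
- move=> d; rewrite (_ : behead _ = rcons (behead (rcons l z)) x); last by case: (l).
  by rewrite mem_rcons inE => /predU1P[->|]; [rewrite xE|apply: l2].
- by move=> d; rewrite mem_rcons inE => /predU1P[->|/lF].
- rewrite map_rcons rcons_uniq U andbT; apply/negP => /mapP[y yl /dart_edge[] E].
    have : y \in behead (rcons l z).
      case: (l) W yl su => [|d0 l'] /= /andP[/eqP W _];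
        rewrite ?inE => yl; rewrite -W => su.
      - by move: su; rewrite -(eqP yl) E xE sv.
      - by case/predU1P: yl => [Ey|//]; move: su; rewrite -Ey E xE sv.
    case/(walk_prev W U) => y' [y'l y't y'y]; rewrite last_rcons => zy'.
    have : rdart y' \in fd v by rewrite -xE -E -y't mem_fd_tgt ?lF.
    case/(fd2P sv xv rz xz) => [E'|/(can_inj (@rdartK e)) E'].
      by rewrite E -E' /= eqxx in y'y.
    by rewrite E' eqxx in zy'.
  have [[_]|[y' [y'l y'E y'y]]] := walk_next W U yl.
    by rewrite last_rcons => zy; case/eqP: xz; rewrite zy E rdartK.
  have y'L := mem_behead y'l.
  have Ev : tgt g y = v by rewrite E /tgt rdartK.
  have : y' \in fd v by rewrite -Ev -y'E mem_fd ?lF.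
  case/(fd2P sv xv rz xz) => E'; first by rewrite E E' eqxx in y'y.
  have /eqP[] := rdart_neq z.
  by rewrite -E'; apply: (uniq_map_inj U) => //; rewrite E'.
- by rewrite -cats1 walk_cat (walk_last W) W /= xE !eqxx.
Qed.

(** The walk is extended until it meets a vertex of frame valence above 2. Its edges are distinct,
    so its length is bounded by [e], which serves as fuel. *)
Lemma good_to_special u d0 :
  (2 < #|fd u|)%N -> d0 \in fd u -> (forall d, F d.1 -> (1 < #|fd (endpoint g d)|)%N) ->
  exists l v, good u (d0 :: l) v /\ (2 < #|fd v|)%N.
Proof.
move=> su; rewrite inE => /andP[/eqP d0u d0F] F2.
suff H k l v : (e - size l <= k)%N -> good u (d0 :: l) v ->
    exists l' v', good u (d0 :: l') v' /\ (2 < #|fd v'|)%N.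
  apply: (H e [::] (tgt g d0)); rewrite ?leq_subr //.
  by split=> //=; rewrite ?d0u ?eqxx // => d; rewrite inE => /eqP ->.
elim: k l v => [|k IH] l v kl G.
  have [_ U _ _] := G; have := card_uniqP U; have := max_card (mem (map fst (d0 :: l))).
  by move=> + E; rewrite E card_ord size_map /=; lia.
have [sv|] := boolP (2 < #|fd v|)%N; first by exists l, v.
rewrite -leqNgt => v2; have [W _ lF _] := G.
have cv : #|fd v| = 2%N.
  have zv : tgt g (last d0 l) = v := @walk_last_dart _ (d0 :: l) _ d0 isT W.
  apply/eqP; rewrite eqn_leq v2 -zv.
  exact: (F2 (rdart (last d0 l)) (lF _ (mem_last d0 l))).
have [d] := @good_extend u (d0 :: l) v isT su cv G.
rewrite rcons_cons => Gd; apply: (IH (rcons l d)) Gd.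
by rewrite size_rcons; lia.
Qed.

(** Traced backwards from a common dart, both walks are forced at vertices of frame valence 2, so
    they arrive at [u] together, by the same dart. *)
Lemma good_same u w l l' p1 d q1 p2 q2 d1 :
  (2 < #|fd u|)%N -> good u l w -> good u l' w ->
  l = p1 ++ d :: q1 -> l' = p2 ++ d :: q2 -> head d1 l = head d1 l'.
Proof.
move=> su [W U lF l2] [W' U' lF' l2'].
elim/last_ind: p1 d q1 p2 q2 => [|p1 y IH] d q1 p2 q2 E E'.
  case: p2 E' => [|y p2] E'; first by rewrite E E'.
  have du : endpoint g d = u by move: W; rewrite E => /walk_head.
  have := l2' d; rewrite E' /= mem_cat mem_head orbT du => /(_ isT) su'.
  by rewrite su' in su.
have Ey : endpoint g d = tgt g y.
  by apply: (@walk_consec u p1 _ _ q1 w); rewrite -cat_rcons -E.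
have dl : d \in behead l.
  by rewrite E cat_rcons; case: (p1) => [|? ?]; rewrite /= ?mem_cat !inE eqxx ?orbT.
have dl' : d \in l by apply: mem_behead.
have yl : y \in l by rewrite E mem_cat mem_rcons mem_head.
have uf : y.1 != d.1.
  move: U; rewrite E cat_rcons map_cat cat_uniq => /and3P[_ _ /= /andP[]].
  by rewrite inE negb_or => /andP[].
have c2 := l2 d dl.
case/lastP: p2 E' => [|p2 y'] E'.
  have du : endpoint g d = u by move: W'; rewrite E' => /walk_head.
  by rewrite du in c2; rewrite c2 in su.
have Ey' : endpoint g d = tgt g y'.
  by apply: (@walk_consec u p2 _ _ q2 w); rewrite -cat_rcons -E'.
have y'l : y' \in l' by rewrite E' mem_cat mem_rcons mem_head.
have uf' : y'.1 != d.1.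
  move: U'; rewrite E' cat_rcons map_cat cat_uniq => /and3P[_ _ /= /andP[]].
  by rewrite inE negb_or => /andP[].
have dv : d \in fd (endpoint g d) by rewrite mem_fd ?lF.
have yv : rdart y \in fd (endpoint g d) by rewrite Ey mem_fd_tgt ?lF.
have yv' : rdart y' \in fd (endpoint g d) by rewrite Ey' mem_fd_tgt ?lF'.
have yd : d != rdart y by apply: contraNneq uf => ->.
case: (fd2P c2 dv yv yd yv') => [Ed|/(can_inj (@rdartK e)) Eyy].
  by rewrite -Ed eqxx in uf'.
apply: (IH y (d :: q1) p2 (d :: q2)); first by rewrite -cat_rcons.
by rewrite -Eyy -cat_rcons.
Qed.

(** Following [l] forwards means following [l'] backwards until an end vertex of one walk is met.
    That vertex would have frame valence 2, as an interior vertex of the other walk, or [u] and [w]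
    would coincide. *)
Lemma good_opposite u w l l' p1 d q1 p2 q2 :
  (2 < #|fd u|)%N -> (2 < #|fd w|)%N -> u != w -> good u l w -> good u l' w ->
  l = p1 ++ d :: q1 -> l' = p2 ++ rdart d :: q2 -> False.
Proof.
move=> su sw uw [W U lF l2] [W' U' lF' l2'].
elim: q1 p1 d p2 q2 => [|y q1 IH] p1 d p2 q2 E E'.
  have dw : tgt g d = w by rewrite -(walk_last W) E map_cat last_cat.
  case: p2 E' => [|y p2] E'.
    by case/eqP: uw; move: W'; rewrite E' => /walk_head <-.
  have := l2' (rdart d); rewrite E' /= mem_cat mem_head orbT -[endpoint g _]/(tgt g d) dw.
  by move=> /(_ isT) sw'; rewrite sw' in sw.
have Ey : endpoint g y = tgt g d.
  by apply: (@walk_consec u p1 _ _ q1 w); rewrite -E.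
have yl : y \in behead l.
  by rewrite E; case: (p1) => [|? ?]; rewrite /= ?mem_cat !inE eqxx ?orbT.
have dl : d \in l by rewrite E mem_cat mem_head orbT.
have c2 := l2 y yl; rewrite Ey in c2.
have uf : d.1 != y.1.
  move: U; rewrite E map_cat cat_uniq => /and3P[_ _ /= /andP[]].
  by rewrite inE negb_or => /andP[].
case/lastP: p2 E' => [|p2 y'] E'.
  have := W'; rewrite E' => /walk_head; rewrite -[endpoint g _]/(tgt g d) => du.
  by rewrite du in c2; rewrite c2 in su.
have Ey' : tgt g d = tgt g y'.
  by rewrite -(@walk_consec u p2 y' (rdart d) q2 w) // -cat_rcons -E'.
have y'l : y' \in l' by rewrite E' mem_cat mem_rcons mem_head.
have uf' : y'.1 != d.1.
  move: U'; rewrite E' cat_rcons map_cat cat_uniq => /and3P[_ _ /= /andP[]].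
  by rewrite inE negb_or => /andP[].
have dv : rdart d \in fd (tgt g d) by rewrite mem_fd_tgt ?lF.
have yv : y \in fd (tgt g d) by rewrite -Ey mem_fd // lF // mem_behead.
have yv' : rdart y' \in fd (tgt g d) by rewrite Ey' mem_fd_tgt ?lF'.
have yd : rdart d != y by apply: contraNneq uf => <-.
case: (fd2P c2 dv yv yd yv') => [/(can_inj (@rdartK e)) Ed|Eyy].
  by rewrite Ed eqxx in uf'.
apply: (IH (rcons p1 d) y p2 (rdart d :: q2)); first by rewrite cat_rcons.
by rewrite -Eyy rdartK -cat_rcons.
Qed.

Lemma good_disjoint u w l l' d d' d1 :
  (2 < #|fd u|)%N -> (2 < #|fd w|)%N -> u != w -> good u l w -> good u l' w ->
  d \in l -> d' \in l' -> d.1 = d'.1 -> head d1 l = head d1 l'.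
Proof.
move=> su sw uw G G' dl d'l /dart_edge E.
have [p1 [q1 El]] : exists p1 q1, l = p1 ++ d :: q1.
  by case/splitPr: dl {G} => p1 q1; exists p1, q1.
have [p2 [q2 El']] : exists p2 q2, l' = p2 ++ d' :: q2.
  by case/splitPr: d'l {G'} => p2 q2; exists p2, q2.
case: E => E; rewrite E in El'; first exact: good_same su G G' El El'.
by case: (good_opposite su sw uw G G' El El').
Qed.

(** The two frame half-edges at an interior vertex both belong to the strand. With [good_vertex_adj]
    this makes the strand closed under adjacency except at its ends. *)
Lemma good_edge_adj u l w (A : {set cell h n e}) (c : cell h n e) f :
  good u l w -> (forall f, inr f \in A -> F f) ->
  c \in map (@inl _ _) (map (endpoint g) (behead l)) ->
  adj g A c (inr f) -> f \in map fst l.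
Proof.
move=> [W U lF l2] AF /mapP[_ /mapP[d dl ->] ->] /and3P[_ /AF fF].
case/incidentP=> b bE.
have [y [yl yt yd _]] := walk_prev W U dl.
have dL := mem_behead dl.
have dv : d \in fd (endpoint g d) by rewrite mem_fd ?lF.
have yv : rdart y \in fd (endpoint g d) by rewrite -yt mem_fd_tgt ?lF.
have fv : (f, b) \in fd (endpoint g d) by rewrite inE bE eqxx.
have ne : d != rdart y by apply: contraNneq yd => ->.
case: (fd2P (l2 d dl) dv yv ne fv) => /(congr1 fst) /= ->; first exact: map_f.
exact: map_f.
Qed.

Lemma good_vertex_adj u l w (A : {set cell h n e}) d v :
  good u l w -> d \in l -> adj g A (inr d.1) (inl v) ->
  [\/ v = u, v = w | v \in map (endpoint g) (behead l)].
Proof.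
move=> [W U lF l2] dl /and3P[_ _ /incidentP[b <-]].
have : d.1 = (d.1, b).1 by [].
case/dart_edge=> ->.
  case: l dl W {U lF l2} => // d0 l dl W; move: dl; rewrite inE => /predU1P[->|dl].
    by constructor 1; apply: walk_head W.
  by constructor 3; apply: map_f.
rewrite -[endpoint g _]/(tgt g d).
have [[-> _]|[d' [d'l <- _]]] := walk_next W U dl; first by constructor 2.
by constructor 3; apply: map_f.
Qed.

(** A strand returning to [u] would be separated from the rest of the frame by removing [u], and
    there is a rest, since [u] has a third frame half-edge [x]. *)
Lemma good_not_closed u l (A : {set cell h n e}) :
  l != [::] -> (2 < #|fd u|)%N -> good u l u ->
  (forall f, (inr f \in A) = F f) -> inl u \notin A -> connected g A -> False.
Proof.
move=> l0 su G AF uA cA; have [W U lF l2] := G.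
case: l l0 G W U lF l2 => // d0 l _ G W U lF l2; set z := last d0 l.
have zl : z \in d0 :: l by apply: mem_last.
have zu : tgt g z = u := @walk_last_dart _ (d0 :: l) _ d0 isT W.
have [x [xu xd xz]] : exists x : halfedge e, [/\ x \in fd u, x != d0 & x != rdart z].
  have := cardsD1 d0 (fd u); have := cardsD1 (rdart z) (fd u :\ d0) => E1 E2.
  have : (0 < #|fd u :\ d0 :\ rdart z|)%N.
    have := su; rewrite E2 E1; case: #|fd u :\ d0 :\ rdart z| => //.
    by case: (d0 \in _); case: (rdart z \in _).
  by case/card_gt0P=> x; rewrite !in_setD1 => /and3P[? ? ?]; exists x.
have [xE xF] : endpoint g x = u /\ F x.1 by move: xu; rewrite inE => /andP[/eqP].
pose S := [pred c : cell h n e | match c with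
  | inl v => v \in map (endpoint g) l | inr f => f \in map fst (d0 :: l) end].
have : connect (adj g A) (inr d0.1) (inr x.1).
  have d0A : inr d0.1 \in A by rewrite AF lF ?mem_head.
  by have /(connectedP g d0A) := cA; apply; rewrite AF.
move/(@connect_closed _ S) => H.
have : S (inr x.1).
  apply: H; last by rewrite /= mem_head.
  move=> [v|f] [v'|f'] //.
  - by move=> /and3P[].
  - move=> vf vS; apply: (good_edge_adj (A := A) (c := inl v) G) => //.
      by move=> f; rewrite AF.
    exact: map_f.
  - move=> fv /mapP[d dl E]; rewrite E in fv.
    have v'A : inl v' \in A by case/and3P: fv.
    by have [E'|E'|//] := good_vertex_adj G dl fv; rewrite E' (negbTE uA) in v'A.
  - by move=> /and3P[].
have sl d : d \in l -> endpoint g d <> u.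
  by move=> dl E; have := l2 d dl; rewrite E => c2; rewrite c2 in su.
case/mapP=> d dl /esym/dart_edge[] E.
  move: dl; rewrite -E inE => /predU1P[E'|/sl//]; by rewrite E' eqxx in xd.
have [[_ E']|[d' [/sl d'u + _]]] := walk_next W U dl; last first.
  by rewrite -xE E in d'u.
by case/eqP: xz; rewrite E -E'.
Qed.

End Walks.

Section TwoLoopTheta.
Variables h n e : nat.
Variable g : graph h n e.
Hypothesis gT : two_loop_hairy_graph g.
Let F f := ~~ tree_edge g f.
Notation fd := (fd g F).

Let g_ok : graph_ok g. Proof. by case/and4P: gT. Qed.
Let h_gt0 : (0 < h)%N. Proof. by case/and4P: g_ok. Qed.
Let g_conn : connected g [set: cell h n e]. Proof. by case/and4P: g_ok. Qed.
Let ext_val x : valence g (inl x) = 1%N.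
Proof. by case/and4P: g_ok => _ _ /forallP/(_ x)/eqP. Qed.
Let int_val v : (2 < valence g (inr v))%N.
Proof. by case/and4P: g_ok => _ _ _ /forallP. Qed.

Let card_e : e = (h + n + 1)%N.
Proof.
have [_ /eqP + _ _] := and4P gT; rewrite /betti1.
rewrite (@n_comp_connected _ _ _ _ _ (inl (inl (Ordinal h_gt0)))) ?inE //.
have -> : [set f | inr f \in [set: cell h n e]] = [set: 'I_e].
  by apply/setP => f; rewrite !inE.
have -> : [set v | inl v \in [set: cell h n e]] = [set: vertex h n].
  by apply/setP => v; rewrite !inE.
by rewrite !cardsT card_sum !card_ord; lia.
Qed.

Lemma ext_dart : exists y : 'I_h -> halfedge e,
  forall x, endpoint g (y x) = inl x /\ forall d, endpoint g d = inl x -> d = y x.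
Proof.
apply: (@fin_all_exists _ _ (fun x y => endpoint g y = inl x /\
  forall d, endpoint g d = inl x -> d = y)) => x.
have /eqP/cards1P[y yE] := ext_val x.
have: y \in [set y] by rewrite inE.
exists y; split; first by move: H; rewrite -yE inE => /eqP.
by move=> d dx; apply/eqP; rewrite -in_set1 -yE inE dx.
Qed.

(** One side of the edge is the external vertex alone. The other side contains all remaining cells,
    and by [card_e] these include more edges than vertices, hence a cycle. *)
Let tree_ext d x : endpoint g d = inl x ->
  (forall d', endpoint g d' = inl x -> d' = d) -> tree_edge g d.1.
Proof.
move=> dx dU; rewrite tree_edgeE; set A := [set~ _].
have tx : tgt g d != inl x.
  by apply/eqP => /dU E; have := rdart_neq d; rewrite E eqxx.
have x_part c : connect (adj g A) (inl (inl x)) c -> c = inl (inl x).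
  move=> /connectP[[|c' p] /= + ->] //; case/andP=> /and3P[_].
  case: c' => // f; rewrite !inE => fd /incidentP[b' /dU E].
  by rewrite -E eqxx in fd.
apply/andP; split.
  by rewrite dx; apply/negP => /x_part[] E; rewrite E eqxx in tx.
have -> : is_tree g [set c | connect (adj g A) (inl (endpoint g d)) c].
  set P := [set c | _]; have PE : P = [set inl (inl x)].
    apply/setP => c; rewrite !inE dx; apply/idP/eqP => [/x_part //|->].
    exact: connect0.
  have cP : connected g P.
    rewrite PE; apply/(@connectedP _ _ _ _ _ (inl (inl x))) => [|c]; rewrite inE //.
    by move=> /eqP ->; apply: connect0.
  have dP : inl (inl x) \in P by rewrite PE inE.
  rewrite /is_tree cP /betti1 (n_comp_connected dP cP) PE.
  rewrite (_ : [set f | _] = set0); last by apply/setP => f; rewrite !inE.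
  rewrite (_ : [set v | _] = [set inl x]); last by apply/setP => v; rewrite !inE.
  by rewrite cards0 cards1.
rewrite addTb; apply: cycle_not_tree.
set P := [set c | _].
have PA c : c \in P -> c \in A.
  by rewrite inE; apply: connect_in; rewrite !inE.
have all c : [|| c \in P, c == inl (inl x) | c == inr d.1].
  pose S := [pred c | [|| c \in P, c == inl (inl x) | c == inr d.1]].
  have tP : inl (tgt g d) \in P by rewrite inE connect0.
  have := (connectedP g (in_setT (inl (tgt g d) : cell h n e)) : reflect _ _).
  move/(@elimT _ _)/(_ g_conn)/(_ c (in_setT _)).
  move/(@connect_closed _ _ _ _ S); apply; last by rewrite /= tP.
  move=> c1 c2 c12; rewrite /S /= => /or3P[c1P|/eqP E|/eqP E].
  - have [->|c2d] := eqVneq c2 (inr d.1); first by rewrite !orbT.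
    have c12A : adj g A c1 c2.
      by move: c12; rewrite /adj !inE /= c2d; have := PA _ c1P; rewrite !inE => ->.
    by move: c1P; rewrite !inE => /connect_trans/(_ (connect1 c12A)) ->.
  - rewrite E in c12; case: c2 c12 => [v|f] /and3P[_ _] //.
    by case/incidentP=> b' /dU E'; rewrite -E' /= eqxx !orbT.
  - rewrite E in c12; case: c2 c12 => [v|f] /and3P[_ _] //.
    case/incidentP=> b' vE; have : d.1 = (d.1, b').1 by [].
    case/dart_edge=> Ed; rewrite Ed in vE; last by rewrite -vE tP.
    by rewrite -vE dx eqxx orbT.
have vP : [set v | inl v \in P] \subset [set~ inl x].
  apply/subsetP => v; rewrite !inE => C; apply/eqP => E.
  move: C; rewrite E connect_adjC => /x_part[] E'.
  by rewrite E' eqxx in tx.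
have fP : [set~ d.1] \subset [set f | inr f \in P].
  apply/subsetP => f; rewrite !inE => fd.
  have := all (inr f); rewrite -[_ == inl _]/false orFb => /orP[|/eqP[] E].
    by rewrite inE.
  by rewrite E eqxx in fd.
apply: leq_ltn_trans (subset_leq_card vP) (leq_trans _ (subset_leq_card fP)).
by rewrite !cardsC1 card_sum !card_ord; move: h_gt0 card_e; lia.
Qed.

(** Edges at external vertices are tree-type and tree-type edges are hairs, so hairs and external
    vertices correspond. A hair meets no other tree-type edge at its frame end, which makes these
    ends distinct. *)
Lemma hair_data : exists y : 'I_h -> halfedge e,
  [/\ forall x, endpoint g (y x) = inl x,
      forall f, tree_edge g f <-> exists x, f = (y x).1,
      forall x, is_int (tgt g (y x)) &
      injective (fun x => tgt g (y x))].
Proof.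
have [y yP] := ext_dart; have yE x := (yP x).1; have yU x := (yP x).2.
have tree_y x : tree_edge g (y x).1 := tree_ext (yE x) (yU x).
have H f : tree_edge g f -> exists b x, [/\ (f, b) = y x, is_int (tgt g (y x)) &
    forall f', tree_edge g f' -> incident g (tgt g (y x)) f' -> f' = f].
  move=> fT; have [_ _ _ /forallP/(_ f)/implyP/(_ fT)/andP[_]] := and4P gT.
  case/existsP=> b /and3P[v1 vF /forallP U].
  case E: (endpoint g (f, b)) v1 => [x|v]; last by move/eqP=> v1; have := int_val v; rewrite v1.
  move=> _; have Ey := yU x _ E; exists b, x; rewrite -Ey; split=> //.
    move: vF; rewrite inE -[endpoint _ _]/(tgt g (f, b)); case: (tgt _ _) => // x'.
    by case/existsP=> f' /andP[+ /incidentP[b' /yU Ex']]; rewrite -[f']/((f', b').1) Ex' tree_y.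
  by move=> f' f'T f'I; apply/eqP; have /implyP := U f'; apply; rewrite f'T.
have yI x : is_int (tgt g (y x)).
  have [b [x' [Eb xI _]]] := H _ (tree_y x).
  have : (y x).1 = (y x').1 by rewrite -Eb.
  case/dart_edge=> E; first by rewrite -E.
  by move: xI; rewrite E /tgt rdartK yE.
have ext_eq x x' : (y x).1 = (y x').1 -> y x' = y x.
  case/dart_edge=> E //; have := yE x'; have := yI x.
  by rewrite E -[endpoint g (rdart _)]/(tgt g _) => + E'; rewrite E'.
exists y; split=> //.
- move=> f; split=> [/H[b [x [E _ _]]]|[x ->]]; last exact: tree_y.
  by exists x; rewrite -E.
- move=> x1 x2 /= E; have [b [x [Eb _ U]]] := H _ (tree_y x2).
  have Ex : y x = y x2 by apply: ext_eq; rewrite -Eb.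
  have : y x1 = y x2.
    apply: ext_eq; symmetry; apply: U; first exact: tree_y.
    by rewrite Ex -E -[(y x1).1]/(rdart (y x1)).1 incident_endpoint.
  by move=> E12; have := yE x1; rewrite E12 yE => -[].
Qed.

Section Hairs.
Variable y : 'I_h -> halfedge e.
Hypotheses (yE : forall x, endpoint g (y x) = inl x)
  (yT : forall f, tree_edge g f <-> exists x, f = (y x).1)
  (yI : forall x, is_int (tgt g (y x)))
  (y_inj : injective (fun x => tgt g (y x))).

Let tree_y x : tree_edge g (y x).1. Proof. by apply/yT; exists x. Qed.

Let yU x d : endpoint g d = inl x -> d = y x.
Proof.
have [y' y'P] := ext_dart; have [_ U] := y'P x.
by move=> /U ->; rewrite -(U _ (yE x)).
Qed.

Let F_int d : F d.1 -> is_int (endpoint g d).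
Proof.
by case E: (endpoint g d) => [x|//]; rewrite (yU E) /F tree_y.
Qed.

Let card_hair v : is_int v ->
  #|[set d | (endpoint g d == v) && tree_edge g d.1]| = [exists x, tgt g (y x) == v].
Proof.
move=> vI; have [/existsP[x /eqP xv]|/existsP nx] := boolP [exists x, tgt g (y x) == v].
  rewrite -[RHS](cards1 (rdart (y x))); apply: eq_card => d; rewrite !inE; apply/andP/eqP => [[/eqP dv]|->]; last first.
    by rewrite tree_y -[endpoint _ _]/(tgt g _) xv eqxx.
  move=> /yT[x' E0]; case: (dart_edge (esym E0)) => E; first by move: vI; rewrite -dv E yE.
  have Ex : x' = x by apply: y_inj; rewrite /= xv -dv E.
  by rewrite E Ex.
apply/eqP; rewrite cards_eq0; apply/eqP/setP => d; rewrite !inE; apply/andP => -[/eqP dv].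
move=> /yT[x' E0]; case: (dart_edge (esym E0)) => E; first by move: vI; rewrite -dv E yE.
by apply: nx; exists x'; rewrite -dv E.
Qed.

Let fd_hair v : is_int v -> valence g v = (#|fd v| + [exists x, tgt g (y x) == v])%N.
Proof.
move=> vI; rewrite -(card_hair vI) /valence -(cardsID [set d | F d.1] (star g v)).
congr (_ + _)%N; apply: eq_card => d; rewrite !inE //.
by rewrite andbC negbK.
Qed.

Let fd_gt1 v : is_int v -> (1 < #|fd v|)%N.
Proof.
case: v => // v vI; have := int_val v; rewrite fd_hair //.
by case: [exists _, _]; rewrite ?addn1 ?addn0 // => /ltnW.
Qed.

Let card_tree : #|[set f | tree_edge g f]| = h.
Proof.
have fI : injective (fun x => (y x).1).
  move=> x x' /dart_edge[] E; have := yE x'; rewrite E ?yE => E'; first by case: E'.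
  by have := yI x; rewrite /tgt E'.
rewrite -[RHS]card_ord -(card_imset predT fI); apply: eq_card => f; rewrite inE.
apply/idP/imsetP => [/yT[x ->]|[x _ ->]]; [by exists x|exact: tree_y].
Qed.

(** The half-edges of the frame, which has e - h = n + 1 edges, are counted by their vertices. *)
Let sum_fd : (\sum_(v < n) #|fd (inr v)| = 2 * n.+1)%N.
Proof.
have -> : (\sum_(v < n) #|fd (inr v)| = #|[set d : halfedge e | F d.1]|)%N.
  rewrite -[RHS]sum1_card (partition_big (endpoint g) predT) //= big_sumType /=.
  rewrite [X in (_ = X + _)%N]big1 ?add0n => [|x _]; last first.
    apply: big_pred0 => d; rewrite inE; apply/negP => /andP[dF /eqP dx].
    by have := F_int dF; rewrite dx.
  apply: eq_bigr => v _; rewrite -sum1_card; apply: eq_bigl => d.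
  by rewrite !inE andbC.
pose ds := [seq (f, false) | f <- enum 'I_e].
have pds : perm_eq (map fst ds) (enum 'I_e) by rewrite -map_comp map_id.
have Fc : count F (enum 'I_e) = #|[set f | F f]|.
  by rewrite enumT cardsE cardE /enum_mem size_filter; apply: eq_count.
have E1 : count (fun d => F d.1) ds = count F (enum 'I_e) by rewrite count_map.
have E2 : count (fun d => F d.1) (map (@rdart e) ds) = count F (enum 'I_e).
  by rewrite -map_comp count_map.
rewrite (card_halfedge (fun d => F d.1) pds) E1 E2 Fc addnn -mul2n; congr (2 * _)%N.
have := cardsC [set f | tree_edge g f]; rewrite card_tree card_ord.
rewrite (_ : ~: _ = [set f | F f]); last by apply/setP => f; rewrite !inE.
by move: card_e; lia.
Qed.

Let c v := (#|fd (inr v)| - 2)%N.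
Let cE v : #|fd (inr v)| = (c v + 2)%N.
Proof. by rewrite subnK // fd_gt1. Qed.

(** The total excess of the frame valences over 2 leaves two possibilities: one vertex of frame
    valence 4, or two of frame valence 3. *)
Let sum_c : (\sum_(v < n) c v = 2)%N.
Proof.
have := sum_fd; rewrite (eq_bigr _ (fun v _ => cE v)) big_split /= sum_nat_const card_ord.
by move: (\sum_(v < n) c v)%N => s; lia.
Qed.

Let special : exists u0, (2 < #|fd (inr u0)|)%N.
Proof.
apply/existsP; rewrite -[X in is_true X]negbK; apply/negP => /existsPn H.
have := sum_c; rewrite big1 // => v _; apply/eqP; rewrite subn_eq0 leqNgt.
exact: H.
Qed.

Let F_frame f : (inr f \in frame g) = F f. Proof. by rewrite inE. Qed.

Let int_frame v : is_int v -> inl v \in frame g.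
Proof.
move=> /fd_gt1/ltnW/card_gt0P[d]; rewrite inE => /andP[/eqP <- dF].
by rewrite inE; apply/existsP; exists d.1; rewrite [~~ _]dF incident_endpoint.
Qed.

Let special_int v : (2 < #|fd v|)%N -> is_int v.
Proof.
move/ltnW/ltnW/card_gt0P=> [d]; rewrite inE => /andP[/eqP <-]; exact: F_int.
Qed.

Let no_cut v : is_int v -> connected g (frame g :\ inl v).
Proof.
move=> vI; have [_ _ /forallP/(_ v)] := and4P gT.
by rewrite negb_and int_frame //= negbK.
Qed.

(** Here the absence of cut vertices excludes frames such as the figure eight and the dumbbell. *)
Let good_neq u l v : l != [::] -> (2 < #|fd u|)%N -> good g F u l v -> v != u.
Proof.
move=> l0 su G; apply/eqP => vu; rewrite vu in G.
apply: (good_not_closed (A := frame g :\ inl u) l0 su G).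
- by move=> f; rewrite in_setD1 F_frame.
- by rewrite in_setD1 eqxx.
- exact/no_cut/special_int.
Qed.

Let walk_from u d : (2 < #|fd u|)%N -> d \in fd u ->
  exists l v, [/\ good g F u (d :: l) v, (2 < #|fd v|)%N & v != u].
Proof.
move=> su du; have [|l [v [G sv]]] := good_to_special su du.
  by move=> d' /F_int; apply: fd_gt1.
by exists l, v; split=> //; apply: good_neq G.
Qed.

Let two_special u w : (2 < #|fd u|)%N -> (2 < #|fd w|)%N -> w != u ->
  [/\ #|fd u| = 3%N, #|fd w| = 3%N &
      forall v, is_int v -> v != u -> v != w -> #|fd v| = 2%N].
Proof.
move=> su sw; have := special_int su; have := special_int sw.
case: w sw => // w; case: u su => // u; rewrite !cE => su sw _ _ wu.
have {}wu : w != u by [].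
have := sum_c; rewrite (bigD1 u) //= (bigD1 w) //= => S.
have [E1 [E2 E3]] : c u = 1%N /\ c w = 1%N /\ (\sum_(i < n | (i != u) && (i != w)) c i = 0)%N.
  by move: S; set s := bigop _ _ _; lia.
rewrite E1 E2; split=> // -[//|v] _ vu vw; rewrite cE.
have /eqP := E3; rewrite sum_nat_eq0 => /forallP/(_ v)/implyP.
by rewrite (_ : (v != u) && (v != w)) => [/(_ isT)/eqP ->//|]; apply/andP.
Qed.

(** The three frame half-edges at [u] start three walks, each ending at the only other vertex [w] of
    frame valence 3. They are edge-disjoint by [good_disjoint] and exhaust the frame because it
    stays connected without [u]. *)
Let strands : exists u w ls,
  [/\ [/\ w != u, #|fd u| = 3%N, #|fd w| = 3%N &
        forall v, is_int v -> v != u -> v != w -> #|fd v| = 2%N],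
      size ls = 3%N,
      {in ls, forall l, l != [::] /\ good g F u l w},
      uniq (map fst (flatten ls)) &
      forall f, F f -> f \in map fst (flatten ls)].
Proof.
have [u0 su] := special; set u := inr u0 in su; have uI : is_int u by [].
have [d1 d1u] : exists d, d \in fd u by apply/card_gt0P; do 2 apply: ltnW.
have [l1 [w [G1 sw wu]]] := walk_from su d1u.
have [cu cw c2] := two_special su sw wu.
have wI := special_int sw.
have walk d : d \in fd u -> exists l, good g F u (d :: l) w.
  move=> /(walk_from su)[l [v [G sv vu]]]; exists l.
  have [<-//|vw] := eqVneq v w.
  by have := c2 v (special_int sv) vu vw => E; rewrite E in sv.
have : size (enum (fd u)) = 3%N by rewrite -cardE.
case Eu: (enum (fd u)) => [|x1 [|x2 [|x3 []]]] // _.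
have xU : uniq [:: x1; x2; x3] by rewrite -Eu enum_uniq.
have xu x : x \in [:: x1; x2; x3] = (x \in fd u) by rewrite -Eu mem_enum.
have [m1 H1] : exists l, good g F u (x1 :: l) w by apply: walk; rewrite -xu mem_head.
have [m2 H2] : exists l, good g F u (x2 :: l) w.
  by apply: walk; rewrite -xu !inE eqxx orbT.
have [m3 H3] : exists l, good g F u (x3 :: l) w.
  by apply: walk; rewrite -xu !inE eqxx !orbT.
have uw : u != w by rewrite eq_sym.
have disj x m x' m' : good g F u (x :: m) w -> good g F u (x' :: m') w -> x != x' ->
    ~~ has (mem (map fst (x :: m))) (map fst (x' :: m')).
  move=> G G' xx; apply/hasPn => f /mapP[d' d'm ->]; apply/negP => /mapP[d dm E].
  by case/eqP: xx; apply: (good_disjoint x su sw uw G G' dm d'm).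
move: xU; rewrite /= !inE negb_or andbT => /andP[/andP[x12 x13] x23].
pose ls := [:: x1 :: m1; x2 :: m2; x3 :: m3]; exists u, w, ls.
have lsU : uniq (map fst (flatten ls)).
  have [_ U1 _ _] := H1; have [_ U2 _ _] := H2; have [_ U3 _ _] := H3.
  have -> : flatten ls = (x1 :: m1) ++ (x2 :: m2) ++ (x3 :: m3) by rewrite /ls /= cats0.
  rewrite map_cat cat_uniq U1 map_cat.
  rewrite cat_uniq U2 U3 has_cat negb_or (disj _ _ _ _ H1 H2) // (disj _ _ _ _ H1 H3) //.
  by rewrite (disj _ _ _ _ H2 H3).
have lsG : {in ls, forall l, l != [::] /\ good g F u l w}.
  by move=> l; rewrite !inE => /or3P[]/eqP ->.
split=> // f fF.
set A := frame g :\ inl u; have A_conn : connected g A by apply: no_cut.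
have wA : inl w \in A by rewrite in_setD1 int_frame // andbT.
(* [S] consists of the strands without [u]. It contains [w] and is closed under adjacency in the
   connected set [A], so it contains every frame edge. *)
pose S := [pred c : cell h n e | match c with
  | inl v => (v == w) || has (fun l => v \in map (endpoint g) (behead l)) ls
  | inr f => f \in map fst (flatten ls) end].
have : connect (adj g A) (inl w) (inr f).
  by have /(connectedP g wA) := A_conn; apply; rewrite in_setD1 F_frame.
move/(@connect_closed _ _ _ _ S); apply; last by rewrite /= eqxx.
have lsM l d : l \in ls -> d \in l -> d.1 \in map fst (flatten ls).
  by move=> lls dl; apply: map_f; apply/flattenP; exists l.
move=> [v|f1] [v'|f'] //.
- by move=> /and3P[].
- move=> vf /orP[/eqP vw|/hasP[l lls vl]]; last first.
    have [_ Gl] := lsG l lls.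
    have : f' \in map fst l.
      apply: (good_edge_adj (A := A) (c := inl v) Gl) vf; last exact: map_f.
      by move=> f2; rewrite in_setD1 F_frame.
    by case/mapP=> d dl ->; apply: lsM dl.
  rewrite vw in vf; have [_ f'A /incidentP[b bw]] := and3P vf.
  have f'w : (f', b) \in fd w.
    by rewrite inE bw eqxx; move: f'A; rewrite in_setD1 F_frame.
  have last_w x m : x :: m \in ls -> rdart (last x m) \in fd w.
    move=> xm; have [_ [W _ mF _]] := lsG _ xm.
    rewrite -(@walk_last_dart _ _ _ g _ (x :: m) _ x isT W) mem_fd_tgt //.
    exact/mF/mem_last.
  (* The reversed last darts are three distinct frame half-edges at [w], hence all of them; so every
     frame edge at [w] lies on a strand. *)
  pose Z := [set rdart (last x1 m1); rdart (last x2 m2); rdart (last x3 m3)].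
  have last_neq x m x' m' : x :: m \in ls -> x' :: m' \in ls -> x != x' ->
      rdart (last x m) != rdart (last x' m').
    move=> xm xm' xx; rewrite (inj_eq (can_inj (@rdartK e))); apply/eqP => E.
    have [_ G] := lsG _ xm; have [_ G'] := lsG _ xm'.
    have mx : (last x m).1 \in map fst (x' :: m') by rewrite E; apply/map_f/mem_last.
    have /hasPn/(_ _ mx)/negP := disj _ _ _ _ G G' xx.
    by apply; apply/map_f/mem_last.
  have i1 : x1 :: m1 \in ls by rewrite mem_head.
  have i2 : x2 :: m2 \in ls by rewrite !inE eqxx orbT.
  have i3 : x3 :: m3 \in ls by rewrite !inE eqxx !orbT.
  have : Z == fd w.
    rewrite eqEcard cw; apply/andP; split.
      by apply/subsetP => z; rewrite !inE -orbA => /or3P[]/eqP ->;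
        [have := last_w _ _ i1|have := last_w _ _ i2|have := last_w _ _ i3]; rewrite inE.
    rewrite /Z setUC cardsU1 !inE negb_or cards2 (last_neq _ _ _ _ i1 i2) //.
    by rewrite (last_neq _ _ _ _ i3 i1) ?(last_neq _ _ _ _ i3 i2) // eq_sym.
  move/eqP=> EZ; move: f'w; rewrite -EZ !inE -orbA.
  by case/or3P=> /eqP/(congr1 fst) /= ->; [apply: (lsM _ _ i1)|apply: (lsM _ _ i2)|
    apply: (lsM _ _ i3)]; apply: mem_last.
- move=> fv /mapP[d /flattenP[l lls dl] E]; rewrite E in fv.
  have [_ Gl] := lsG l lls; have v'A : inl v' \in A by case/and3P: fv.
  have [E'|->|vl] := good_vertex_adj Gl dl fv.
  - by move: v'A; rewrite E' in_setD1 eqxx.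
  - by rewrite /= eqxx.
  - by apply/orP; right; apply/hasP; exists l.
- by move=> /and3P[].
Qed.

Lemma theta_of_hairs : exists u w ls hs a b, theta g u w ls hs a b.
Proof.
have [u [w [ls [[wu cu cw c2] ls3 lsG lsU lsF]]]] := strands.
have uI : is_int u by apply: special_int; rewrite cu.
have wI : is_int w by apply: special_int; rewrite cw.
pose hs := map y (enum 'I_h).
pose B := flatten (map behead ls).
have IE : flatten (map (inner g) ls) = map (endpoint g) B.
  by rewrite map_flatten -map_comp.
have BP d : d \in B -> exists2 l, l \in ls & d \in behead l.
  by move=> /flattenP[_ /mapP[l lls ->] dl]; exists l.
have lsB d : d \in B -> d \in flatten ls.
  by move=> /BP[l lls dl]; apply/flattenP; exists l; rewrite // mem_behead.
have B2 d : d \in B -> #|fd (endpoint g d)| = 2%N.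
  by move=> /BP[l lls dl]; have [_ [_ _ _]] := lsG l lls; apply.
have ls_F d : d \in flatten ls -> F d.1.
  by move=> /flattenP[l lls dl]; have [_ [_ _ + _]] := lsG l lls; apply.
have BU : uniq B.
  apply: (@subseq_uniq _ _ (flatten ls)); last exact: map_uniq lsU.
  rewrite /B; elim: (ls) => //= l s IH; apply: cat_subseq => //.
  by case: l => //= d l; apply: subseq_cons.
have B_inj : {in B &, injective (endpoint g)}.
  move=> d d' dB d'B E; apply/eqP; apply: contraTT isT => dd'.
  have [l lls dl] := BP d dB; have [_ [W U _ _]] := lsG l lls.
  have [z [zl zt zd _]] := walk_prev W U dl.
  have zls : z \in flatten ls by apply/flattenP; exists l.
  have zv : rdart z \in fd (endpoint g d) by rewrite -zt mem_fd_tgt ?ls_F.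
  have dv : d \in fd (endpoint g d) by rewrite mem_fd ?ls_F ?lsB.
  have dv' : d' \in fd (endpoint g d) by rewrite E mem_fd ?ls_F ?lsB.
  have dz : d != rdart z by apply: contraNneq zd => ->.
  case: (fd2P (B2 d dB) dv zv dz dv') => E'; first by rewrite E' eqxx in dd'.
  have /eqP[] := rdart_neq z; rewrite -E'.
  by apply: (uniq_map_inj lsU) => //; [apply: lsB|rewrite E'].
have uB : u \notin map (endpoint g) B.
  by apply/mapP => -[d /B2 + E]; rewrite -E cu.
have wB : w \notin map (endpoint g) B.
  by apply/mapP => -[d /B2 + E]; rewrite -E cw.
have IU : uniq (u :: w :: flatten (map (inner g) ls)).
  by rewrite IE /= inE negb_or uB wB eq_sym wu map_inj_in_uniq.
have Imem v : is_int v = (v \in u :: w :: flatten (map (inner g) ls)).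
  rewrite IE !inE; apply/idP/or3P => [vI|[/eqP->//|/eqP->//|/mapP[d dB ->]]]; last first.
    by apply: F_int; apply: ls_F; apply: lsB.
  have [->|vu] := eqVneq v u; first by constructor.
  have [->|vw] := eqVneq v w; first by constructor.
  constructor 3; have /ltnW/card_gt0P[x] := fd_gt1 vI; rewrite inE => /andP[/eqP xv xF].
  have /mapP[d dls /esym/dart_edge Ed] := lsF _ xF.
  have /flattenP[l lls dl] := dls; have [l0 [W U _ _]] := lsG l lls.
  case: Ed => Ed; rewrite -xv Ed.
    apply: map_f; apply/flattenP; exists (behead l); first exact: map_f.
    case: (l) dl W => // d0 l' dl W; move: dl; rewrite inE => /predU1P[E|//].
    by case/eqP: vu; rewrite -xv Ed E; apply: walk_head W.
  have [[E _]|[d' [d'l E _]]] := walk_next W U dl.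
    by case/eqP: vw; rewrite -xv Ed.
  rewrite -[endpoint _ _]/(tgt g d) -E.
  by apply: map_f; apply/flattenP; exists (behead l); rewrite ?map_f.
pose a := u \in map (tgt g) hs; pose b := w \in map (tgt g) hs.
exists u, w, ls, hs, a, b; split=> //.
- by move=> l lls; have [l0 [W _ _ _]] := lsG l lls.
- apply: uniq_perm => //; first by rewrite map_inj_uniq ?enum_uniq // => ? ? [].
  move=> v; rewrite -Imem; case: v => [x|v] /=; last by rewrite map_f ?mem_enum.
  by apply/esym/negP => /mapP[].
- apply: uniq_perm; rewrite ?enum_uniq //.
    rewrite map_cat cat_uniq lsU /=; apply/andP; split.
      apply/hasPn => f /mapP[_ /mapP[x _ ->] ->]; apply/negP => /mapP[d /ls_F + E].
      by rewrite /F -E tree_y.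
    rewrite -map_comp map_inj_uniq ?enum_uniq // => x x' /=.
    move=> /dart_edge[] E; have := yE x'; rewrite E ?yE => E'; first by case: E'.
    by have := yI x; rewrite /tgt E'.
  move=> f; rewrite mem_enum map_cat mem_cat.
  have [fT|/lsF->//] := boolP (tree_edge g f).
  have /yT[x ->] := fT; apply/orP; right; apply: map_f; apply: map_f.
  by rewrite mem_enum.
- by rewrite -map_comp; rewrite (eq_map (g := inl)).
- have hsU : uniq (map (tgt g) hs) by rewrite -map_comp map_inj_uniq ?enum_uniq.
  apply: uniq_perm => //.
    move: IU; rewrite /= inE negb_or => /and3P[/andP[uw uI'] wI' I_uniq].
    by case: (a); case: (b); rewrite /= ?inE ?negb_or ?uw ?uI' ?wI' ?I_uniq.
  move=> v; rewrite !mem_cat !mem_nseq; apply/idP/idP.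
    move=> vh; have : is_int v by case/mapP: vh => _ /mapP[x _ ->] ->.
    rewrite Imem !inE => /or3P[/eqP vu|/eqP vw|->]; last by rewrite !orbT.
      by rewrite /a -vu vh eqxx.
    by rewrite /b -vw vh eqxx orbT.
  case/or3P=> [/andP[+ /eqP->]|/andP[+ /eqP->]|vI].
  - by rewrite /a; case: (_ \in _).
  - by rewrite /b; case: (_ \in _).
  (* An interior vertex of a strand has frame valence 2 and valence at least 3, so it carries a
     hair. *)
  have vint : is_int v by rewrite Imem !inE vI !orbT.
  have v2 : #|fd v| = 2%N by move: vI; rewrite IE => /mapP[d /B2 + ->].
  case: v vint vI v2 => // v vint _ v2.
  have := int_val v; rewrite (fd_hair vint) v2; case: existsP => // -[x /eqP <-] _.
  by rewrite -map_comp; apply: (map_f (tgt g \o y)); rewrite mem_enum.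
Qed.

End Hairs.

Lemma two_loop_hairy_theta : exists u w ls hs a b, theta g u w ls hs a b.
Proof. by have [y [yE yT yI y_inj]] := hair_data; apply: theta_of_hairs y_inj. Qed.

End TwoLoopTheta.

(** At interior vertices the next dart is forced, and neither walk can stop before [w] or pass
    through it, as [w] does not have frame valence 2. *)
Lemma good_det h n e (g : graph h n e) F u w d l l' :
  (2 < #|fd g F w|)%N -> good g F u (d :: l) w -> good g F u (d :: l') w -> l = l'.
Proof.
move=> sw; elim: l l' u d => [|y l IH] [|y' l'] u d // G G'.
- have [/andP[_ /= /eqP dw] _ _ _] := G; have [/andP[_ /andP[/eqP yd _]] _ _ l2] := G'.
  by have := l2 y' (mem_head _ _); rewrite yd dw => c2; rewrite c2 in sw.
- have [/andP[_ /= /eqP dw] _ _ _] := G'; have [/andP[_ /andP[/eqP yd _]] _ _ l2] := G.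
  by have := l2 y (mem_head _ _); rewrite yd dw => c2; rewrite c2 in sw.
have tail u1 d1 y1 l1 : good g F u1 [:: d1, y1 & l1] w ->
    [/\ good g F (tgt g d1) (y1 :: l1) w, endpoint g y1 = tgt g d1, F d1.1, F y1.1 & y1.1 != d1.1].
  move=> [/andP[_ W] U lF l2]; split.
  - split=> //; first by case/andP: U.
      by move=> x xl; apply: lF; rewrite inE xl orbT.
    by move=> x xl; apply: l2; rewrite [behead _]/= inE xl orbT.
  - by case/andP: W => /eqP.
  - by apply: lF; rewrite mem_head.
  - by apply: lF; rewrite !inE eqxx orbT.
  - by case/andP: U; rewrite /= inE negb_or eq_sym => /andP[].
have [_ _ _ l2] := G; have c2 := l2 y (mem_head _ _).
have [Gt yt dF yF yd] := tail _ _ _ _ G; have [Gt' yt' _ yF' yd'] := tail _ _ _ _ G'.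
have E : y' = y.
  have dv : rdart d \in fd g F (endpoint g y) by rewrite yt mem_fd_tgt.
  have yv : y \in fd g F (endpoint g y) by rewrite mem_fd.
  have yv' : y' \in fd g F (endpoint g y) by rewrite yt -yt' mem_fd.
  have ne : rdart d != y by apply: contraNneq yd => <-.
  by case: (fd2P c2 dv yv ne yv') => // E; rewrite E eqxx in yd'.
by rewrite E in Gt' *; rewrite (IH l' _ _ Gt Gt').
Qed.

Lemma uniq_flatten (X : eqType) (ss : seq (seq X)) :
  {in ss, forall s, s != [::]} -> uniq (flatten ss) -> uniq ss.
Proof.
elim: ss => //= s ss IH H; rewrite cat_uniq => /and3P[us /hasPn sd uss].
rewrite IH ?andbT //; last by move=> s' s's; apply: H; rewrite inE s's orbT.
apply/negP => sss; case: s H us sd sss => [/(_ [::] (mem_head _ _))//|x s] H us sd sss.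
have := sd x; rewrite /= mem_head => /(_ _)/negP; apply=> //.
by apply/flattenP; exists (x :: s); rewrite ?mem_head.
Qed.

(** * Isomorphisms of Theta-graphs and their signs *)

Section Rigidity.
Variables h n e : nat.
Variable g : graph h n e.
Let F f := ~~ tree_edge g f.
Notation fd := (fd g F).

Section OneTheta.
Variables (u w : vertex h n) (ls : seq (seq (halfedge e))).
Variables (hs : seq (halfedge e)) (a b : bool).
Hypothesis T : theta g u w ls hs a b.

Lemma theta_F f : F f = (f \in map fst (flatten ls)).
Proof. by have := theta_mem_frame T (inr f); rewrite inE. Qed.

Lemma theta_card_fd v : is_int v ->
  #|fd v| = if (v == u) || (v == w) then 3%N else 2%N.
Proof.
move=> vI.
have -> : #|fd v| = (count (fun d => (endpoint g d == v) && F d.1) (flatten ls ++ hs) +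
    count (fun d => (endpoint g d == v) && F d.1) (map (@rdart e) (flatten ls ++ hs)))%N.
  exact: (card_halfedge (fun d => (endpoint g d == v) && F d.1) (th_edge T)).
have hs0 d : d \in hs -> F d.1 = false.
  by move=> dhs; rewrite /F (tree_edge_hair T dhs).
have ls1 d : d \in flatten ls -> F d.1 by move=> dls; rewrite theta_F map_f.
rewrite map_cat !count_cat.
rewrite (@eq_in_count _ (fun d => (endpoint g d == v) && F d.1) pred0 hs); last first.
  by move=> d /hs0 ->; rewrite andbF.
rewrite (@eq_in_count _ (fun d => (endpoint g d == v) && F d.1) pred0 (map _ hs)); last first.
  by move=> _ /mapP[d /hs0 + ->] /= => ->; rewrite andbF.
rewrite !count_pred0 !addn0.
have -> : count (fun d => (endpoint g d == v) && F d.1) (flatten ls) =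
    count_mem v (map (endpoint g) (flatten ls)).
  by rewrite count_map; apply: eq_in_count => d /ls1 -> /=; rewrite andbT.
have -> : count (fun d => (endpoint g d == v) && F d.1) (map (@rdart e) (flatten ls)) =
    count_mem v (map (tgt g) (flatten ls)).
  by rewrite !count_map; apply: eq_in_count => d /ls1 /= ->; rewrite andbT.
rewrite (permP (theta_src_perm T)) (permP (theta_tgt_perm T)).
rewrite !count_cat !count_nseq /=.
have := count_uniq_mem v (theta_int_uniq T); rewrite 2!in_cons -(theta_intE T) vI /=.
by rewrite !(eq_sym v); case: (u == v); case: (w == v); rewrite /=; lia.
Qed.

Lemma theta_uw : u != w.
Proof. by have := theta_int_uniq T; rewrite /= inE negb_or => /andP[/andP[]]. Qed.

Lemma theta_fd_u : #|fd u| = 3%N.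
Proof. by rewrite theta_card_fd ?(theta_u_int T) // eqxx. Qed.

Lemma theta_fd_w : #|fd w| = 3%N.
Proof. by rewrite theta_card_fd ?(theta_w_int T) // eqxx orbT. Qed.

Lemma theta_special v : (2 < #|fd v|)%N -> v = u \/ v = w.
Proof.
move=> sv; have vI : is_int v.
  have /ltnW/ltnW/card_gt0P[d] := sv; rewrite inE theta_F => /andP[/eqP <-].
  case/mapP=> d' d'ls /esym/dart_edge[] E; have [I1 I2] := theta_frame_int T d'ls.
    by rewrite E.
  by rewrite E.
move: sv; rewrite theta_card_fd //.
by case: eqP => [->|_]; [left|case: eqP => [->|//]; right].
Qed.

Lemma theta_good l : l \in ls -> good g F u l w.
Proof.
move=> lls; have [l0 W] := th_walk T lls; split=> //.
- have [l' [l'' [_ T']]] := theta_to_front T lls.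
  by have := theta_edge_uniq T'; rewrite /= -catA map_cat cat_uniq => /andP[].
- by move=> d dl; rewrite theta_F map_f // (mem_strand_frame lls).
move=> d dl; have [dI _] := theta_strand_int T lls (mem_behead dl).
have := theta_strand_uniq T lls; rewrite rcons_cons /= mem_rcons inE negb_or rcons_uniq.
case/and3P=> /andP[_ uI] wI _.
have di : endpoint g d \in inner g l by apply: map_f.
have du : endpoint g d != u by apply: contraNneq uI => <-.
have dw : endpoint g d != w by apply: contraNneq wI => <-.
by rewrite theta_card_fd // (negbTE du) (negbTE dw).
Qed.

Lemma theta_head d : d \in fd u -> exists2 l, (d :: l) \in ls & True.
Proof.
have su : (2 < #|fd u|)%N by rewrite theta_fd_u.
rewrite inE theta_F => /andP[/eqP du /mapP[d' d'ls /esym E]].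
have /flattenP[l lls d'l] := d'ls; have [W U _ l2] := theta_good lls.
have not_u x : x \in behead l -> endpoint g x != u.
  by move=> xl; apply/eqP => xu; have := l2 x xl; rewrite xu => c2; rewrite c2 in su.
case/dart_edge: E => E.
  case: l lls d'l {W U} l2 not_u => // x l lls; rewrite inE -E => /predU1P[Ex|dl] _ nu.
    by exists l; rewrite // Ex.
  by have := nu d dl; rewrite du eqxx.
have tu : tgt g d' = u by rewrite -du E.
have [[t _]|[x [xl xt _]]] := walk_next W U d'l.
  by have := theta_uw; rewrite -t tu eqxx.
by have := not_u x xl; rewrite xt tu eqxx.
Qed.

Lemma theta_ls_uniq : uniq ls.
Proof.
apply: uniq_flatten; first by move=> l /(th_walk T)[].
by have := theta_edge_uniq T; rewrite map_cat cat_uniq => /andP[/map_uniq].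
Qed.

End OneTheta.

(** With [u] fixed, [w] is the other vertex of frame valence 3. A strand is determined by its first
    half-edge and a hair by its external vertex. *)
Lemma theta_rigid1 u w w' ls ls' hs hs' a b a' b' :
  theta g u w ls hs a b -> theta g u w' ls' hs' a' b' ->
  [/\ w' = w, a' = a, b' = b, perm_eq ls ls' & perm_eq hs hs'].
Proof.
move=> T T'.
have E : w' = w.
  have := theta_uw T'; have [//| ->|//] := theta_special T (v := w').
    by rewrite (theta_fd_w T').
  by rewrite eqxx.
rewrite E in T' *; have uw := theta_uw T.
have uI := theta_u_int T; have wI := theta_w_int T.
have Ea : a' = a.
  have := theta_valence T u; rewrite (theta_valence T') uI eqxx eq_sym (negbTE uw).
  by case: (a); case: (a'); rewrite /= ?andbF.
have Eb : b' = b.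
  have := theta_valence T w; rewrite (theta_valence T') wI eqxx (negbTE uw).
  by case: (b); case: (b'); rewrite /= ?andbF.
split=> //.
  have sub : {subset ls' <= ls}.
    move=> l' l'ls; have [l0 _] := th_walk T' l'ls; have G' := theta_good T' l'ls.
    case: l' l0 G' l'ls => // d l' _ G' l'ls.
    have du : d \in fd u.
      have [/andP[/eqP <- _] _ lF _] := G'; apply: mem_fd; apply: lF; exact: mem_head.
    have [l lls _] := theta_head T du.
    have sw : (2 < #|fd w|)%N by rewrite (theta_fd_w T).
    by rewrite -(good_det sw (theta_good T lls) G').
  rewrite perm_sym; apply: uniq_perm; rewrite ?(theta_ls_uniq T) ?(theta_ls_uniq T') //.
  have := uniq_min_size (theta_ls_uniq T') sub.
  by rewrite (th_size T) (th_size T') => /(_ isT)[].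
apply: uniq_perm.
- by have := theta_edge_uniq T; rewrite map_cat cat_uniq => /and3P[_ _ /map_uniq].
- by have := theta_edge_uniq T'; rewrite map_cat cat_uniq => /and3P[_ _ /map_uniq].
have sub ls1 ls2 hs1 hs2 a1 a2 b1 b2 : theta g u w ls1 hs1 a1 b1 ->
    theta g u w ls2 hs2 a2 b2 -> {subset hs1 <= hs2}.
  move=> T1 T2 d dhs; have [+ _] := theta_hair_ext T1 dhs.
  case E1: (endpoint g d) => [x|//] _; have [d' d'hs E2] := theta_ext_hair T2 x.
  by rewrite (theta_ext_unique T2 d'hs (y := d)) // E1 E2.
by move=> d; apply/idP/idP; [apply: sub T T' d|apply: sub T' T d].
Qed.

(** The end vertices are the vertices of frame valence 3, so [u'] is [u] or [w]; [theta_flip]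
    reduces the second case to the first. *)
Lemma theta_rigid u w u' w' ls ls' hs hs' a b a' b' :
  theta g u w ls hs a b -> theta g u' w' ls' hs' a' b' ->
  [/\ u' = u, a' = a, b' = b, perm_eq ls ls' & perm_eq hs hs'] \/
  [/\ u' = w, a' = b, b' = a, perm_eq (map (@rstrand e) ls) ls' & perm_eq hs hs'].
Proof.
move=> T T'; have [|E|E] := theta_special T (v := u').
- by rewrite (theta_fd_u T').
- by left; rewrite E in T'; have [_ -> -> ? ?] := theta_rigid1 T T'.
- by right; rewrite E in T'; have [_ -> -> ? ?] := theta_rigid1 (theta_flip T) T'.
Qed.

End Rigidity.

Section ListBijections.

Lemma perm_eq_map (X Y : eqType) (f : X -> Y) (s : seq X) (t : seq Y) :
  perm_eq t (map f s) -> exists2 s', t = map f s' & perm_eq s' s.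
Proof.
case: s => [|x0 s] p; first by exists [::] => //; apply/perm_nilP.
have /(perm_iotaP (f x0)) [Is pI ->] := p; rewrite size_map in pI.
exists (map (nth x0 (x0 :: s)) Is); last by apply/(perm_iotaP x0); exists Is.
rewrite -map_comp; apply/eq_in_map => i; rewrite (perm_mem pI) mem_iota leq0n add0n => ilt.
by rewrite /= -(nth_map x0 (f x0)).
Qed.

Lemma bij_of_lists (k k' : nat) (s : seq 'I_k) (s' : seq 'I_k') :
  perm_eq s (enum 'I_k) -> perm_eq s' (enum 'I_k') -> size s = size s' ->
  exists2 f : 'I_k -> 'I_k', bijective f & map f s = s'.
Proof.
move=> ps ps' E.
have kk : k = k' by rewrite -[k]size_enum_ord -[k']size_enum_ord -(perm_size ps) -(perm_size ps').
case: k' / kk s' ps' E => s' ps' E.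
have us : uniq s by rewrite (perm_uniq ps) enum_uniq.
have us' : uniq s' by rewrite (perm_uniq ps') enum_uniq.
have ms x : x \in s by rewrite (perm_mem ps) mem_enum.
have ms' x : x \in s' by rewrite (perm_mem ps') mem_enum.
exists (fun x => nth x s' (index x s)).
  exists (fun x => nth x s (index x s')) => x.
    rewrite index_uniq ?us' -?E ?index_mem // (set_nth_default x) ?index_mem //.
    exact: nth_index.
  rewrite index_uniq ?us ?E ?index_mem // (set_nth_default x) ?index_mem //.
  exact: nth_index.
case: s' E us' {ps' ms'} => [|x0 s'] E us'; first by apply/nilP; rewrite /nilp size_map E.
apply: (@eq_from_nth _ x0); rewrite size_map // => i ilt.
rewrite (nth_map x0) // index_uniq // (set_nth_default x0) // -E //.
Qed.

End ListBijections.

Section SignChange.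
Variable T : eqType.
Variable r : T -> nat.
Hypothesis r_inj : injective r.

(* A strand with an even number of edges commutes with the other strands. *)
Definition odd_sign (s : seq nat) : bool := inv_parity id (filter odd s).

Lemma odd_size_flatten (ls : seq (seq T)) :
  odd (size (flatten ls)) = odd (size (filter odd (map size ls))).
Proof.
elim: ls => //= l ls IH; rewrite size_cat oddD IH.
by case: ifP => //= ->.
Qed.

(** Exchanging neighbouring blocks of strands changes both summands by the product of the parities
    of the block sizes, so the sum does not depend on the order of the strands. For [odd_sign] to
    register the exchange, the odd lengths have to be distinct. *)
Lemma inv_parity_strands (ls ls' : seq (seq T)) :
  uniq (flatten ls) -> uniq (filter odd (map size ls)) -> perm_eq ls ls' ->
  inv_parity r (flatten ls') (+) odd_sign (map size ls') =
  inv_parity r (flatten ls) (+) odd_sign (map size ls).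
Proof.
move=> u1 u2 p; pose P (ss : seq (seq T)) := uniq (flatten ss) && uniq (filter odd (map size ss)).
pose H (ss : seq (seq T)) := P ss && (inv_parity r (flatten ss) (+) odd_sign (map size ss)).
have Pp (s1 s2 : seq (seq T)) : perm_eq s1 s2 -> P s1 = P s2.
  move=> p12; rewrite /P (perm_uniq (perm_flatten p12)).
  by rewrite (perm_uniq (perm_filter odd (perm_map size p12))).
suff E : H ls = H ls' by move: E; rewrite /H -(Pp _ _ p) /P u1 u2.
move: p; apply: (catCA_perm_subst (F := H)) => a b c.
rewrite /H (Pp (b ++ a ++ c) (a ++ b ++ c)); last by rewrite perm_catCA.
case: (boolP (P _)) => //= /andP[].
rewrite !map_cat !flatten_cat !filter_cat; set A := flatten a; set B := flatten b.
set A' := filter odd (map size a); set B' := filter odd (map size b).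
have disj (X : eqType) (s1 s2 s3 : seq X) : uniq (s1 ++ s2 ++ s3) ->
    {in s1 & s2, forall x y, x != y}.
  rewrite cat_uniq has_cat negb_or => /and3P[_ /andP[/hasPn D _] _] x y xs ys.
  by apply: contraTneq xs => ->; apply: D.
move=> /disj AB /disj AB'; rewrite /odd_sign !filter_cat !inv_parity_cat !cross_parity_catr -/A' -/B'.
rewrite (@cross_parityC _ r A B) => [|x y xA yB]; last first.
  by apply: contra_neq (AB x y xA yB) => /r_inj.
rewrite (@cross_parityC _ id A' B') //.
by rewrite !odd_size_flatten -/A' -/B'; case: (_ && _); xorb.
Qed.

End SignChange.

Section ThetaSign.
Variable G : ograph.
Let g := ends G.
Hypothesis oU : uniq (orient_order G).
Hypothesis oA : forall c, c \in orient_order G.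

Lemma order_inj : injective (index^~ (orient_order G)).
Proof. by move=> c d E; rewrite -(nth_index c (oA c)) E nth_index. Qed.

Lemma strand_sign_perm u w ls ls' hs a b : theta g u w ls hs a b ->
  uniq (filter odd (map size ls)) -> perm_eq ls ls' ->
  strand_sign ls' hs (+) odd_sign (map size ls') = strand_sign ls hs (+) odd_sign (map size ls).
Proof.
move=> T U p; have := sgl_uniq T; rewrite /strand_sign /orient_list cat_uniq => /andP[U1 _].
pose f (d : halfedge (n_edge G)) : cell (n_ext G) (n_int G) (n_edge G) := inr d.1.
have sz (ss : seq (seq (halfedge (n_edge G)))) :
    map size (map (map f) ss) = map size ss.
  by rewrite -map_comp; apply: eq_map => s; rewrite /= size_map.
rewrite -/f !inv_parity_cat.
rewrite (cross_parity_perml _ _ (perm_map f (perm_flatten p))) addbAC [RHS]addbAC.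
congr (_ (+) _); rewrite addbAC [RHS]addbAC; congr (_ (+) _).
rewrite -(sz ls) -(sz ls') !map_flatten; apply: inv_parity_strands.
- exact: order_inj.
- by rewrite -map_flatten.
- by rewrite sz.
- exact: perm_map.
Qed.

Lemma sg_perm_hs u w ls hs hs' a b : theta g u w ls hs a b -> perm_eq hs hs' ->
  strand_sign ls hs' = strand_sign ls hs.
Proof.
move=> T p; have := sgl_uniq T; rewrite /strand_sign /orient_list cat_uniq => /and3P[_ _ U].
rewrite !inv_parity_cat; set F := fun d => _.
rewrite (inv_parity_flatten_perm order_inj _ U p) //; congr (_ (+) _).
by apply: cross_parity_permr; apply: perm_flatten; apply: perm_map; rewrite perm_sym.
Qed.

(* Exchanging the end vertices reverses the block of edges of each strand,
   which is a permutation of sign (-1) ^ 'C(x, 2) on a strand of x edges. *)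
Definition flip_sign (s : seq nat) : bool := \big[addb/false]_(x <- s) odd 'C(x, 2).

Lemma sg_flip u w ls hs a b : theta g u w ls hs a b ->
  strand_sign (map (@rstrand _) ls) hs = strand_sign ls hs (+) flip_sign (map size ls).
Proof.
move=> T; have := sgl_uniq T; rewrite /strand_sign /orient_list cat_uniq => /andP[U1 _].
pose f (d : halfedge (n_edge G)) : cell (n_ext G) (n_int G) (n_edge G) := inr d.1.
have p : perm_eq (map f (flatten (map (@rstrand _) ls))) (map f (flatten ls)).
  elim: (ls) => //= l s IH; rewrite !map_cat perm_cat //.
  by rewrite /rstrand map_rev -map_comp perm_rev perm_map.
rewrite -/f !inv_parity_cat (cross_parity_perml _ _ p).
suff -> : inv_parity (index^~ (orient_order G)) (map f (flatten (map (@rstrand _) ls))) =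
    inv_parity (index^~ (orient_order G)) (map f (flatten ls)) (+) flip_sign (map size ls) by xorb.
rewrite -/f in U1; rewrite /flip_sign big_map; elim: (ls) U1 {p T} => [|l s IH].
  by rewrite big_nil.
rewrite /= !map_cat cat_uniq => /and3P[U2 _ U3]; rewrite !inv_parity_cat big_cons IH //.
have p : perm_eq (map f (flatten (map (@rstrand _) s))) (map f (flatten s)).
  elim: (s) => //= l' s' IH'; rewrite !map_cat perm_cat //.
  by rewrite /rstrand map_rev -map_comp perm_rev perm_map.
have E : map f (rstrand l) = rev (map f l) by rewrite /rstrand map_rev -map_comp.
rewrite E (cross_parity_permr _ _ p) (cross_parity_perml _ _ (permEl (perm_rev (map f l)))).
rewrite inv_parity_rev // ?size_map; first by rewrite addbACA addbAC.
by move=> x y _ _; apply: contra_neq => /order_inj.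
Qed.

End ThetaSign.

Definition oriented (G : ograph) : bool :=
  uniq (orient_order G) && [forall c, c \in orient_order G].

Lemma theta_admissible (G : ograph) u w ls hs a b : (0 < n_ext G)%N -> oriented G ->
  theta (ends G) u w ls hs a b -> admissible G.
Proof.
by move=> h0 /andP[oU oA] T; rewrite /admissible (theta_graph_ok T h0) oU oA.
Qed.

Lemma admissible_oriented G : admissible G -> oriented G.
Proof. by case/and3P=> _ oU oA; apply/andP. Qed.

Lemma endpoint_dart h n e (g : graph h n e) f :
  g f = (endpoint g (f, false), endpoint g (f, true)).
Proof. by rewrite /endpoint /=; case: (g f). Qed.

Section Flips.
Variables m N : nat.
Hypothesis N_even : ~~ odd N.

Definition flips (G : ograph) (X : seq 'I_(n_edge G)) : ograph :=
  OGraph [ffun f => if f \in X then ((ends G f).2, (ends G f).1) else ends G f]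
    (orient_order G).
Arguments flips : clear implicits.

Variable G : ograph.
Let g := ends G.
Hypothesis h0 : (0 < n_ext G)%N.
Hypothesis Go : oriented G.

Lemma flips_endpoint X d :
  endpoint (ends (flips G X)) (dmap id (mem X) d) = vertex_map id id (endpoint g d).
Proof.
have -> v : vertex_map id id v = v by case: v.
case: d => f b; rewrite /endpoint /= ffunE /=.
by case: (f \in X); case: b.
Qed.

Lemma flips_theta X u w ls hs a b : theta g u w ls hs a b ->
  theta (ends (flips G X)) u w (map (map (dmap id (mem X))) ls)
    (map (dmap id (mem X)) hs) a b.
Proof.
have V v : vertex_map id id v = v :> vertex (n_ext G) (n_int G) by case: v.
have id_bij T : bijective (@id T) by exists id.
move=> T; rewrite -(V u) -(V w).
by apply: theta_map T; rewrite ?id_bij //; apply: flips_endpoint.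
Qed.

Lemma flips_ceq X u w ls hs a b : theta g u w ls hs a b -> uniq X ->
  ceq m N (gen (flips G X)) (gen G).
Proof.
move=> T; elim: X => [|f X IH] /=.
  move=> _; suff -> : flips G [::] = G by apply: ceq_refl.
  rewrite /flips; case: (G) => h n e gg o /=; congr OGraph.
  by apply/ffunP => f; rewrite ffunE.
case/andP=> fX uX; apply: ceq_trans (IH uX).
have -> : flips G (f :: X) = @flip (flips G X) f.
  rewrite /flip /flips /=; congr OGraph; apply/ffunP => f'; rewrite !ffunE inE.
  by case: eqP => [->|_] //=; rewrite (negbTE fX).
have A : admissible (flips G X).
  exact: (theta_admissible (G := flips G X) h0 Go (flips_theta X T)).
have /zero_class_rel := @RelFlip m N (flips G X) f A.
by rewrite -signr_odd (negbTE N_even) expr0 scale1r.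
Qed.

End Flips.
Arguments flips : clear implicits.

Lemma cell_map_id h n e (c : cell h n e) : cell_map id id id c = c.
Proof. by case: c => [[x|v]|f]. Qed.

Lemma flips_sg (G : ograph) X ls hs :
  strand_sign (G := flips G X) (map (map (dmap id (mem X))) ls) (map (dmap id (mem X)) hs) =
  strand_sign (G := G) ls hs.
Proof.
rewrite /strand_sign (sgl_dmap (g := ends G) (fx := id) (fi := id)); last first.
  exact: flips_endpoint.
by rewrite (eq_map (@cell_map_id _ _ _)) map_id.
Qed.

Section Isomorphism.
Variables m N : nat.
Hypotheses (N_gt0 : (0 < N)%N) (N_even : ~~ odd N) (m_odd : odd m).

Lemma theta_src_eq h n e (g : graph h n e) u w ls hs a b : theta g u w ls hs a b ->
  map (endpoint g) (flatten ls) = flatten (map (cons u) (map (inner g) ls)).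
Proof.
move/th_walk; elim: ls => //= l ls IH H; rewrite map_cat IH.
  by have [l0 W] := H l (mem_head _ _); rewrite (walk_src l0 W).
by move=> l' l'ls; apply: H; rewrite inE l'ls orbT.
Qed.

Lemma theta_tgt_eq h n e (g : graph h n e) u w ls hs a b : theta g u w ls hs a b ->
  map (tgt g) (flatten ls) = flatten (map (rcons^~ w) (map (inner g) ls)).
Proof.
move/th_walk; elim: ls => //= l ls IH H; rewrite map_cat IH.
  by have [l0 W] := H l (mem_head _ _); rewrite (walk_tgt l0 W).
by move=> l' l'ls; apply: H; rewrite inE l'ls orbT.
Qed.

Lemma map_eq_flatten (X Y : eqType) (f : X -> Y) (s : seq (seq X)) (t : seq (seq Y)) :
  shape s = shape t -> map f (flatten s) = flatten t -> map (map f) s = t.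
Proof.
elim: s t => [|x s IH] [|y t] //= [E1 E2]; rewrite map_cat => /eqP.
by rewrite eqseq_cat ?size_map // => /andP[/eqP -> /eqP/(IH _ E2) ->].
Qed.

Section TwoGraphs.
Variables G G' : ograph.
Let g := ends G.
Let g' := ends G'.
Hypotheses (h0' : (0 < n_ext G')%N) (h0 : (0 < n_ext G)%N) (Go : oriented G) (Go' : oriented G').
Variables (u w : vertex (n_ext G) (n_int G)).
Variables (u' w' : vertex (n_ext G') (n_int G')).
Variables (ls : seq (seq (halfedge (n_edge G)))) (hs : seq (halfedge (n_edge G))).
Variables (ls' : seq (seq (halfedge (n_edge G')))) (hs' : seq (halfedge (n_edge G'))).
Variables a b : bool.
Hypotheses (T : theta g u w ls hs a b) (T' : theta g' u' w' ls' hs' a b).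
Hypothesis same_shape : map size ls = map size ls'.

(** When all darts follow their edges and the hairs are listed in the order of their end vertices,
    matching the lists entry by entry gives an isomorphism of graphs. Only the orders of the
    orientation sets may then differ, and [koszulE] compares them through [orient_list]. *)
Lemma theta_iso_directed :
  all (fun d => ~~ d.2) (flatten ls ++ hs) ->
  all (fun d => ~~ d.2) (flatten ls' ++ hs') ->
  map (tgt g) hs = nseq a u ++ nseq b w ++ flatten (map (inner g) ls) ->
  map (tgt g') hs' = nseq a u' ++ nseq b w' ++ flatten (map (inner g') ls') ->
  ceq m N (gen G') ((-1) ^+ (strand_sign ls hs (+) strand_sign ls' hs') *: gen G).
Proof.
move=> dirG dirG' hsG hsG'.
have shI : shape (map (inner g) ls) = shape (map (inner g') ls').
  have sz k n e (gg : graph k n e) ss : shape (map (inner gg) ss) = map predn (map size ss).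
    rewrite /shape -!map_comp; apply: eq_map => l.
    by rewrite /= /inner size_map size_behead.
  by rewrite !sz same_shape.
have szI : size (flatten (map (inner g) ls)) = size (flatten (map (inner g') ls')).
  by rewrite !size_flatten shI.
have [vs vsE pvs] := perm_eq_map (th_int T).
have [vs' vsE' pvs'] := perm_eq_map (th_int T').
have [xs xsE pxs] := perm_eq_map (th_ext T).
have [xs' xsE' pxs'] := perm_eq_map (th_ext T').
have szh : size hs = size hs'.
  by rewrite (theta_size_hs T) (theta_size_hs T') (theta_h T) (theta_h T') szI.
have szf : size (flatten ls) = size (flatten ls').
  by rewrite !size_flatten /shape same_shape.
have [fi bfi fiE] : exists2 f, bijective f & map f vs = vs'.
  apply: bij_of_lists => //.
  by have := congr1 size vsE; have := congr1 size vsE'; rewrite /= 2!size_map szI => <- <-.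
have [fx bfx fxE] : exists2 f, bijective f & map f xs = xs'.
  apply: bij_of_lists => //.
  by have := congr1 size xsE; have := congr1 size xsE'; rewrite 4!size_map szh => <- <-.
have [fe bfe feE] : exists2 f, bijective f &
    map f (map fst (flatten ls ++ hs)) = map fst (flatten ls' ++ hs').
  apply: bij_of_lists; [exact: th_edge T|exact: th_edge T'|].
  by rewrite !size_map !size_cat szf szh.
pose V := vertex_map fx fi.
have VI : map V (u :: w :: flatten (map (inner g) ls)) =
    u' :: w' :: flatten (map (inner g') ls').
  by rewrite vsE vsE' -fiE -!map_comp.
have [Vu Vw VIn] : [/\ V u = u', V w = w' & map V (flatten (map (inner g) ls)) =
    flatten (map (inner g') ls')] by case: VI.
have Vls := map_eq_flatten shI VIn.
have Vsrc : map V (map (endpoint g) (flatten ls ++ hs)) =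
    map (endpoint g') (flatten ls' ++ hs').
  rewrite !map_cat (theta_src_eq T) (theta_src_eq T') -Vls xsE xsE' -fxE; congr (_ ++ _).
    by rewrite map_flatten -!map_comp; congr flatten; apply: eq_map => l /=; rewrite Vu.
  by rewrite -!map_comp.
have Vtgt : map V (map (tgt g) (flatten ls ++ hs)) =
    map (tgt g') (flatten ls' ++ hs').
  rewrite !map_cat (theta_tgt_eq T) (theta_tgt_eq T') hsG hsG' -VIn -Vls; congr (_ ++ _).
    by rewrite map_flatten -!map_comp; congr flatten; apply: eq_map => l /=;
      rewrite map_rcons Vw.
  by rewrite !map_cat !map_nseq Vu Vw.
set ds := flatten ls ++ hs in dirG feE Vsrc Vtgt *.
set ds' := flatten ls' ++ hs' in dirG' feE Vsrc Vtgt *.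
have szd : size ds = size ds' by rewrite !size_cat szf szh.
have iso f : g' (fe f) = (V (g f).1, V (g f).2).
  have [d dds <-] := theta_edgeP T f; have ilt : (index d ds < size ds)%N by rewrite index_mem.
  pose d' := nth (fe d.1, false) ds' (index d ds).
  have nthE X (f1 : halfedge (n_edge G) -> X) (f2 : halfedge (n_edge G') -> X) :
      map f1 ds = map f2 ds' -> f1 d = f2 d'.
    move=> /(congr1 (fun s => nth (f1 d) s (index d ds))).
    rewrite (nth_map d) // nth_index // => ->.
    by rewrite (nth_map (fe d.1, false)) -?szd.
  have E1 : fe d.1 = d'.1 by apply: (nthE _ (fun d => fe d.1)); rewrite -feE -map_comp.
  have E2 : V (endpoint g d) = endpoint g' d'.
    by apply: (nthE _ (fun d => V (endpoint g d))); rewrite -Vsrc -map_comp.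
  have E3 : V (tgt g d) = tgt g' d'.
    by apply: (nthE _ (fun d => V (tgt g d))); rewrite -Vtgt -map_comp.
  have d'ds : d' \in ds' by rewrite mem_nth // -szd.
  have := allP dirG d dds; have := allP dirG' d' d'ds; rewrite E1.
  move: E2 E3; case: (d) (d') => fd [] [fd' []] //=.
  rewrite /tgt /rdart /= => E2 E3 _ _; rewrite !endpoint_dart /=.
  by rewrite E2 E3.
pose cm := cell_map fx fi fe.
have [/andP[oU /forallP oA] /andP[oU' /forallP oA']] := (Go, Go').
have cmI : injective cm by apply: cell_map_inj; apply: bij_inj.
have cm_onto c : exists c0, cm c0 = c.
  have [[[fx' _ fxK] [fi' _ fiK]] [fe' _ feK]] := (bfx, bfi, bfe).
  case: c => [[x|v]|f].
  - by exists (inl (inl (fx' x))); rewrite /cm /= fxK.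
  - by exists (inl (inr (fi' v))); rewrite /cm /= fiK.
  - by exists (inr (fe' f)); rewrite /cm /= feK.
(* The graph of [G'] with the order transported from [G]: it is isomorphic to [G], and [G'] is a
   reordering of it. *)
pose G2 := @OGraph (n_ext G') (n_int G') (n_edge G') (ends G') (map cm (orient_order G)).
have G2o : oriented G2.
  rewrite /oriented /= map_inj_uniq // oU; apply/forallP => c.
  by have [c0 <-] := cm_onto c; apply: map_f.
have R1 : ceq m N (gen G2) (gen G).
  apply: zero_class_rel; apply: RelIso; first exact: theta_admissible h0 Go T.
  by exists fx, fi, fe; split.
have oP : perm_eq (orient_order G') (orient_order G2).
  apply: uniq_perm => //; first by case/andP: G2o.
  by move=> c; rewrite oA'; have /andP[_ /forallP/(_ c) ->] := G2o.
have R2 : ceq m N (gen G') (koszul m N (orient_order G2) (orient_order G') *: gen G2).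
  have A2 : admissible G2 := theta_admissible (G := G2) h0' G2o T'.
  have := zero_class_rel (RelOrder m N A2 oP).
  have eta (H : ograph) : OGraph (ends H) (orient_order H) = H by case: H.
  by rewrite /ceq /reorder /= eta.
apply: ceq_trans R2 (ceq_trans (ceqZ _ R1) _).
have G2A c : c \in orient_order G2 by have /andP[_ /forallP/(_ c)] := G2o.
rewrite (koszulE N_gt0 N_even m_odd G2A oA' (sgl_uniq T') (mem_sgl T')).
suff -> : inv_parity (index^~ (orient_order G2)) (orient_list g' ls' hs') = strand_sign ls hs.
  exact: ceq_refl.
have -> : orient_list g' ls' hs' = map cm (orient_list g ls hs).
  rewrite /orient_list map_cat; congr (_ ++ _).
    have : map (fun d => fe d.1) (flatten ls) = map fst (flatten ls').
      move: feE; rewrite /ds /ds' !map_cat => /eqP; rewrite eqseq_cat ?size_map //.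
      by case/andP=> /eqP <- _; rewrite -map_comp.
    by move=> E; rewrite -map_comp (map_comp inr fst) -E -map_comp.
  have E1 : map (fun d => fe d.1) hs = map fst hs'.
    move: feE; rewrite /ds /ds' !map_cat => /eqP; rewrite eqseq_cat ?size_map //.
    by case/andP=> _ /eqP <-; rewrite -map_comp.
  have E2 : map (fun d => V (endpoint g d)) hs = map (endpoint g') hs'.
    by rewrite xsE' -fxE -map_comp (map_comp V (endpoint g)) xsE -map_comp.
  rewrite map_flatten -map_comp; congr flatten.
  move: szh E1 E2; elim: (hs) (hs') => [|d s IH] [|d' s'] //= [sz] [E1 E1'] [E2 E2'].
  by rewrite IH // -E1 -E2; case: (endpoint g d).
rewrite inv_parity_map /strand_sign; apply: eq_isgn_lt => x y _ _.
by rewrite /= !index_map.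
Qed.

End TwoGraphs.

(** Edges traversed against their orientation are reversed, and the hairs are listed anew; for even
    N neither changes the class or the relative orientation. *)
Lemma theta_direct (G : ograph) u w ls hs a b :
  (0 < n_ext G)%N -> oriented G -> theta (ends G) u w ls hs a b ->
  exists X ls1 hs1, let G1 := flips G X in
  [/\ theta (ends G1) u w ls1 hs1 a b, map size ls1 = map size ls,
      all (fun d => ~~ d.2) (flatten ls1 ++ hs1),
      map (tgt (ends G1)) hs1 =
        nseq a u ++ nseq b w ++ flatten (map (inner (ends G1)) ls1) &
      ceq m N (gen G1) (gen G) /\ strand_sign (G := G1) ls1 hs1 = strand_sign ls hs].
Proof.
move=> h0 Go T; have := th_hair T; rewrite perm_sym.
case/perm_eq_map=> hs0 E phs; have {}phs : perm_eq hs hs0 by rewrite perm_sym.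
have T0 := theta_perm (perm_refl ls) phs T.
pose X := [seq d.1 | d <- flatten ls ++ hs0 & d.2].
pose D := dmap id (mem X) : halfedge (n_edge G) -> halfedge (n_edge G).
have T1 := flips_theta X T0.
have XP d : d \in flatten ls ++ hs0 -> (d.1 \in X) = d.2.
  move=> dds; apply/mapP/idP => [[d']|d2]; last by exists d; rewrite // mem_filter d2.
  by rewrite mem_filter => /andP[d'2 d'ds] /(theta_edge_inj T0 dds d'ds) ->.
have V v : vertex_map id id v = v :> vertex (n_ext G) (n_int G) by case: v.
have tD d : tgt (ends (flips G X)) (D d) = tgt (ends G) d.
  by rewrite (tgt_dmap (@flips_endpoint G X)) V.
have iD l : inner (ends (flips G X)) (map D l) = inner (ends G) l.
  by rewrite (inner_dmap (@flips_endpoint G X)) (eq_map V) map_id.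
exists X, (map (map D) ls), (map D hs0); split=> //.
- by rewrite -map_comp; apply: eq_map => l; rewrite /= size_map.
- rewrite -map_flatten -map_cat all_map; apply/allP => d dds.
  by rewrite /= XP // addbb.
- rewrite -map_comp (eq_map tD) -E -map_comp; congr (_ ++ (_ ++ flatten _)).
  by apply: eq_map => l; rewrite /= iD.
split; last first.
  rewrite [LHS](flips_sg X ls hs0).
  have [/andP[oU /forallP oA]] := Go; exact: sg_perm_hs T phs.
apply: (flips_ceq _ N_even h0 Go T0); rewrite /X.
apply: (@subseq_uniq _ _ (map fst (flatten ls ++ hs0))); last exact: theta_edge_uniq T0.
exact/map_subseq/filter_subseq.
Qed.

Lemma theta_ceq (G G' : ograph) u w u' w' ls ls' hs hs' a b :
  (0 < n_ext G)%N -> (0 < n_ext G')%N -> oriented G -> oriented G' ->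
  theta (ends G) u w ls hs a b -> theta (ends G') u' w' ls' hs' a b ->
  map size ls = map size ls' ->
  ceq m N (gen G') ((-1) ^+ (strand_sign ls hs (+) strand_sign ls' hs') *: gen G).
Proof.
move=> h0 h0' Go Go' T T' E.
have [X [ls1 [hs1 [T1 S1 D1 H1 [C1 <-]]]]] := theta_direct h0 Go T.
have [X' [ls1' [hs1' [T1' S1' D1' H1' [C1' <-]]]]] := theta_direct h0' Go' T'.
apply: ceq_trans (ceq_sym C1') (ceq_trans _ (ceqZ _ C1)).
apply: (theta_iso_directed (G := flips G X) (G' := flips G' X') h0' h0 Go Go' T1 T1') => //.
by rewrite S1 S1'.
Qed.

End Isomorphism.

Lemma inv_parity_min (X : eqType) (r : X -> nat) x s :
  {in s, forall y, (r x <= r y)%N} -> inv_parity r (x :: s) = inv_parity r s.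
Proof.
move=> H; rewrite /= (@eq_in_count _ _ pred0) ?count_pred0 // => y ys /=.
by rewrite ltnNge H.
Qed.

(** * Splittings *)

Section SplitTheta.
Variable G : ograph.
Let g := ends G.
Hypothesis Go : oriented G.
Variables (u0 : 'I_(n_int G)) (w : vertex (n_ext G) (n_int G)).
Notation u := (inr u0 : vertex (n_ext G) (n_int G)).
Variables (d1 d2 d3 dh : halfedge (n_edge G)) (l1 l2 l3 hs : seq (halfedge (n_edge G))).
Variable b : bool.
Notation ls := [:: d1 :: l1; d2 :: l2; d3 :: l3].
Hypothesis T : theta g u w ls hs true b.
Hypotheses (dh_hs : dh \in hs) (dh_u : tgt g dh = u).
Variables (B : {set halfedge (n_edge G)}) (beta : bool).
Hypothesis BS : {in B, forall d, endpoint g d = u}.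
Hypotheses (Bh : (rdart dh \in B) = beta) (B1 : (d1 \in B) = beta)
  (B2 : (d2 \in B) = ~~ beta) (B3 : (d3 \in B) = ~~ beta).

Let G1 := split_at u0 B.
Let g1 : graph (n_ext G) (n_int G).+1 (n_edge G).+1 := ends G1.

Definition lift_dart k (d : halfedge k) : halfedge k.+1 := (lift ord0 d.1, d.2).
Notation L := (@lift_dart (n_edge G)).
Let lv : vertex (n_ext G) (n_int G) -> vertex (n_ext G) (n_int G).+1 :=
  vertex_map id (lift ord0).
Let nu : vertex (n_ext G) (n_int G).+1 := inr ord0.
(** After the splitting, [p] has the hair and the first strand, while [q] has the other two strands;
    [beta] tells whether the moved block is the one at [p]. *)
Let p := if beta then nu else lv u.
Let q := if beta then lv u else nu.

Let split_endpoint d : endpoint g1 (L d) = if d \in B then nu else lv (endpoint g d).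
Proof.
rewrite /g1 /G1 /split_at /split_graph /endpoint /= ffunE liftK.
by case: d => f [].
Qed.

Let split_endpoint_neq d : endpoint g d != u -> endpoint g1 (L d) = lv (endpoint g d).
Proof.
by rewrite split_endpoint; case: ifP => // /BS ->; rewrite eqxx.
Qed.

Let rdart_L d : rdart (L d) = L (rdart d). Proof. by []. Qed.

Let split_tgt_neq d : tgt g d != u -> tgt g1 (L d) = lv (tgt g d).
Proof. by rewrite /tgt rdart_L; apply: split_endpoint_neq. Qed.

Let new_src : endpoint g1 (ord0, false) = lv u.
Proof. by rewrite /g1 /endpoint /= ffunE unlift_none. Qed.

Let new_tgt : endpoint g1 (ord0, true) = nu.
Proof. by rewrite /g1 /endpoint /= ffunE unlift_none. Qed.

Let uI := theta_int_uniq T.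

Let tgt_u d : d \in flatten ls -> tgt g d != u.
Proof.
move=> dls; have := map_f (tgt g) dls; rewrite (perm_mem (theta_tgt_perm T)) mem_cat mem_nseq.
move: uI; rewrite /= inE negb_or => /andP[/andP[uw uI'] _].
by case/orP=> [/eqP ->|H]; [rewrite eq_sym|apply: contraNneq uI' => <-].
Qed.

Let src_u d : [|| d \in l1, d \in l2 | d \in l3] -> endpoint g d != u.
Proof.
move=> dl; move: uI; rewrite /= inE negb_or => /andP[/andP[_ +] _].
apply: contraNneq => <-; rewrite /inner /= !cats0 !mem_cat.
by case/or3P: dl => /(map_f (endpoint g)) ->; rewrite ?orbT.
Qed.

Let walk_split x l y : walk g x l y -> {in l, forall d, endpoint g d != u /\ tgt g d != u} ->
  walk g1 (lv x) (map L l) (lv y).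
Proof.
elim: l x => [|d l IH] x /=; first by move=> /eqP ->.
case/andP=> /eqP <- W H; have [H1 H2] := H d (mem_head _ _).
rewrite split_endpoint_neq // eqxx split_tgt_neq //=; apply: IH => // d' d'l.
by apply: H; rewrite inE d'l orbT.
Qed.

Let walk_strand d l : walk g u (d :: l) w -> d :: l \in ls ->
  {in l, forall d, endpoint g d != u} -> walk g1 (lv (tgt g d)) (map L l) (lv w).
Proof.
case/andP=> _ W lls H; apply: walk_split => // d' d'l; split; first exact: H.
by apply: tgt_u; apply/flattenP; exists (d :: l); rewrite // inE d'l orbT.
Qed.

Let ls1 := [:: (ord0, ~~ beta) :: map L (d1 :: l1); map L (d2 :: l2); map L (d3 :: l3)].

Let inner_split l : {in l, forall d, endpoint g d != u} ->
  map (endpoint g1) (map L l) = map lv (map (endpoint g) l).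
Proof.
move=> H; rewrite -!map_comp; apply/eq_in_map => d dl.
by rewrite /= split_endpoint_neq // H.
Qed.

Let src1 : {in l1, forall d, endpoint g d != u}.
Proof. by move=> d dl; apply: src_u; rewrite dl. Qed.
Let src2 : {in l2, forall d, endpoint g d != u}.
Proof. by move=> d dl; apply: src_u; rewrite dl orbT. Qed.
Let src3 : {in l3, forall d, endpoint g d != u}.
Proof. by move=> d dl; apply: src_u; rewrite dl !orbT. Qed.

Let d_src : [/\ endpoint g d1 = u, endpoint g d2 = u & endpoint g d3 = u].
Proof.
have H := th_walk T.
have [_ /andP[/eqP E1 _]] := H (d1 :: l1) (mem_head _ _).
have [|_ /andP[/eqP E2 _]] := H (d2 :: l2); first by rewrite !inE eqxx orbT.
have [|_ /andP[/eqP E3 _]] := H (d3 :: l3); first by rewrite !inE eqxx !orbT.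
by [].
Qed.

Let innerE : flatten (map (inner g1) ls1) = p :: map lv (flatten (map (inner g) ls)).
Proof.
have [E1 _ _] := d_src.
rewrite /ls1 /inner /= !cats0 !inner_split // split_endpoint B1 E1 -/p.
by rewrite !map_cat.
Qed.

(** The new edge becomes the first edge of the first strand: it leads from the end vertex [q] to
    [p], now an interior vertex carrying the hair formerly at [u]. *)
Lemma split_theta : theta g1 q (lv w) ls1 (map L hs) false b.
Proof.
have [E1 E2 E3] := d_src; have H := th_walk T.
have i1 : d1 :: l1 \in ls by rewrite mem_head.
have i2 : d2 :: l2 \in ls by rewrite !inE eqxx orbT.
have i3 : d3 :: l3 \in ls by rewrite !inE eqxx !orbT.
have tl d l : d :: l \in ls -> tgt g d != u.
  by move=> dl; apply: tgt_u; apply/flattenP; exists (d :: l); rewrite ?mem_head.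
split=> //.
- move=> l; rewrite !inE => /or3P[]/eqP ->; split=> //.
  + have [_ W] := H _ i1.
    rewrite [map L _]/= /= /tgt /rdart /= negbK.
    have -> : endpoint g1 (ord0, ~~ beta) = q.
      by rewrite /q; case: (beta) => //=; rewrite ?new_src ?new_tgt.
    have -> : endpoint g1 (ord0, beta) = p.
      by rewrite /p; case: (beta) => //=; rewrite ?new_src ?new_tgt.
    rewrite split_endpoint B1 E1 -/p !eqxx /= -/(tgt g1 (L d1)) split_tgt_neq ?(tl _ _ i1) //.
    exact: walk_strand.
  + have [_ W] := H _ i2.
    rewrite /= split_endpoint B2 E2 split_tgt_neq ?(tl _ _ i2) // walk_strand // andbT.
    by rewrite /q; case: (beta); rewrite eqxx.
  + have [_ W] := H _ i3.
    rewrite /= split_endpoint B3 E3 split_tgt_neq ?(tl _ _ i3) // walk_strand // andbT.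
    by rewrite /q; case: (beta); rewrite eqxx.
- rewrite innerE.
  have -> : map inr (enum 'I_(n_int G).+1) = nu :: map lv (map inr (enum 'I_(n_int G)))
      :> seq (vertex (n_ext G) (n_int G).+1).
    by rewrite enum_ordSl /= -!map_comp.
  have := perm_map lv (th_int T); rewrite -(perm_cons nu) => P.
  apply: perm_trans P; rewrite /p /q /=; case: (beta); last by rewrite perm_cons (perm_catCA [:: _] [:: _]).
  rewrite perm_sym (perm_catCA [:: nu] [:: lv u]) perm_cons.
  by rewrite (perm_catCA [:: nu] [:: lv w]).
- have E : flatten ls1 ++ map L hs = (ord0, ~~ beta) :: map L (flatten ls ++ hs).
    by rewrite /ls1 [in RHS]map_cat [in RHS]map_flatten.
  have E' : map fst (map L (flatten ls ++ hs)) = map (lift ord0) (map fst (flatten ls ++ hs)).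
    by rewrite -!map_comp.
  by rewrite enum_ordSl E map_cons E' perm_cons perm_map // (th_edge T).
- rewrite -map_comp (@eq_in_map _ _ _ (lv \o endpoint g) hs).1; last first.
    move=> d dhs; rewrite /= split_endpoint_neq //.
    by have [] := theta_hair_ext T dhs; case: (endpoint g d).
  rewrite map_comp; apply: perm_trans (perm_map lv (th_ext T)) _.
  by rewrite -map_comp.
- rewrite innerE /=; pose phi v := if v == u then p else lv v.
  rewrite -map_comp (@eq_in_map _ _ _ (phi \o tgt g) hs).1; last first.
    move=> d dhs; rewrite /phi /=; case: eqP => [du|/eqP du]; last exact: split_tgt_neq.
    rewrite (theta_hair_inj T dhs dh_hs); last by rewrite du.
    by rewrite /tgt rdart_L split_endpoint Bh -/(tgt g dh) dh_u.
  rewrite map_comp; apply: perm_trans (perm_map phi (th_hair T)) _.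
  rewrite /= {1}/phi eqxx map_cat perm_sym perm_catC /= perm_cons perm_sym perm_catC.
  move: uI; rewrite /= inE negb_or => /andP[/andP[uw uI'] _].
  apply: perm_cat.
    rewrite (@eq_in_map _ _ phi lv _).1 // => v vI; rewrite /phi; case: eqP => // vu.
    by rewrite vu in vI; rewrite vI in uI'.
  by rewrite map_nseq /phi eq_sym (negbTE uw).
Qed.

Lemma split_oriented : oriented G1.
Proof.
have [oU /forallP oA] := andP Go.
have cI : injective (cell_map id (lift ord0) (lift ord0)
    : cell (n_ext G) (n_int G) (n_edge G) -> cell _ (n_int G).+1 (n_edge G).+1).
  by apply: cell_map_inj => //; apply: lift_inj.
apply/andP; split.
  rewrite /= inE negb_or /= map_inj_uniq // oU andbT; apply/andP; split.
    by apply/mapP => -[[[x|v]|f] _ //= [] /eqP]; rewrite -(inj_eq val_inj).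
  by apply/mapP => -[[[x|v]|f] _ //= [] /eqP]; rewrite -(inj_eq val_inj).
apply/forallP => -[[x|v]|f]; rewrite !inE /=.
- by apply: (map_f _ (oA (inl (inl x)))).
- case: (unliftP ord0 v) => [v' ->|->]; last by rewrite eqxx.
  by rewrite (map_f (cell_map id (lift ord0) (lift ord0)) (oA (inl (inr v')))) ?orbT.
- case: (unliftP ord0 f) => [f' ->|->]; last by rewrite eqxx.
  by rewrite (map_f (cell_map id (lift ord0) (lift ord0)) (oA (inr f'))) ?orbT.
Qed.

(** The new vertex has even degree, and the new edge is first among the odd cells both in the
    orientation and along the strands, so no inversion is added, whichever block is moved. *)
Lemma split_sg : strand_sign (G := G1) ls1 (map L hs) = strand_sign ls hs.
Proof.
have [oU /forallP oA] := andP Go.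
set cm := (cell_map id (lift ord0) (lift ord0)
    : cell (n_ext G) (n_int G) (n_edge G) -> cell _ (n_int G).+1 (n_edge G).+1).
have cI : injective cm by apply: cell_map_inj => //; apply: lift_inj.
have E : orient_list g1 ls1 (map L hs) = inr ord0 :: map cm (orient_list g ls hs).
  rewrite /orient_list map_cat -cat_cons; congr (_ ++ _).
    have EF : flatten ls1 = (ord0, ~~ beta) :: map L (flatten ls).
      by rewrite /ls1 [in RHS]map_flatten.
    by rewrite EF map_cons -!map_comp.
  rewrite map_flatten -!map_comp; congr flatten; apply/eq_in_map => d dhs /=.
  have [+ _] := theta_hair_ext T dhs; rewrite -/g.
  case Ed: (endpoint g d) => [x|//] _.
  by rewrite split_endpoint_neq Ed.
have oE c : index (cm c) (orient_order G1) = (index c (orient_order G)).+2.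
  have n1 : inl (inr ord0) != cm c.
    by clear; case: c => [[x|v]|f] //; apply/eqP => -[] /eqP; rewrite -(inj_eq val_inj).
  have n2 : inr ord0 != cm c.
    by clear; case: c => [[x|v]|f] //; apply/eqP => -[] /eqP; rewrite -(inj_eq val_inj).
  by rewrite [orient_order G1]/= [index _ _]/= (negbTE n1) (negbTE n2) index_map.
rewrite /strand_sign -/g1 E inv_parity_min; last by move=> _ /mapP[c _ ->]; rewrite oE.
rewrite inv_parity_map; apply: eq_isgn_lt => x y _ _.
by rewrite [(_ \o _) x]oE [(_ \o _) y]oE.
Qed.

End SplitTheta.

Section SetSplittings.
Variable X : finType.
Implicit Types (S A B : {set X}) (P : {set {set X}}).

Definition splits P S : bool :=
  [&& partition P S, #|P| == 2%N & [forall B in P, (2 <= #|B|)%N]].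

Lemma splits_small P S : (#|S| < 4)%N -> splits P S = false.
Proof.
move=> S4; apply/negP => /and3P[pP /eqP P2 /forall_inP H].
have := card_partition pP; have : (\sum_(A in P) 2 <= \sum_(A in P) #|A|)%N.
  by apply: leq_sum.
by rewrite sum_nat_const P2 => + E; rewrite -E; move: S4; lia.
Qed.

Lemma splits_pair S A : A \subset S -> #|A| = 2%N -> #|S| = 4%N ->
  splits [set A; S :\: A] S.
Proof.
move=> AS A2 S4; have D2 : #|S :\: A| = 2%N.
  by have := cardsID A S; rewrite (setIidPr AS) A2 S4; lia.
have AD : A != S :\: A.
  apply: contra_eq_neq A2 => E; have : A :&: A = set0.
    by rewrite {1}E; apply/setP => x; rewrite !inE; case: (x \in A); rewrite ?andbF.
  by rewrite setIid => ->; rewrite cards0.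
apply/and3P; split; last 2 first.
- by rewrite cards2 AD.
- by apply/forall_inP => B; rewrite !inE => /orP[]/eqP ->; rewrite ?A2 ?D2.
apply/and3P; split.
- rewrite /cover bigcup_setU !big_set1 setDE setUIr setUCr setIT.
  by rewrite eqEsubset subUset AS subxx subsetUr.
- apply/trivIsetP => B C; rewrite !inE => /orP[]/eqP -> /orP[]/eqP -> //;
    rewrite ?eqxx // => _; rewrite -setI_eq0; apply/eqP/setP => x; rewrite !inE;
    by case: (x \in A); rewrite ?andbF.
- rewrite !inE !(eq_sym set0) -!cards_eq0 A2 D2 //.
Qed.

Lemma splitsP S h P : #|S| = 4%N -> h \in S -> splits P S ->
  exists2 x, x \in S :\ h & P = [set [set h; x]; S :\: [set h; x]].
Proof.
move=> S4 hS /and3P[pP /eqP P2 /forall_inP H].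
have hc : h \in cover P by rewrite (cover_partition pP).
set B := pblock P h; have BP : B \in P by apply: pblock_mem.
have hB : h \in B by rewrite mem_pblock.
have BS : B \subset S by rewrite -(cover_partition pP); apply: (bigcup_sup (F := id) _ BP).
have P1 : #|P :\ B| = 1%N by have := cardsD1 B P; rewrite BP P2 add1n => -[<-].
have /eqP/cards1P[C EC] := P1.
have CE : C = S :\: B.
  by have := cover_partition (partitionD1 pP BP); rewrite EC cover1.
have PE : P = [set B; S :\: B] by rewrite -CE -(setD1K BP) EC.
have DP : S :\: B \in P by rewrite PE !inE eqxx orbT.
have B2 : #|B| = 2%N.
  by have := cardsID B S; rewrite (setIidPr BS) S4; have := H _ BP; have := H _ DP; lia.
have /eqP/cards1P[x Ex] : #|B :\ h| = 1%N by have := cardsD1 h B; rewrite hB B2 add1n => -[<-].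
exists x; last by rewrite {1}PE -(setD1K hB) Ex.
have : x \in B :\ h by rewrite Ex inE.
by rewrite !in_setD1 => /andP[-> /(subsetP BS) ->].
Qed.

(** Four half-edges have three partitions into pairs, indexed by the partner of [h], which will be
    the half-edge of the hair. *)
Lemma sum_splits (V : nmodType) (F : {set {set X}} -> V) h x1 x2 x3 :
  uniq [:: h; x1; x2; x3] -> let S := [set h; x1; x2; x3] in
  let P x := [set [set h; x]; S :\: [set h; x]] in
  \sum_(Q | splits Q S) F Q = F (P x1) + F (P x2) + F (P x3).
Proof.
move=> U S P; have SE x : (x \in S) = (x \in [:: h; x1; x2; x3]) by rewrite !inE -!orbA.
have S4 : #|S| = 4%N by rewrite (eq_card SE); apply/card_uniqP.
have hS : h \in S by rewrite SE mem_head.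
have hx x : x \in [:: x1; x2; x3] -> x != h.
  by move: U; rewrite cons_uniq => /andP[hn _] xs; apply: contraNneq hn => <-.
have PI : {in [:: x1; x2; x3] &, injective P}.
  move=> x y xs ys E; have xS : x \in S by rewrite SE inE xs orbT.
  have : [set h; x] \in P y by rewrite -E !inE eqxx.
  rewrite !inE => /orP[]/eqP Exy.
    have : x \in [set h; y] by rewrite -Exy !inE eqxx orbT.
    by rewrite !inE (negbTE (hx x xs)) => /eqP.
  have : h \in S :\: [set h; y] by rewrite -Exy !inE eqxx.
  by rewrite !inE eqxx.
rewrite (eq_bigl [pred Q | Q \in map P [:: x1; x2; x3]]) => [|Q].
  rewrite -big_uniq; first by rewrite /= !big_cons big_nil addr0 addrA.
  rewrite (map_inj_in_uniq PI).
  by move: U; rewrite cons_uniq => /andP[].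
apply/idP/mapP => [sQ|[x xs ->]].
  have [x xS ->] := splitsP S4 hS sQ; exists x => //.
  by case/setD1P: xS => /negbTE xh; rewrite SE (in_cons h) xh.
apply: splits_pair => //; first by
  rewrite subUset !sub1set hS SE inE xs orbT.
by rewrite cards2 eq_sym hx.
Qed.

End SetSplittings.

Lemma splitting_splits (G : ograph) v P :
  @splitting G v P = splits P (star (ends G) (inr v)).
Proof. by []. Qed.

(* Graphs with a parametrization whose strands have the lengths listed in s;
   o is the orientation relative to the order of the strands. *)
Definition has_theta (G : ograph) (a b : bool) (s : seq nat) (o : bool) : Prop :=
  exists (u w : vertex (n_ext G) (n_int G)) (ls : seq (seq (halfedge (n_edge G))))
    (hs : seq (halfedge (n_edge G))),
    [/\ theta (ends G) u w ls hs a b, map size ls = s & strand_sign ls hs = o].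

Section SplitSum.
Variable G : ograph.
Let g := ends G.
Hypothesis Go : oriented G.
Implicit Types (l hs : seq (halfedge (n_edge G))).

Lemma heads_uniq u w d1 l1 d2 l2 d3 l3 hs a b :
  theta g u w [:: d1 :: l1; d2 :: l2; d3 :: l3] hs a b ->
  uniq (map fst [:: d1; d2; d3]).
Proof.
move=> T; have := theta_edge_uniq T; rewrite map_cat cat_uniq => /andP[+ _].
apply: subseq_uniq; apply: map_subseq.
have s1 d l : subseq [:: d] (d :: l) by rewrite sub1seq mem_head.
by do 3 apply: (@cat_subseq _ [:: _]) => //; apply: s1.
Qed.

(* Splitting off the hair at u together with the first half-edge of the first
   strand prolongs this strand by the new edge. *)
Lemma split_one u0 w x1 x2 x3 hs b dh :
  theta g (inr u0) w [:: x1; x2; x3] hs true b -> dh \in hs -> tgt g dh = inr u0 ->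
  let S := star g (inr u0) in
  let A := [set rdart dh; head dh x1] in
  let G1 := split_at u0 (moved_block [set A; S :\: A]) in
  oriented G1 /\
  has_theta G1 false b [:: (size x1).+1; size x2; size x3] (strand_sign [:: x1; x2; x3] hs).
Proof.
move=> T dhs dhu S A; have H := th_walk T.
case: x1 T @A H => [|d1 l1] T A H; first by have [] := H _ (mem_head _ _).
case: x2 T H => [|d2 l2] T H; first by have [] := H [::] _; rewrite // !inE orbT.
case: x3 T H => [|d3 l3] T H; first by have [] := H [::] _; rewrite // !inE !orbT.
have [_ /andP[/eqP E1 _]] := H (d1 :: l1) (mem_head _ _).
have [|_ /andP[/eqP E2 _]] := H (d2 :: l2); first by rewrite !inE eqxx orbT.
have [|_ /andP[/eqP E3 _]] := H (d3 :: l3); first by rewrite !inE eqxx !orbT.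
have eU := theta_edge_uniq T.
have [i1 i2 i3] : [/\ d1 \in flatten [:: d1 :: l1; d2 :: l2; d3 :: l3],
    d2 \in flatten [:: d1 :: l1; d2 :: l2; d3 :: l3] &
    d3 \in flatten [:: d1 :: l1; d2 :: l2; d3 :: l3]].
  by rewrite /= !(inE, mem_cat) !eqxx !orbT.
have hneq d : d \in flatten [:: d1 :: l1; d2 :: l2; d3 :: l3] -> d.1 != dh.1.
  move: eU; rewrite map_cat cat_uniq => /and3P[_ /hasPn D _] dls.
  by apply: contraTneq (map_f fst dls) => ->; apply: D; apply: map_f.
have [n12 n13] : d1.1 != d2.1 /\ d1.1 != d3.1.
  by have := heads_uniq T; rewrite /= !inE negb_or => /andP[/andP[]].
set B := moved_block _.
have BP : B \in [set A; S :\: A].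
  rewrite /B /moved_block; case: pickP => [C //|/(_ A)]; by rewrite !inE eqxx.
have AS : {in A, forall d, endpoint g d = inr u0}.
  by move=> d; rewrite /A !inE => /orP[]/eqP ->.
have mA d : d.1 != dh.1 -> (d \in A) = (d == d1).
  by move=> ne; rewrite /A !inE; case: eqP => // E; rewrite E eqxx in ne.
have A1 : d1 \in A by rewrite /A !inE eqxx orbT.
have A2 : (d2 \in A) = false.
  by rewrite mA ?hneq //; apply/eqP => E; rewrite E eqxx in n12.
have A3 : (d3 \in A) = false.
  by rewrite mA ?hneq //; apply/eqP => E; rewrite E eqxx in n13.
have Ah : rdart dh \in A by rewrite /A !inE eqxx.
have S1 : d1 \in S by rewrite inE E1.
have S2 : d2 \in S by rewrite inE E2.
have S3 : d3 \in S by rewrite inE E3.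
have [beta [BS Bh B1 [B2 B3]]] : exists beta : bool,
  [/\ {in B, forall d, endpoint g d = inr u0}, (rdart dh \in B) = beta, (d1 \in B) = beta &
      (d2 \in B) = ~~ beta /\ (d3 \in B) = ~~ beta].
  move: BP; rewrite !inE => /orP[]/eqP ->; [exists true|exists false].
    by split; rewrite ?Ah ?A1 ?A2 ?A3.
  split; rewrite ?in_setD ?Ah ?A1 ?A2 ?A3 ?S2 ?S3 //.
  by move=> d /setDP[+ _]; rewrite inE => /eqP.
have T' := split_theta T dhs dhu BS Bh B1 B2 B3.
split; first exact: split_oriented.
do 4 eexists; split; first exact: T'.
- by rewrite /= !size_map.
- exact: (split_sg Go T beta BS).
Qed.

(** The edges of [x] pass all edges of the strands before it. *)
Lemma sg_front u w s1 x s2 hs a b :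
  theta g u w (s1 ++ x :: s2) hs a b ->
  strand_sign (x :: s1 ++ s2) hs =
  strand_sign (s1 ++ x :: s2) hs (+) (odd (size x) && odd (size (flatten s1))).
Proof.
move=> T; have [oU /forallP oA] := andP Go; have := sgl_uniq T; rewrite /strand_sign /orient_list cat_uniq => /andP[U _].
pose f (d : halfedge (n_edge G)) : cell (n_ext G) (n_int G) (n_edge G) := inr d.1.
rewrite -/f in U *; rewrite !inv_parity_cat.
have p : perm_eq (x :: s1 ++ s2) (s1 ++ x :: s2) by rewrite -cat1s perm_catCA.
rewrite (cross_parity_perml _ _ (perm_map f (perm_flatten p))).
suff -> : inv_parity (index^~ (orient_order G)) (map f (flatten (x :: s1 ++ s2))) =
  inv_parity (index^~ (orient_order G)) (map f (flatten (s1 ++ x :: s2))) (+)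
  (odd (size x) && odd (size (flatten s1))) by rewrite [X in X (+) _]addbAC addbAC.
move: U; rewrite /= !flatten_cat /= !map_cat !catA cat_uniq => /andP[U _].
rewrite !(inv_parity_cat _ (_ ++ _)) (cross_parity_perml _ _ (permEl (perm_catC (map f x) _))).
rewrite (inv_parity_swap (s := map f (flatten s1))) //; last first.
  by move=> c d _ _; apply: contra_neq => /(order_inj oA).
by rewrite !size_map andbC [X in X (+) _]addbAC addbAC.
Qed.

(** Each term is computed by [split_one] after the growing strand has been brought to the front;
    this move causes the additional sign. *)
Lemma split_sum u0 w x1 x2 x3 hs b :
  theta g (inr u0) w [:: x1; x2; x3] hs true b ->
  exists G1 G2 G3, [/\
    \sum_(P | @splitting G u0 P) gen (split_at u0 (moved_block P)) =
      gen G1 + gen G2 + gen G3,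
    [/\ oriented G1, n_ext G1 = n_ext G & has_theta G1 false b
      [:: (size x1).+1; size x2; size x3] (strand_sign [:: x1; x2; x3] hs)],
    [/\ oriented G2, n_ext G2 = n_ext G & has_theta G2 false b
      [:: (size x2).+1; size x1; size x3]
      (strand_sign [:: x1; x2; x3] hs (+) (odd (size x1) && odd (size x2)))] &
    [/\ oriented G3, n_ext G3 = n_ext G & has_theta G3 false b
      [:: (size x3).+1; size x1; size x2]
      (strand_sign [:: x1; x2; x3] hs (+) (odd (size x3) && odd (size x1 + size x2)))]].
Proof.
move=> T.
have [dh dhs dhu] : exists2 d, d \in hs & tgt g d = inr u0.
  have : inr u0 \in map (tgt g) hs by rewrite (perm_mem (th_hair T)) mem_head.
  by case/mapP=> d dhs ->; exists d.
have H := th_walk T.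
pose S := star g (inr u0).
have S4 : #|S| = 4%N.
  have uw := theta_uw T; have := theta_valence T (inr u0); rewrite /= eqxx eq_sym.
  by rewrite (negbTE uw) andbF addn0.
have hd x : x \in [:: x1; x2; x3] -> exists l, x = head dh x :: l /\ head dh x \in S.
  move=> /H[x0 W]; case: x x0 W => // d l _ /andP[/eqP dE _].
  by exists l; rewrite /= inE dE.
have i1 : x1 \in [:: x1; x2; x3] by rewrite mem_head.
have i2 : x2 \in [:: x1; x2; x3] by rewrite !inE eqxx orbT.
have i3 : x3 \in [:: x1; x2; x3] by rewrite !inE eqxx !orbT.
have hS : rdart dh \in S by rewrite inE -[endpoint _ _]/(tgt g dh) dhu.
have U : uniq [:: rdart dh; head dh x1; head dh x2; head dh x3].
  have := theta_edge_uniq T.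
  have [[l1 [E1 _]] [l2 [E2 _]] [l3 [E3 _]]] := And3 (hd x1 i1) (hd x2 i2) (hd x3 i3).
  rewrite map_cat cat_uniq => /and3P[Ul /hasPn Dh _].
  apply: (@map_uniq _ _ fst); rewrite [map _ _]/= cons_uniq; apply/andP; split.
    apply/negP => K; have := Dh dh.1 (map_f _ dhs) => /negP; apply.
    have hf x : x \in [:: x1; x2; x3] -> (head dh x).1 \in map fst (flatten [:: x1; x2; x3]).
      move=> xi; have [l [E _]] := hd x xi; apply/map_f/flattenP; exists x => //.
      by rewrite {2}E mem_head.
    by move: K; rewrite !inE => /or3P[]/eqP ->; apply: hf.
  by move: (T); rewrite {1}E1 {1}E2 {1}E3; apply: heads_uniq.
have SE : S = [set rdart dh; head dh x1; head dh x2; head dh x3].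
  apply/eqP; rewrite eq_sym eqEcard S4; apply/andP; split.
    have [[_ [_ s1]] [_ [_ s2]] [_ [_ s3]]] := And3 (hd x1 i1) (hd x2 i2) (hd x3 i3).
    by rewrite !subUset !sub1set hS s1 s2 s3.
  rewrite (eq_card (B := mem [:: rdart dh; head dh x1; head dh x2; head dh x3])).
    by rewrite (card_uniqP U).
  by move=> y; rewrite !inE -!orbA.
have sumE := sum_splits (fun P => gen (split_at u0 (moved_block P))) U.
rewrite /= -SE in sumE; do 3 eexists; split; first exact: sumE.
- by have [o H1] := split_one T dhs dhu; split.
- have p2 : perm_eq [:: x1; x2; x3] [:: x2; x1; x3] by rewrite (perm_catCA [:: x1] [:: x2]).
  have [o H2] := split_one (theta_perm p2 (perm_refl hs) T) dhs dhu; split=> //.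
  by move: H2; rewrite (sg_front (s1 := [:: x1]) (s2 := [:: x3]) T) /= cats0 andbC.
- have p3 : perm_eq [:: x1; x2; x3] [:: x3; x1; x2] by rewrite (perm_catC [:: x1; x2]).
  have [o H3] := split_one (theta_perm p3 (perm_refl hs) T) dhs dhu; split=> //.
  by move: H3; rewrite (sg_front (s1 := [:: x1; x2]) (s2 := [::]) T) /= cats0 size_cat.
Qed.

End SplitSum.

(** * Strand lengths and relative orientation of a graph *)

Section HasTheta.
Implicit Type G : ograph.

Lemma has_theta_n_ext G a b s o : has_theta G a b s o ->
  n_ext G = (a + b + sumn (map predn s))%N.
Proof.
case=> u [w [ls [hs [T <- _]]]]; rewrite (theta_h T) size_flatten /shape -!map_comp.
congr (_ + sumn _)%N; apply: eq_map => l.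
by rewrite /= /inner size_map size_behead.
Qed.

Lemma has_theta_pos G a b s o : has_theta G a b s o -> size s = 3%N /\ all (leq 1) s.
Proof.
case=> u [w [ls [hs [T <- _]]]]; rewrite size_map (th_size T); split=> //.
rewrite all_map; apply/allP => l lls; have [l0 _] := th_walk T lls.
by rewrite /= lt0n size_eq0.
Qed.

Lemma has_theta_front G a b t1 x t2 o : oriented G ->
  has_theta G a b (t1 ++ x :: t2) o ->
  has_theta G a b (x :: t1 ++ t2) (o (+) (odd x && odd (sumn t1))).
Proof.
move=> Go [u [w [ls [hs [T E <-]]]]].
have [ls1 [l [ls2 [El E1 E2 E3]]]] : exists ls1 l ls2,
    [/\ ls = ls1 ++ l :: ls2, map size ls1 = t1, size l = x & map size ls2 = t2].
  elim: t1 (ls) E => [|y t1 IH] [|l ls'] //= [E1 E2]; first by exists [::], l, ls'.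
  have [ls1 [l' [ls2 [-> <- <- <-]]]] := IH _ E2; exists (l :: ls1), l', ls2.
  by rewrite /= E1.
rewrite {}El in T E *; exists u, w, (l :: ls1 ++ ls2), hs; split.
- by apply: theta_perm T => //; rewrite -cat1s perm_catCA.
- by rewrite /= map_cat E1 E2 E3.
- by rewrite (sg_front Go T) E2 size_flatten -E1.
Qed.

Lemma has_theta_unfront G a b t1 x t2 o : oriented G ->
  has_theta G a b (x :: t1 ++ t2) o ->
  has_theta G a b (t1 ++ x :: t2) (o (+) (odd x && odd (sumn t1))).
Proof.
move=> Go [u [w [ls [hs [T E <-]]]]].
have [l [ls1 [ls2 [El E1 E2 E3]]]] : exists l ls1 ls2,
    [/\ ls = l :: ls1 ++ ls2, map size ls1 = t1, size l = x & map size ls2 = t2].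
  case: (ls) E => [|l ls'] //= [E1 E2].
  exists l, (take (size t1) ls'), (drop (size t1) ls'); rewrite cat_take_drop; split=> //.
    by rewrite map_take E2 take_size_cat.
  by rewrite map_drop E2 drop_size_cat.
rewrite {}El in T E *; have T' : theta (ends G) u w (ls1 ++ l :: ls2) hs a b.
  by apply: theta_perm T => //; rewrite -cat1s perm_catCA.
exists u, w, (ls1 ++ l :: ls2), hs; split=> //.
  by rewrite /= map_cat /= E1 E2 E3.
by rewrite (sg_front Go T') E2 size_flatten -E1 addbK.
Qed.

Lemma has_theta_perm G a b s s' o : oriented G -> uniq (filter odd s) -> perm_eq s s' ->
  has_theta G a b s o -> has_theta G a b s' (o (+) (odd_sign s (+) odd_sign s')).
Proof.
move=> Go U p [u [w [ls [hs [T E <-]]]]].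
have [oU /forallP oA] := andP Go.
move: p; rewrite -E perm_sym => /perm_eq_map[ls' -> pls]; rewrite perm_sym in pls.
exists u, w, ls', hs; split=> //; first exact: theta_perm T.
have := strand_sign_perm oA T; rewrite E => /(_ ls' U pls).
by move/(canRL (addbK _)) ->; rewrite addbA.
Qed.

Lemma has_theta_flip G a b s o : oriented G ->
  has_theta G a b s o -> has_theta G b a s (o (+) flip_sign s).
Proof.
move=> Go [u [w [ls [hs [T <- <-]]]]]; have [oU /forallP oA] := andP Go.
exists w, u, (map (@rstrand _) ls), hs; split; first exact: theta_flip.
  by rewrite -map_comp; apply: eq_map => l; rewrite /= size_rstrand.
exact: (sg_flip oA T).
Qed.

(* Exchanging two strands of the same odd length reverses the orientation. *)
Lemma has_theta_repeated_odd G a b s o : oriented G -> has_theta G a b s o ->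
  ~~ uniq (filter odd s) ->
  exists s1 o1, has_theta G a b s1 o1 /\ has_theta G a b s1 (~~ o1).
Proof.
move=> Go T; have [+ _] := has_theta_pos T.
case: s T => [|x [|y [|z []]]] // T _ nU.
have swap y' o' : has_theta G a b y' o' -> forall x1 x2, y' = [:: x1; x1; x2] -> odd x1 ->
    exists s1 o1, has_theta G a b s1 o1 /\ has_theta G a b s1 (~~ o1).
  move=> T' x1 x2 E ox; rewrite E in T'; exists [:: x1; x1; x2], o'; split=> //.
  have := has_theta_front (t1 := [:: x1]) (t2 := [:: x2]) Go T'.
  by rewrite /= addn0 ox addbT.
have : [|| odd x && (x == y), odd x && (x == z) | odd y && (y == z)].
  move: nU => /=; case: (odd x); case: (odd y); case: (odd z);
    rewrite /= ?inE ?andbT ?orbF ?negb_or; by case: (x == y); case: (x == z); case: (y == z).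
case/or3P=> /andP[ox /eqP E].
- by apply: (swap _ _ T x z); rewrite ?E // -E.
- have := has_theta_front (t1 := [:: x; y]) (t2 := [::]) Go T.
  by move/swap => /(_ z y); apply; rewrite -?E.
- have T1 := has_theta_front (t1 := [:: x]) (t2 := [:: z]) Go T.
  have := has_theta_front (t1 := [:: y; x]) (t2 := [::]) Go T1.
  by move/swap => /(_ z x); apply; rewrite -?E.
Qed.

(** By [theta_rigid] two parametrizations differ by permutations of strands and hairs and possibly
    by an exchange of the ends, which forces a = b. Under the stated conditions none of these
    changes [o (+) odd_sign s]. *)
Lemma has_theta_rigid G a b s s' o o' : oriented G ->
  has_theta G a b s o -> has_theta G a b s' o' ->
  perm_eq s s' /\ (uniq (filter odd s) -> (a == b) ==> ~~ flip_sign s ->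
                   o (+) odd_sign s = o' (+) odd_sign s').
Proof.
move=> Go [u [w [ls [hs [T <- <-]]]]] [u' [w' [ls' [hs' [T' <- <-]]]]].
have [oU /forallP oA] := andP Go.
have Er : map size (map (@rstrand _) ls) = map size ls.
  by rewrite -map_comp; apply: eq_map => l; rewrite /= size_rstrand.
case: (theta_rigid T T') => [[Eu Ea Eb pl ph]|[Eu Ea Eb pl ph]].
  split; first exact: perm_map.
  move=> U _; rewrite -(strand_sign_perm oA T U pl).
  congr (_ (+) _); rewrite (sg_perm_hs oA (theta_perm pl (perm_refl hs) T) ph) //.
split; first by rewrite -Er; apply: perm_map.
move=> U; rewrite Ea eqxx /= => eF; have Tf := theta_flip T.
have Uf : uniq (filter odd (map size (map (@rstrand _) ls))) by rewrite Er.
have := strand_sign_perm oA Tf Uf pl; rewrite Er (sg_flip oA T) (negbTE eF) addbF => <-.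
congr (_ (+) _); symmetry.
exact: (sg_perm_hs oA (theta_perm pl (perm_refl hs) Tf) ph).
Qed.

End HasTheta.

(** * Standard graphs with given strand lengths *)

Section Existence.

Lemma walk_of_ends h n e (g : graph h n e) l x y I :
  map (fun d => (endpoint g d, tgt g d)) l = zip (x :: I) (rcons I y) ->
  [/\ l != [::], walk g x l y & inner g l = I].
Proof.
elim: I x l => [|z I IH] x [|d l] //=.
  by case=> <- <-; case: l => //= _; rewrite !eqxx.
case=> <- dz /IH[l0 W E]; split=> //; first by rewrite eqxx dz.
by rewrite /inner [behead _]/= (walk_src l0 W) E.
Qed.

Lemma map_eq_cat (X Y : Type) (f : X -> Y) s t1 t2 : map f s = t1 ++ t2 ->
  exists s1 s2, [/\ s = s1 ++ s2, map f s1 = t1 & map f s2 = t2].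
Proof.
move=> E; exists (take (size t1) s), (drop (size t1) s); rewrite cat_take_drop.
by rewrite map_take map_drop E take_size_cat // drop_size_cat.
Qed.

Lemma inv_parity_iota m k : inv_parity id (iota m k) = false.
Proof.
elim: k m => //= k IH m; rewrite IH addbF (@eq_in_count _ _ pred0) ?count_pred0 //.
by move=> x; rewrite mem_iota /= => /andP[/ltnW]; rewrite leqNgt => /negbTE.
Qed.

Lemma inv_parity_index (X : eqType) (s t : seq X) : uniq s -> inv_parity (index^~ (s ++ t)) s = false.
Proof.
move=> us; rewrite -[X in inv_parity X _]/(id \o (index^~ (s ++ t))) -inv_parity_map.
suff -> : map (index^~ (s ++ t)) s = iota 0 (size s) by apply: inv_parity_iota.
case: s us => // x0 s us; apply: (@eq_from_nth _ 0%N); rewrite size_map ?size_iota // => i ilt.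
rewrite (nth_map x0) // nth_iota // index_cat mem_nth // index_uniq //.
Qed.

Lemma theta_exists (a b : bool) p q r : exists G : ograph,
  oriented G /\ has_theta G a b [:: p.+1; q.+1; r.+1] false.
Proof.
(* There are n + 1 internal vertices: 0 and 1 are the ends, and the interior vertices of the three
   strands follow in consecutive intervals starting at 2. *)
pose n := (p + q + r).+1; pose k := (a + b + (p + q + r))%N.
pose V : Type := vertex k n.+1; pose iv (i : nat) : vertex k n.+1 := inr (inord i).
pose u := iv 0%N; pose w := iv 1%N.
pose I1 := map iv (iota 2 p); pose I2 := map iv (iota (2 + p) q).
pose I3 := map iv (iota (2 + p + q) r).
pose cr := nseq a u ++ nseq b w ++ I1 ++ I2 ++ I3.
pose es := [:: zip (u :: I1) (rcons I1 w); zip (u :: I2) (rcons I2 w); zip (u :: I3) (rcons I3 w)].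
pose el := flatten es ++ zip (map inl (enum 'I_k)) cr.
pose g : graph k n.+1 (size el) := [ffun f : 'I_(size el) => nth (u, u) el f].
pose ds := [seq (f, false) | f <- enum 'I_(size el)].
have dsE : map (fun d => (endpoint g d, tgt g d)) ds = el.
  rewrite -map_comp; apply: (@eq_from_nth _ (u, u)); rewrite size_map size_enum_ord // => i ilt.
  rewrite (nth_map (Ordinal ilt)) ?size_enum_ord //= /tgt /rdart /endpoint /= !ffunE.
  by rewrite -surjective_pairing nth_enum_ord.
have szcr : size cr = k.
  by rewrite /cr /k !size_cat !size_nseq !size_map !size_iota; lia.
have [l1 [s1 [Es El1 E1]]] := map_eq_cat (etrans dsE (esym (catA _ _ _))).
rewrite /= cats0 in E1.
have [l2 [s2 [Es1 El2 E2]]] := map_eq_cat (etrans E1 (esym (catA _ _ _))).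
have [l3 [hs [Es2 El3 E3]]] := map_eq_cat E2.
have [l10 W1 J1] := walk_of_ends El1.
have [l20 W2 J2] := walk_of_ends El2.
have [l30 W3 J3] := walk_of_ends El3.
have szz : size (map inl (enum 'I_k) : seq (vertex k n.+1)) = size cr.
  by rewrite size_map size_enum_ord szcr.
have hsrc : map (endpoint g) hs = map inl (enum 'I_k).
  have := congr1 unzip1 E3; rewrite unzip1_zip ?szz // => <-.
  by rewrite /unzip1 -map_comp.
have htgt : map (tgt g) hs = cr.
  have := congr1 unzip2 E3; rewrite unzip2_zip ?szz // => <-.
  by rewrite /unzip2 -map_comp.
have dsS : flatten [:: l1; l2; l3] ++ hs = ds.
  by rewrite Es Es1 Es2 /= cats0 !catA.
have T : theta g u w [:: l1; l2; l3] hs a b.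
  split=> //.
  - by move=> l; rewrite !inE => /or3P[]/eqP ->.
  - rewrite /= J1 J2 J3 cats0 /u /w -!map_cat -!map_cons.
    rewrite -iotaD -iotaD -[1%N :: _]/(iota 1 (p + (q + r)).+1) -[0%N :: _]/(iota 0 (p + (q + r)).+2).
    have -> : (p + (q + r)).+2 = n.+1 by rewrite /n addnA.
    rewrite -val_enum_ord -map_comp (@eq_map _ _ _ inr) // => i.
    by rewrite /= /iv inord_val.
  - by rewrite dsS -map_comp map_id.
  - by rewrite hsrc.
  - by rewrite htgt /= J1 J2 J3 cats0.
(* The odd cells are listed as along the strands, which makes the relative orientation trivial; the
   place of the even internal vertices does not affect it. *)
pose o := orient_list g [:: l1; l2; l3] hs ++ [seq inl (inr v) | v <- enum 'I_n.+1].
exists (@OGraph k n.+1 (size el) g o).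
have oU := sgl_uniq T; have oM := mem_sgl T; split.
  apply/andP; split.
    rewrite /= cat_uniq oU map_inj_uniq ?enum_uniq ?andbT; last by move=> ? ? [].
    by apply/hasPn => _ /mapP[v _ ->]; rewrite /= oM.
  apply/forallP => -[[x|v]|f]; rewrite /= mem_cat oM //=.
  by rewrite map_f ?mem_enum ?orbT.
exists u, w, [:: l1; l2; l3], hs; split=> //.
  have sz (l : seq (halfedge (size el))) I x y :
      map (fun d => (endpoint g d, tgt g d)) l = zip (x :: I) (rcons I y) -> size l = (size I).+1.
    by move=> E; rewrite -(size_map (fun d => (endpoint g d, tgt g d))) E size_zip size_rcons minnn.
  by rewrite /= (sz _ _ _ _ El1) (sz _ _ _ _ El2) (sz _ _ _ _ El3) !size_map !size_iota.
exact: inv_parity_index.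
Qed.

End Existence.

Definition has_std (a b : bool) (s : seq nat) (G : ograph) : Prop :=
  oriented G /\ has_theta G a b s false.

(* The value is irrelevant unless s consists of three positive lengths. *)
Definition std_theta (a b : bool) (s : seq nat) : ograph :=
  if pselect (exists G, has_std a b s G) is left H then projT1 (cid H)
  else @OGraph 0 0 0 [ffun f => (inl f, inl f)] [::].

Definition hairs (a b : bool) (s : seq nat) : nat := (a + b + sumn (map predn s))%N.

Lemma stdP a b s : size s = 3%N -> all (leq 1) s -> has_std a b s (std_theta a b s).
Proof.
move=> s3 s1; rewrite /std_theta; case: pselect => [H|[]]; first by case: (cid H).
case: s s3 s1 => [|p [|q [|r []]]] //= _ /and4P[p0 q0 r0 _].
have [G [Go GT]] := theta_exists a b p.-1 q.-1 r.-1; exists G; split=> //.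
by move: GT; rewrite !prednK.
Qed.

(** * The differential in terms of strand lengths *)

Section Differential.
Variables m N : nat.
Hypotheses (N_gt0 : (0 < N)%N) (N_even : ~~ odd N) (m_odd : odd m).
Notation ceq := (ceq m N).

Definition theta_gen (a b : bool) (s : seq nat) : chain := gen (std_theta a b s).

Lemma has_theta_ceq G a b s o : (0 < n_ext G)%N -> oriented G -> has_theta G a b s o ->
  ceq (gen G) ((-1) ^+ o *: theta_gen a b s).
Proof.
move=> h0 Go GT; have [s3 s1] := has_theta_pos GT; have [So ST] := stdP a b s3 s1.
have hS : (0 < n_ext (std_theta a b s))%N.
  by rewrite (has_theta_n_ext ST) -(has_theta_n_ext GT).
have [u [w [ls [hs [T E <-]]]]] := GT; have [u' [w' [ls' [hs' [T' E' e']]]]] := ST.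
have := theta_ceq N_gt0 N_even m_odd hS h0 So Go T' T; rewrite E E' e' addFb.
exact.
Qed.

Lemma std_n_ext a b s : size s = 3%N -> all (leq 1) s -> n_ext (std_theta a b s) = hairs a b s.
Proof. by move=> s3 s1; have [_ ST] := stdP a b s3 s1; apply: has_theta_n_ext ST. Qed.

Lemma theta_gen_flip a b s : size s = 3%N -> all (leq 1) s -> (0 < hairs a b s)%N ->
  ceq (theta_gen a b s) ((-1) ^+ flip_sign s *: theta_gen b a s).
Proof.
move=> s3 s1 h0; have [So ST] := stdP a b s3 s1.
rewrite -(std_n_ext a b s3 s1) in h0.
have := has_theta_ceq h0 So (has_theta_flip So ST); rewrite addFb => H.
by apply: ceq_trans H; apply: ceq_refl.
Qed.

(** The sum of the two congruences says that 2 x vanishes, and 2 is invertible. *)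
Lemma zero_of_signs x y (o : bool) : ceq x ((-1) ^+ o *: y) -> ceq x ((-1) ^+ (~~ o) *: y) ->
  zero_class m N x.
Proof.
move=> H1 H2; have := ceqD H1 H2; rewrite -scalerDl -addTb signr_addb expr1 mulN1r subrr.
rewrite scale0r => /ceq_zero/(_ (zero_class0 m N))/(zero_classZ 2^-1).
by rewrite -mulr2n -scaler_nat scalerA mulVf // scale1r.
Qed.

Lemma theta_gen_odd_flip a s : size s = 3%N -> all (leq 1) s -> (0 < hairs a a s)%N ->
  flip_sign s -> zero_class m N (theta_gen a a s).
Proof.
move=> s3 s1 h0 o; apply: (@zero_of_signs _ (theta_gen a a s) false).
  by rewrite scale1r; apply: ceq_refl.
by have := theta_gen_flip s3 s1 h0; rewrite o.
Qed.

(* A hair at the end vertex u slides onto one of the three strands; the signs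
   come from moving the new edge to its place in the orientation. *)
Definition grow (b : bool) (P Q R : nat) : chain :=
  theta_gen false b [:: P.+1; Q; R] + (-1) ^+ odd P *: theta_gen false b [:: P; Q.+1; R] +
  (-1) ^+ odd (P + Q) *: theta_gen false b [:: P; Q; R.+1].

(** The second strand passes P edges on its way to the front and again, one edge longer, on its way
    back: P Q + P (Q + 1) has the parity of P. In the same way the third strand gives P + Q. *)
Lemma split_sum_grow G u0 w x1 x2 x3 hs b : (0 < n_ext G)%N -> oriented G ->
  theta (ends G) (inr u0) w [:: x1; x2; x3] hs true b ->
  ceq (\sum_(P | @splitting G u0 P) gen (split_at u0 (moved_block P)))
    ((-1) ^+ strand_sign [:: x1; x2; x3] hs *: grow b (size x1) (size x2) (size x3)).
Proof.
move=> h0 Go T; have [G1 [G2 [G3 [-> [o1 e1 T1] [o2 e2 T2] [o3 e3 T3]]]]] := split_sum Go T.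
set o := strand_sign _ _ in T1 T2 T3 *; set P := size x1 in T1 T2 T3 *.
set Q := size x2 in T1 T2 T3 *; set R := size x3 in T1 T2 T3 *.
rewrite /grow scalerDr scalerDr; apply: ceqD; first apply: ceqD.
- by apply: has_theta_ceq; rewrite ?e1.
- have := has_theta_unfront (t1 := [:: P]) (t2 := [:: R]) o2 T2; rewrite /= addn0.
  rewrite scalerA -signr_addb; move/(has_theta_ceq _ o2); rewrite e2 => /(_ h0).
  by rewrite -addbA; case: (odd P); case: (odd Q).
- have := has_theta_unfront (t1 := [:: P; Q]) (t2 := [::]) o3 T3; rewrite /= addn0.
  rewrite scalerA -signr_addb; move/(has_theta_ceq _ o3); rewrite e3 => /(_ h0).
  by rewrite -addbA; case: (odd (P + Q)); case: (odd R).
Qed.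

Lemma splitting_small G v : (valence (ends G) (inr v) < 4)%N ->
  \sum_(P | @splitting G v P) gen (split_at v (moved_block P)) = 0.
Proof.
move=> v4; rewrite big_pred0 // => P.
by rewrite splitting_splits splits_small.
Qed.

Lemma diff_gen_one G P Q R o : (0 < n_ext G)%N -> oriented G ->
  has_theta G true false [:: P; Q; R] o ->
  ceq (diff_gen G) ((-1) ^+ o *: grow false P Q R).
Proof.
move=> h0 Go [u [w [ls [hs [T E <-]]]]].
case: ls T E => [|x1 [|x2 [|x3 []]]] // T [<- <- <-].
have := theta_u_int T; case: u T => // u T _.
have z v : v != u -> \sum_(P | @splitting G v P) gen (split_at v (moved_block P)) = 0.
  move=> vu; apply: splitting_small; rewrite (theta_valence T) /=.
  by rewrite -[inr u == inr v]/(u == v) eq_sym (negbTE vu).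
have -> : diff_gen G = \sum_(P | @splitting G u P) gen (split_at u (moved_block P)).
  by rewrite /diff_gen (bigD1 u) // (big1 _ _ _ z); apply: addr0.
exact: (split_sum_grow h0 Go T).
Qed.

(** Exchanging the ends turns the splittings at [w] into splittings at the first end, at the cost of
    [flip_sign]. The two contributions add up or cancel, and they cancel exactly when the exchange
    reverses the orientation. *)
Lemma diff_gen_two G P Q R o : (0 < n_ext G)%N -> oriented G ->
  has_theta G true true [:: P; Q; R] o ->
  ceq (diff_gen G) (((-1) ^+ o + (-1) ^+ (o (+) flip_sign [:: P; Q; R])) *: grow true P Q R).
Proof.
move=> h0 Go [u [w [ls [hs [T E <-]]]]]; have uw := theta_uw T.
case: ls T E => [|x1 [|x2 [|x3 []]]] // T [E1 E2 E3].
have := theta_u_int T; case: u T uw => // u T uw _.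
have := theta_w_int T; case: w T uw => // w T uw _.
have {}uw : u != w by [].
have T' := theta_flip T; have [oU /forallP oA] := andP Go.
have z v : (v != u) && (v != w) ->
    \sum_(P | @splitting G v P) gen (split_at v (moved_block P)) = 0.
  case/andP=> vu vw; apply: splitting_small; rewrite (theta_valence T) /=.
  rewrite -[inr u == inr v]/(u == v) -[inr w == inr v]/(w == v).
  by rewrite !(eq_sym _ v) (negbTE vu) (negbTE vw).
have wu : w != u by rewrite eq_sym.
have -> : diff_gen G =
    \sum_(P | @splitting G u P) gen (split_at u (moved_block P)) +
    \sum_(P | @splitting G w P) gen (split_at w (moved_block P)).
  rewrite /diff_gen (bigD1 u) //; congr (_ + _); rewrite (bigD1 w) // (big1 _ _ _ z).
  exact: addr0.
rewrite scalerDl; apply: ceqD.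
  by rewrite -E1 -E2 -E3; exact: (split_sum_grow h0 Go T).
have := split_sum_grow h0 Go T'; rewrite -[[:: rstrand x1; _; _]]/(map (@rstrand _) [:: x1; x2; x3]).
by rewrite (sg_flip oA T) !size_rstrand /= E1 E2 E3.
Qed.

Lemma diff_gen_zero G P Q R o : has_theta G false false [:: P; Q; R] o -> diff_gen G = 0.
Proof.
move=> [u [w [ls [hs [T E _]]]]]; rewrite /diff_gen big1 // => v _.
by apply: splitting_small; rewrite (theta_valence T).
Qed.

End Differential.

(** * Coordinates *)

Section Functional.
Variables m N : nat.
Hypotheses (N_gt0 : (0 < N)%N) (N_even : ~~ odd N) (m_odd : odd m).
Notation ceq := (ceq m N).

Section Transport.
Implicit Type G : ograph.

Lemma has_theta_oiso G G' a b s o : oriented G -> oiso G G' ->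
  has_theta G a b s o -> has_theta G' a b s o.
Proof.
move=> Go [fx [fi [fe [bfx bfi bfe E Eo]]]] [u [w [ls [hs [T <- <-]]]]].
pose D := dmap fe (fun _ => false) : halfedge (n_edge G) -> halfedge (n_edge G').
have gE d : endpoint (ends G') (D d) = vertex_map fx fi (endpoint (ends G) d).
  by rewrite /endpoint /= E addbF; case: d => f [].
exists (vertex_map fx fi u), (vertex_map fx fi w), (map (map D) ls), (map D hs); split.
- exact: theta_map T.
- by rewrite -map_comp; apply: eq_map => l; rewrite /= size_map.
rewrite /strand_sign (sgl_dmap gE) Eo inv_parity_map; apply: eq_isgn_lt => x y _ _ /=.
by rewrite !index_map //; apply: cell_map_inj; apply: bij_inj.
Qed.

Lemma oiso_sym G G' : oiso G G' -> oiso G' G.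
Proof.
move=> [fx [fi [fe [[fx' fxK fxK'] [fi' fiK fiK'] [fe' feK feK'] E Eo]]]].
exists fx', fi', fe'; split; [by exists fx|by exists fi|by exists fe| |].
  have VK : cancel (vertex_map fx fi) (vertex_map fx' fi').
    by case=> [x|v] /=; rewrite ?fxK ?fiK.
  by move=> f; rewrite -{2 3}(feK' f) E /= !VK; case: (ends G (fe' f)).
rewrite Eo -map_comp (@eq_map _ _ _ id) ?map_id // => -[[x|v]|f] /=.
- by rewrite fxK.
- by rewrite fiK.
- by rewrite feK.
Qed.

Lemma oiso_oriented G G' : oriented G -> oiso G G' -> oriented G'.
Proof.
move=> /andP[oU /forallP oA] [fx [fi [fe [bfx bfi bfe _ Eo]]]].
apply/andP; rewrite Eo map_inj_uniq ?oU; last by apply: cell_map_inj; apply: bij_inj.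
split=> //; apply/forallP => c.
have [[[fx' _ fxK] [fi' _ fiK]] [fe' _ feK]] := (bfx, bfi, bfe).
suff -> : c = cell_map fx fi fe (cell_map fx' fi' fe' c) by apply: map_f.
by case: c => [[x|v]|f] /=; rewrite ?fxK ?fiK ?feK.
Qed.

Lemma has_theta_flips G X a b s o : has_theta G a b s o -> has_theta (flips G X) a b s o.
Proof.
move=> [u [w [ls [hs [T <- <-]]]]].
exists u, w, (map (map (dmap id (mem X))) ls), (map (dmap id (mem X)) hs); split.
- exact: flips_theta.
- by rewrite -map_comp; apply: eq_map => l; rewrite /= size_map.
exact: flips_sg.
Qed.

Lemma has_theta_flip_edge G (f : 'I_(n_edge G)) a b s o :
  has_theta (flip f) a b s o <-> has_theta G a b s o.
Proof.
have E (H : ograph) (f' : 'I_(n_edge H)) : flip f' = flips H [:: f'].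
  rewrite /flip /flips; congr OGraph; apply/ffunP => f0; rewrite !ffunE inE.
  by case: eqP => // ->.
split=> [/(@has_theta_flips (flip f) [:: f])|T]; last by rewrite E; apply: has_theta_flips.
suff -> : flips (flip f) [:: f] = G by [].
rewrite -E /flip /=; case: G f => h n e g o' f /=; congr OGraph.
apply/ffunP => f0; rewrite !ffunE; case: eqP => // ->.
by case: (g f).
Qed.

(** By [koszulE] the change of [strand_sign] is the Koszul sign, which does not refer to a
    parametrization; hence one [x] serves all of them. *)
Lemma has_theta_reorder G t a b : oriented G -> perm_eq t (orient_order G) ->
  exists x : bool, forall s o, has_theta G a b s o ->
  koszul m N (orient_order G) t = (-1) ^+ x /\ has_theta (reorder t) a b s (o (+) x).
Proof.
move=> Go pt; have [oU /forallP oA] := andP Go.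
have tA c : c \in t by rewrite (perm_mem pt).
have [[s0 [o0 [u [w [ls [hs [T _ _]]]]]]]|nT] := pselect (exists s o, has_theta G a b s o); last first.
  by exists false => s o T; case: nT; exists s, o.
have K ls' hs' u' w' : theta (ends G) u' w' ls' hs' a b ->
    koszul m N (orient_order G) t =
    (-1) ^+ (inv_parity (index^~ (orient_order G)) (orient_list (ends G) ls' hs') (+)
             inv_parity (index^~ t) (orient_list (ends G) ls' hs')).
  by move=> T'; rewrite (koszulE N_gt0 N_even m_odd oA tA (sgl_uniq T') (mem_sgl T')).
exists (inv_parity (index^~ (orient_order G)) (orient_list (ends G) ls hs) (+)
        inv_parity (index^~ t) (orient_list (ends G) ls hs)) => s o [u' [w' [ls' [hs' [T' <- <-]]]]].
split; first exact: K T.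
exists u', w', ls', hs'; split=> //.
have := K _ _ _ _ T'; rewrite (K _ _ _ _ T) => /Num.Theory.signr_inj ->.
by rewrite /strand_sign /= addbA addbb addFb.
Qed.

End Transport.

Variables (a b : bool) (t : seq nat).

Definition has_type (G : ograph) (o : bool) : Prop := exists s o', 
  [/\ perm_eq s t, has_theta G a b s o' & o = o' (+) (odd_sign s (+) odd_sign t)].

(** If [G] has type [t] with both orientations the terms cancel, in accordance with the vanishing of
    its class. Stated through existence of parametrizations, the coefficient requires no choice. *)
Definition theta_coef (G : ograph) : rat := `[< has_type G false >]%:R - `[< has_type G true >]%:R.

Definition theta_form (x : chain) : rat := lext (theta_coef : ograph -> rat^o) x.

Lemma theta_formD x y : theta_form (x + y) = theta_form x + theta_form y.
Proof. exact: (lextD (theta_coef : ograph -> rat^o)). Qed.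

Lemma theta_formZ c x : theta_form (c *: x) = c * theta_form x.
Proof. exact: (lextZ (theta_coef : ograph -> rat^o)). Qed.

Lemma theta_formB x y : theta_form (x - y) = theta_form x - theta_form y.
Proof. exact: (lextB (theta_coef : ograph -> rat^o)). Qed.

Lemma theta_form_sum (I : Type) (s : seq I) (P : pred I) (f : I -> chain) :
  theta_form (\sum_(i <- s | P i) f i) = \sum_(i <- s | P i) theta_form (f i).
Proof. exact: (lext_sum (theta_coef : ograph -> rat^o)). Qed.

Lemma theta_form_gen G : theta_form (gen G) = theta_coef G.
Proof. exact: (lext_gen (theta_coef : ograph -> rat^o)). Qed.

Lemma theta_form_gen_sub G G' : theta_form (gen G' - gen G) = theta_coef G' - theta_coef G.
Proof. exact: etrans (theta_formB _ _) (congr2 (fun x y => x - y) (theta_form_gen G') (theta_form_gen G)). Qed.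

Lemma theta_form_gen_subZ c G G' : theta_form (gen G' - c *: gen G) = theta_coef G' - c * theta_coef G.
Proof.
exact: etrans (theta_formB _ _) (congr2 (fun x y => x - y) (theta_form_gen G')
  (etrans (theta_formZ _ _) (congr1 _ (theta_form_gen G)))).
Qed.

Lemma theta_coef_eq G G' x : (forall o, has_type G' o <-> has_type G (o (+) x)) ->
  theta_coef G' = (-1) ^+ x * theta_coef G.
Proof.
move=> H; rewrite /theta_coef.
have -> : `[< has_type G' false >] = `[< has_type G x >] by apply/asbool_equiv_eq; rewrite -(addFb x).
have -> : `[< has_type G' true >] = `[< has_type G (~~ x) >] by apply/asbool_equiv_eq; rewrite -(addTb x).
by case: x {H}; rewrite ?expr1 ?expr0 ?mul1r // mulN1r opprB.
Qed.

(** A relator compares [G] with a graph that has corresponding parametrizations, their relative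
    orientations being shifted by the very sign in the relator. So the forms descend to the
    quotient, where they detect nonzero classes. *)
Lemma theta_form_rel x : relator m N x -> theta_form x = 0.
Proof.
case=> {x} [G G' A iGG'|G f A|G t' A pt].
- have Go := admissible_oriented A; apply: etrans (theta_form_gen_sub _ _) _.
  rewrite (@theta_coef_eq G G' false) ?mul1r ?subrr // => o; rewrite addbF.
  split=> -[s [o' [p T E]]]; exists s, o'; split=> //.
    exact: (has_theta_oiso (oiso_oriented Go iGG') (oiso_sym iGG') T).
  exact: (has_theta_oiso Go iGG' T).
- apply: etrans (theta_form_gen_subZ _ _ _) _; rewrite -signr_odd (negbTE N_even) expr0.
  rewrite (@theta_coef_eq G _ false) ?mul1r ?subrr // => o; rewrite addbF.
  split=> -[s [o' [p T E]]]; exists s, o'; split=> //.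
    exact: (has_theta_flip_edge f a b s o').1.
  exact: (has_theta_flip_edge f a b s o').2.
have Go := admissible_oriented A; apply: etrans (theta_form_gen_subZ _ _ _) _.
have G'o : oriented (reorder t').
  have [oU /forallP oA] := andP Go.
  by apply/andP; rewrite /= (perm_uniq pt) oU; split=> //; apply/forallP => c; rewrite (perm_mem pt).
have [x H] := has_theta_reorder a b Go pt.
have pt' : perm_eq (orient_order G) (orient_order (reorder t')) by rewrite perm_sym.
have eta : reorder (G := reorder t') (orient_order G) = G by rewrite /reorder /=; case: (G).
have [x' H'] := has_theta_reorder a b G'o pt'.
have [[o [s [o' [p T E]]]]|nT] := pselect (exists o, has_type G o); last first.
  have nF o : has_type G o = False by apply/propext; split=> // H1; case: nT; exists o.
  have nF' o : has_type (reorder t') o = False.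
    apply/propext; split=> // -[s [o' [p T E]]]; have [_] := H' _ _ T; rewrite eta => T1.
    by apply: nT; exists (o (+) x'), s, (o' (+) x'); split; rewrite // E addbAC.
  have F0 (G0 : ograph) : (forall o, has_type G0 o = False) -> theta_coef G0 = 0.
    by move=> nH; rewrite /theta_coef !nH asboolF // subrr.
  by rewrite (F0 _ nF) (F0 _ nF') mulr0 subrr.
have [Ek _] := H _ _ T.
rewrite Ek (@theta_coef_eq G _ x) ?subrr // => o1; split=> -[s1 [o1' [p1 T1 E1]]]; last first.
  exists s1, (o1' (+) x); split=> //; first by have [] := H _ _ T1.
  by rewrite addbAC -E1 addbK.
have [_] := H' _ _ T1; rewrite eta => T2; have [_ T3] := H _ _ T2.
(* The Koszul sign is symmetric in the two orders, so reordering back causes the same shift. *)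
have xx : x' = x.
  have [p3 _] := has_theta_rigid G'o T1 T3.
  have [_ T4] := H _ _ T; have [Ek' T5] := H' _ _ T4.
  have Ek2 : koszul m N (orient_order (reorder t')) (orient_order G) =
     koszul m N (orient_order G) t'.
    have [u [w [ls [hs [T0 _ _]]]]] := T.
    have [/andP[_ /forallP oA] /andP[_ /forallP oA']] := (Go, G'o).
    rewrite (koszulE N_gt0 N_even m_odd oA' oA (sgl_uniq T0) (mem_sgl T0)).
    by rewrite (koszulE N_gt0 N_even m_odd oA oA' (sgl_uniq T0) (mem_sgl T0)) addbC.
  by move: Ek'; rewrite Ek2 Ek => /Num.Theory.signr_inj.
exists s1, (o1' (+) x); split=> //; first by rewrite -xx.
by rewrite E1 addbAC.
Qed.

Lemma theta_form_zero x : zero_class m N x -> theta_form x = 0.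
Proof.
case=> r [c [y [ry ->]]]; rewrite theta_form_sum big1 // => i _.
by rewrite theta_formZ (theta_form_rel (ry i)) mulr0.
Qed.

(** Under these conditions on [t], rigidity leaves only one relative orientation, so nothing cancels
    in [theta_coef]. *)
Lemma theta_coef_theta G s o : oriented G -> has_theta G a b s o -> uniq (filter odd t) ->
  (a == b) ==> ~~ flip_sign t ->
  theta_coef G = if perm_eq s t then (-1) ^+ (o (+) (odd_sign s (+) odd_sign t)) else 0.
Proof.
move=> Go T tU te; case: ifP => [p|p]; last first.
  have nF o1 : ~ has_type G o1.
    move=> [s1 [o1' [p1 T1 _]]]; have [p2 _] := has_theta_rigid Go T T1.
    by rewrite (perm_trans p2 p1) in p.
  by rewrite /theta_coef !asboolF // subrr.
have sU : uniq (filter odd s) by rewrite (perm_uniq (perm_filter odd p)).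
have se : (a == b) ==> ~~ flip_sign s.
  by rewrite /flip_sign (perm_big _ p).
set o1 := o (+) _; have P1 : has_type G o1 by exists s, o.
have P2 : ~ has_type G (~~ o1).
  move=> [s2 [o2 [p2 T2 E2]]]; have [_ /(_ sU se) E] := has_theta_rigid Go T T2.
  by move: E2; rewrite /o1 !addbA E; case: (_ (+) _).
by rewrite /theta_coef; case: o1 P1 P2 => P1 P2; rewrite (asboolT P1) (asboolF P2) ?subr0 ?sub0r.
Qed.

End Functional.

(** * Dimension of a subquotient as a difference of ranks *)

Section QuotientDim.
Variables (V : lmodType rat) (n : nat) (c : V -> 'rV[rat]_n).
Variables (H Z B : V -> Prop) (m1 m2 : nat) (A : 'M[rat]_(m1, n)) (A' : 'M[rat]_(m2, n)).
Hypothesis c_comb : forall d (k : 'I_d -> rat) (x : 'I_d -> V),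
  c (\sum_j k j *: x j) = \sum_j k j *: c (x j).
Hypothesis cB : forall x y, c (x - y) = c x - c y.
Hypothesis ZH : forall z, Z z -> H z /\ (c z <= A)%MS.
Hypothesis ZA : forall v : 'rV_n, (v <= A)%MS -> exists2 z, Z z & c z = v.
Hypothesis H_comb : forall d (k : 'I_d -> rat) (x : 'I_d -> V),
  (forall j, H (x j)) -> H (\sum_j k j *: x j).
Hypothesis HB : forall x y, H x -> H y -> H (x - y).
Hypothesis BH : forall x, H x -> (B x <-> (c x <= A')%MS).
Hypothesis AA : (A' <= A)%MS.

(** A basis of a complement of [A'] in [A], lifted to [Z], induces a basis of the quotient. [H] is a
    subspace on which membership in [B] can be read off from the coordinates [c]. *)
Lemma quotient_dim_rank : quotient_dim Z B (\rank A - \rank A').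
Proof.
set D := (A :\: A')%MS.
have rD : (\rank A - \rank A')%N = \rank D.
  rewrite -(mxrank_cap_compl A A') (_ : \rank (A :&: A') = \rank A') ?addKn //.
  by apply/eqP; rewrite eqn_leq !mxrankS ?capmxSr // sub_capmx AA submx_refl.
rewrite rD; have rowD j : (row j (row_base D) <= A)%MS.
  by apply: submx_trans (row_sub _ _) _; rewrite eq_row_base diffmxSl.
have [x xP] : exists x : 'I_(\rank D) -> V, forall j, Z (x j) /\ c (x j) = row j (row_base D).
  apply: (@fin_all_exists _ _ (fun j x => Z x /\ c x = row j (row_base D))) => j.
  by have [z Zz cz] := ZA (rowD j); exists z.
have cx (k : 'I_(\rank D) -> rat) : c (\sum_j k j *: x j) = (\row_j k j) *m row_base D.
  by rewrite c_comb mulmx_sum_row; apply: eq_bigr => j _; rewrite (xP j).2 mxE.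
have Hx (k : 'I_(\rank D) -> rat) : H (\sum_j k j *: x j).
  by apply: H_comb => j; have [/ZH[]] := xP j.
exists x; split.
- by move=> j; have [] := xP j.
- move=> k /(BH (Hx k)); rewrite cx => kA' j.
  have kD : (\row_j k j *m row_base D <= D)%MS.
    by apply: submx_trans (submxMl _ _) _; rewrite eq_row_base.
  have : (\row_j k j *m row_base D <= D :&: A')%MS by rewrite sub_capmx kD kA'.
  rewrite capmx_diff submx0 => /eqP k0.
  have : \row_j k j = 0 by apply: (row_free_inj (row_base_free D)); rewrite k0 mul0mx.
  by move/rowP/(_ j); rewrite !mxE.
move=> z Zz; have [Hz zA] := ZH Zz.
have : (c z <= D + (A :&: A'))%MS by rewrite addsmx_diff_cap_eq.
case/sub_addsmxP=> -[u1 u2] /= E.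
have : (u1 *m D <= row_base D)%MS by rewrite eq_row_base submxMl.
case/submxP=> k Ek; exists (fun j => k 0 j).
have Ed : c (z - \sum_j k 0 j *: x j) = u2 *m (A :&: A')%MS.
  have kE : \row_j k 0 j = k by apply/rowP => j; rewrite mxE.
  by rewrite cB cx E kE Ek addrC addKr.
apply/BH; first by apply: HB.
by rewrite Ed (submx_trans (submxMl _ _)) // capmxSr.
Qed.

End QuotientDim.

(** * The basis of triples and its coordinates *)

Section Types.

(* Strand lengths of the graphs that do not vanish in the quotient, one triple
   for each isomorphism class: two strands of equal odd length, or (for i = 0
   and i = 2) an orientation reversing flip, give a sign reversing symmetry. *)
Definition is_type (i k : nat) (s : seq nat) : bool :=
  [&& size s == 3%N, all (leq 1) s, sorted geq s, uniq (filter odd s),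
      hairs (0 < i)%N (1 < i)%N s == k & (i == 1%N) || ~~ flip_sign s].

(** A strand of x edges has x - 1 interior vertices with a hair each, so x is at most k + 1. *)
Definition types (i k : nat) : seq (seq nat) :=
  filter (is_type i k) [seq x :: s | x <- iota 1 k.+1,
    s <- [seq [:: y; z] | y <- iota 1 k.+1, z <- iota 1 k.+1]].

Lemma types_uniq i k : uniq (types i k).
Proof.
apply: filter_uniq; apply: allpairs_uniq; rewrite ?iota_uniq //.
  apply: allpairs_uniq; rewrite ?iota_uniq //.
  by move=> [y z] [y' z'] _ _ [-> ->].
by move=> [x s] [x' s'] _ _ [-> ->].
Qed.

Lemma mem_types i k s : (s \in types i k) = is_type i k s.
Proof.
rewrite mem_filter andb_idr // => /and5P[/eqP s3 s1 _ _ /andP[/eqP hk _]].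
have inI w : (0 < w)%N -> (w.-1 <= k)%N -> w \in iota 1 k.+1 by rewrite mem_iota; lia.
case: s s3 s1 hk => [|x [|y [|z []]]] // _ /and4P[x0 y0 z0 _] hk.
rewrite /hairs /= in hk.
apply: (allpairs_f cons); last apply: (allpairs_f (fun y z => [:: y; z]));
  by apply: inI => //; lia.
Qed.

End Types.

Section Coordinates.
Variables m N : nat.
Hypotheses (N_gt0 : (0 < N)%N) (N_even : ~~ odd N) (m_odd : odd m).
Notation ceq := (ceq m N).
Variables (i k : nat) (f : ograph -> chain) (D : seq nat -> chain).
Hypothesis i_le2 : (i <= 2)%N.
Notation a := (0 < i)%N.
Notation b := (1 < i)%N.
Hypothesis f_theta : forall G s o, n_ext G = k -> oriented G -> has_theta G a b s o ->
  (i == 1%N) || ~~ flip_sign s -> ceq (f G) ((-1) ^+ o *: D s).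
Hypothesis f_eps : forall G s o, n_ext G = k -> oriented G -> has_theta G a b s o ->
  ~~ ((i == 1%N) || ~~ flip_sign s) -> zero_class m N (f G).

Lemma types_coef t G s o : t \in types i k -> oriented G -> has_theta G a b s o ->
  theta_coef a b t G = if perm_eq s t then (-1) ^+ (o (+) (odd_sign s (+) odd_sign t)) else 0.
Proof.
rewrite mem_types => /and5P[_ _ _ tU /andP[_ te]] Go T; apply: (theta_coef_theta Go T tU).
by move: i_le2 te; case: (i) => [|[|[]]].
Qed.

(** If the nonvanishing conditions hold, only the sorted list of strand lengths contributes.
    Otherwise all coordinates are zero, and [f G] vanishes by [f_eps] or by two strands of equal odd
    length. *)
Lemma coord_gen G s o : n_ext G = k -> oriented G -> has_theta G a b s o ->
  ceq (f G) (\sum_(t <- types i k) theta_coef a b t G *: D t).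
Proof.
move=> Gk Go T; have [s3 s1] := has_theta_pos T.
case: (boolP (uniq (filter odd s) && ((i == 1%N) || ~~ flip_sign s))) => [/andP[sU se]|nU].
  have p : perm_eq s (sort geq s) by rewrite perm_sym perm_sort.
  have T0 := has_theta_perm Go sU p T; set o0 := (o (+) _) in T0.
  have e0 : (i == 1%N) || ~~ flip_sign (sort geq s) by rewrite /flip_sign -(perm_big _ p).
  have hk : hairs a b (sort geq s) = k by rewrite -Gk (has_theta_n_ext T0).
  have t0 : sort geq s \in types i k.
    rewrite mem_types /is_type size_sort s3 all_sort s1 e0 andbT /=.
    rewrite -(perm_uniq (perm_filter odd p)) sU hk eqxx andbT.
    by rewrite sort_sorted // => x y; apply: leq_total.
  rewrite (bigD1_seq _ t0 (types_uniq _ _)) /= big1_seq.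
    rewrite addr0 (types_coef t0 Go T0) perm_refl addbb addbF.
    exact: f_theta Gk Go T0 e0.
  move=> t /andP[tt0 tT]; rewrite (types_coef tT Go T0); case: ifP => [p1|]; last by rewrite scale0r.
  move: tT; rewrite mem_types => /and5P[_ _ tS _ _].
  have anti : antisymmetric geq by move=> x y; rewrite andbC; apply: anti_leq.
  have tr : transitive geq by move=> x y z /[swap]; apply: leq_trans.
  case/eqP: tt0; apply/esym/(sorted_eq tr anti) => //.
  by apply: sort_sorted => x y; apply: leq_total.
rewrite big1_seq => [|t /= tT]; last first.
  rewrite (types_coef tT Go T); case: ifP => [p|]; last by rewrite scale0r.
  move: tT nU; rewrite mem_types => /and5P[_ _ _ tU /andP[_ te]].
  by rewrite (perm_uniq (perm_filter odd p)) tU /flip_sign (perm_big _ p) te.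
suff: zero_class m N (f G - 0) by [].
rewrite subr0.
case: (boolP ((i == 1%N) || ~~ flip_sign s)) nU => [se|se _]; last exact: f_eps Gk Go T se.
rewrite andbT => /(has_theta_repeated_odd Go T)[s' [o' [T1 T2]]].
have se' : (i == 1%N) || ~~ flip_sign s'.
  by have [p _] := has_theta_rigid Go T T1; rewrite /flip_sign -(perm_big _ p).
exact: (zero_of_signs (f_theta Gk Go T1 se') (f_theta Gk Go T2 se')).
Qed.

Lemma hairy_has_theta x G : hairy_chain i k x -> G \in msupp x ->
  [/\ n_ext G = k, oriented G & exists s o, has_theta G a b s o].
Proof.
move=> hx /hx[/admissible_oriented Go tl di Gk]; split=> //.
have [u [w [ls [hs [a' [b' T]]]]]] := two_loop_hairy_theta tl.
have T' : has_theta G a' b' (map size ls) (strand_sign ls hs) by exists u, w, ls, hs.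
move: di T'; rewrite (theta_defect T) => <-; case: (a') (b') => -[] T'.
- by exists (map size ls), (strand_sign ls hs).
- by exists (map size ls), (strand_sign ls hs).
(* In defect 1 the hair is assumed at the first end vertex; here it is at the second. *)
- by have := has_theta_flip Go T'; exists (map size ls), (strand_sign ls hs (+) flip_sign (map size ls)).
by exists (map size ls), (strand_sign ls hs).
Qed.

(** Used with [gen] and [diff_gen] for [f]: it expands a chain in standard graphs, and its boundary
    in the boundaries of standard graphs. *)
Lemma coord_chain x : hairy_chain i k x ->
  ceq (lext f x) (\sum_(t <- types i k) theta_form a b t x *: D t).
Proof.
move=> hx; apply: (@ceq_trans _ _ (\sum_(G <- msupp x) x@_G *:
    \sum_(t <- types i k) theta_coef a b t G *: D t)).
  apply: ceq_sum => G /(hairy_has_theta hx)[Gk Go [s [o T]]] _.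
  exact: ceqZ (coord_gen Gk Go T).
have -> : \sum_(t <- types i k) theta_form a b t x *: D t =
    \sum_(t <- types i k) \sum_(G <- msupp x) (x@_G * theta_coef a b t G) *: D t.
  by apply: eq_bigr => t _; rewrite scaler_suml.
rewrite exchange_big; apply: ceq_sum => G _ _; rewrite scaler_sumr.
have -> : \sum_(t <- types i k) x@_G *: (theta_coef a b t G *: D t) =
    \sum_(t <- types i k) (x@_G * theta_coef a b t G) *: D t.
  by apply: eq_bigr => t _; rewrite scalerA.
exact: ceq_refl.
Qed.

End Coordinates.

(* The class of the boundary of the standard graph of defect i and strand
   lengths s; for i = 2 both four-valent vertices contribute equally. *)
Definition type_diff (i : nat) (s : seq nat) : chain :=
  (i%:R : rat) *: grow (1 < i)%N (nth 0%N s 0) (nth 0%N s 1) (nth 0%N s 2).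

Definition coords (i k : nat) (x : chain) : 'rV[rat]_(size (types i k)) :=
  \row_j theta_form (0 < i)%N (1 < i)%N (nth [::] (types i k) j) x.

Definition bmx (i k : nat) : 'M[rat]_(size (types i.+1 k), size (types i k)) :=
  \matrix_(r, j) coords i k (type_diff i.+1 (nth [::] (types i.+1 k) r)) 0 j.

Lemma diffE x : diff x = lext diff_gen x. Proof. by []. Qed.

Lemma lext_gen_id (x : chain) : lext gen x = x.
Proof.
rewrite [RHS]monalgE; apply: eq_bigr => G _; apply/malgP => G'.
by rewrite mcoeffZ !mcoeffU; case: eqP => _; rewrite ?mulr1 ?mulr0.
Qed.

Section HairyChain.
Variables i k : nat.

Lemma hairy_chain0 : hairy_chain i k 0.
Proof. by move=> G; rewrite msupp0. Qed.

Lemma hairy_chainD x y : hairy_chain i k x -> hairy_chain i k y -> hairy_chain i k (x + y).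
Proof.
move=> hx hy G Gxy; have := fsubsetP (msuppD_le x y) _ Gxy.
by rewrite inE => /orP[/hx|/hy].
Qed.

Lemma hairy_chainZ c x : hairy_chain i k x -> hairy_chain i k (c *: x).
Proof. by move=> hx G Gx; apply: hx; apply: (fsubsetP (msuppZ_le c x)). Qed.

Lemma hairy_chainB x y : hairy_chain i k x -> hairy_chain i k y -> hairy_chain i k (x - y).
Proof. by move=> hx hy; apply: hairy_chainD => //; rewrite -scaleN1r; apply: hairy_chainZ. Qed.

Lemma hairy_chain_sum (I : eqType) (r : seq I) (f : I -> chain) :
  (forall j, j \in r -> hairy_chain i k (f j)) -> hairy_chain i k (\sum_(j <- r) f j).
Proof.
move=> hf; rewrite big_seq; elim/big_rec: _ => [|j x /hf hj hx]; first exact: hairy_chain0.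
exact: hairy_chainD.
Qed.

End HairyChain.

Lemma hairy_theta_gen (a b : bool) k s : (0 < k)%N -> size s = 3%N -> all (leq 1) s ->
  hairs a b s = k -> hairy_chain (a + b) k (theta_gen a b s).
Proof.
move=> k0 s3 s1 hk G /(fsubsetP (@msuppU_le _ _ _ _)); rewrite inE => /eqP ->.
have [So ST] := stdP a b s3 s1; have Sk := std_n_ext a b s3 s1; rewrite hk in Sk.
have [u [w [ls [hs [T _ _]]]]] := ST; have h0 : (0 < n_ext (std_theta a b s))%N by rewrite Sk.
split=> //.
- exact: theta_admissible h0 So T.
- exact: theta_two_loop_hairy T h0.
exact: theta_defect T.
Qed.

Lemma coords_comb i k d (c : 'I_d -> rat) (x : 'I_d -> chain) :
  coords i k (\sum_j c j *: x j) = \sum_j c j *: coords i k (x j).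
Proof.
apply/rowP => t; rewrite mxE summxE theta_form_sum; apply: eq_bigr => j _.
by rewrite theta_formZ !mxE.
Qed.

Lemma coordsB i k x y : coords i k (x - y) = coords i k x - coords i k y.
Proof. by apply/rowP => t; rewrite !mxE theta_formB. Qed.

Lemma hairy_grow b k P Q R : (0 < k)%N -> [&& 0 < P, 0 < Q & 0 < R]%N ->
  hairs true b [:: P; Q; R] = k -> hairy_chain b k (grow b P Q R).
Proof.
move=> k0 /and3P[P0 Q0 R0] hk; have hS s : size s = 3%N -> all (leq 1) s -> hairs false b s = k ->
    hairy_chain b k (theta_gen false b s) by exact: (@hairy_theta_gen false).
move: hk; rewrite /hairs /= => hk.
by apply: hairy_chainD; [apply: hairy_chainD|]; try apply: hairy_chainZ; apply: hS => //;
  rewrite /hairs /= ?P0 ?Q0 ?R0 //; move: hk; case: (b) => /=; lia.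
Qed.

Lemma typesP i k s : s \in types i k -> exists x y z,
  [/\ s = [:: x; y; z], [&& 0 < x, 0 < y & 0 < z]%N,
      hairs (0 < i)%N (1 < i)%N s = k, uniq (filter odd s) & (i == 1%N) || ~~ flip_sign s].
Proof.
rewrite mem_types; case/and5P=> /eqP s3 s1 _ sU /andP[/eqP hk e].
case: s s3 s1 sU hk e => [|x [|y [|z []]]] // _ s1 sU hk e.
by exists x, y, z; split=> //; move: s1; rewrite /= andbT.
Qed.

Lemma hairy_type_diff i k s : (i <= 1)%N -> (0 < k)%N -> s \in types i.+1 k ->
  hairy_chain i k (type_diff i.+1 s).
Proof.
move=> i1 k0 /typesP[x [y [z [-> s0 hk _ _]]]]; apply: hairy_chainZ.
by case: i i1 hk => [|[|]] // _ hk; [apply: (@hairy_grow false)|apply: (@hairy_grow true)].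
Qed.

(** * The complex in coordinates *)

Section Complex.
Variables m N k : nat.
Hypotheses (N_gt0 : (0 < N)%N) (N_even : ~~ odd N) (m_odd : odd m) (k_gt0 : (0 < k)%N).
Notation ceq := (ceq m N).

Lemma coords_zero i x : zero_class m N x -> coords i k x = 0.
Proof. by move=> z; apply/rowP => t; rewrite !mxE (theta_form_zero N_gt0 N_even m_odd _ _ _ z). Qed.

Lemma coords_ceq i x y : ceq x y -> coords i k x = coords i k y.
Proof. by move/(coords_zero i)/eqP; rewrite coordsB subr_eq0 => /eqP. Qed.

Lemma theta_gen_eps a s : size s = 3%N -> all (leq 1) s -> hairs a a s = k -> flip_sign s ->
  zero_class m N (theta_gen a a s).
Proof. by move=> s3 s1 hk e; apply: (theta_gen_odd_flip N_gt0 N_even m_odd); rewrite ?hk. Qed.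

Lemma hairy_ceq i x : (i <= 2)%N -> hairy_chain i k x ->
  ceq x (\sum_(t <- types i k) theta_form (0 < i)%N (1 < i)%N t x *: theta_gen (0 < i)%N (1 < i)%N t).
Proof.
move=> i2 hx; rewrite -{1}(lext_gen_id x); apply: (coord_chain i2) hx.
  move=> G s o Gk Go T _; apply: (has_theta_ceq N_gt0 N_even m_odd _ Go T).
  by rewrite Gk.
move=> G s o Gk Go T; rewrite negb_or negbK => /andP[i1 e]; have [s3 s1] := has_theta_pos T.
have h0 : (0 < n_ext G)%N by rewrite Gk.
apply: ceq_zero (has_theta_ceq N_gt0 N_even m_odd h0 Go T) _; apply: zero_classZ.
have := has_theta_n_ext T; rewrite Gk.
by case: i i2 i1 {T} => [|[|[|]]] // _ _ hk; apply: theta_gen_eps.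
Qed.

Lemma diff_ceq i x : (i <= 1)%N -> hairy_chain i.+1 k x ->
  ceq (diff x) (\sum_(t <- types i.+1 k) theta_form (0 < i.+1)%N (1 < i.+1)%N t x *: type_diff i.+1 t).
Proof.
move=> i1 hx; rewrite diffE; apply: (coord_chain (i1 : (i.+1 <= 2)%N)) hx.
  move=> G s o Gk Go T; have h0 : (0 < n_ext G)%N by rewrite Gk.
  have [s3 _] := has_theta_pos T; case: s s3 T => [|P [|Q [|R []]]] // _ T e.
  case: i i1 T e => [|[|]] // _ T e; rewrite /type_diff.
    by rewrite scale1r; apply: (diff_gen_one N_gt0 N_even m_odd h0 Go T).
  apply: ceq_trans (diff_gen_two N_gt0 N_even m_odd h0 Go T) _; rewrite (negbTE e) addbF.
  by rewrite scalerA mulr_natr -mulr2n; apply: ceq_refl.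
move=> G s o Gk Go T; have h0 : (0 < n_ext G)%N by rewrite Gk.
have [s3 _] := has_theta_pos T; case: s s3 T => [|P [|Q [|R []]]] // _ T.
rewrite negb_or negbK => /andP[]; case: i i1 T => [|[|]] // _ T _ e.
apply: ceq_zero (diff_gen_two N_gt0 N_even m_odd h0 Go T) _; rewrite e addbT.
have -> : (-1) ^+ o + (-1) ^+ (~~ o) = 0 :> rat by case: (o); rewrite ?expr1 ?expr0 ?addrN ?addNr.
by rewrite scale0r; apply: zero_class0.
Qed.

Lemma diff_zero x : hairy_chain 0 k x -> diff x = 0.
Proof.
move=> hx; rewrite diffE /lext big_seq big1 // => G Gx.
have [_ _ [s [o T]]] := hairy_has_theta hx Gx.
have [s3 _] := has_theta_pos T; case: s s3 T => [|P [|Q [|R []]]] // _ T.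
by rewrite (diff_gen_zero T) scaler0.
Qed.

Lemma coords_diff i x : (i <= 1)%N -> hairy_chain i.+1 k x ->
  coords i k (diff x) = coords i.+1 k x *m bmx i k.
Proof.
move=> i1 hx; rewrite (coords_ceq i (diff_ceq i1 hx)); apply/rowP => j; rewrite !mxE theta_form_sum.
rewrite (big_nth [::]) big_mkord; apply: eq_bigr => r _.
by rewrite theta_formZ !mxE.
Qed.

Lemma hairy_zero i x : (i <= 2)%N -> hairy_chain i k x -> coords i k x = 0 -> zero_class m N x.
Proof.
move=> i2 hx cx; apply: ceq_zero (hairy_ceq i2 hx) _; rewrite big1_seq; first exact: zero_class0.
move=> t /= tT; have lt : (index t (types i k) < size (types i k))%N by rewrite index_mem.
have := congr1 (fun v : 'rV__ => v 0 (Ordinal lt)) cx; rewrite !mxE /= nth_index // => ->.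
by rewrite scale0r.
Qed.

(** Coordinates detect vanishing on hairy chains, by [hairy_zero]. Therefore [diff y] is replaced by
    the congruent combination [y'] of boundaries of types, which is hairy by construction. *)
Lemma hairy_diff i x y : (i <= 1)%N -> hairy_chain i k x -> hairy_chain i.+1 k y ->
  zero_class m N (x - diff y) <-> coords i k x = coords i.+1 k y *m bmx i k.
Proof.
move=> i1 hx hy; rewrite -(coords_diff i1 hy); split; first exact: coords_ceq.
move=> cxy; have dy := diff_ceq i1 hy; set y' := \sum_(t <- _) _ in dy.
have hy' : hairy_chain i k y'.
  apply: hairy_chain_sum => t tT; apply: hairy_chainZ; exact: hairy_type_diff.
suff xy' : ceq x y' by apply: ceq_trans xy' (ceq_sym dy).
apply: (@hairy_zero i); first exact: leq_trans i1 _; first exact: hairy_chainB.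
by rewrite coordsB cxy (coords_ceq i dy) subrr.
Qed.

Lemma types_perm_eq i s t : s \in types i k -> t \in types i k -> perm_eq s t = (s == t).
Proof.
rewrite !mem_types => /and5P[_ _ ss _ _] /and5P[_ _ ts _ _]; apply/idP/eqP => [p|-> //].
apply: (sorted_eq _ _ ss ts p); first by move=> x y z /[swap]; apply: leq_trans.
by move=> x y; rewrite andbC; apply: anti_leq.
Qed.

Lemma theta_form_gen_types i s t : (i <= 2)%N -> s \in types i k -> t \in types i k ->
  theta_form (0 < i)%N (1 < i)%N t (theta_gen (0 < i)%N (1 < i)%N s) = (s == t)%:R.
Proof.
move=> i2 sT tT; have [x [y [z [E s0 hk _ _]]]] := typesP sT.
have [s3 s1] : size s = 3%N /\ all (leq 1) s by rewrite E /= andbT.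
have [So ST] := stdP (0 < i)%N (1 < i)%N s3 s1.
apply: etrans (theta_form_gen _ _ _ _) _; rewrite (types_coef i2 tT So ST) (types_perm_eq sT tT).
by case: eqP => // ->; rewrite addbb.
Qed.

Lemma coords_onto i (v : 'rV_(size (types i k))) : (i <= 2)%N ->
  exists2 x, hairy_chain i k x & coords i k x = v.
Proof.
move=> i2; have inT (j : 'I_(size (types i k))) : nth [::] (types i k) j \in types i k.
  exact: mem_nth.
exists (\sum_j v 0 j *: theta_gen (0 < i)%N (1 < i)%N (nth [::] (types i k) j)).
  apply: hairy_chain_sum => j _; apply: hairy_chainZ.
  have [x [y [z [E s0 hk _ _]]]] := typesP (inT j).
  have := @hairy_theta_gen (0 < i)%N (1 < i)%N k (nth [::] (types i k) j) k_gt0.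
  rewrite hk E /= andbT => /(_ erefl s0 erefl).
  by case: i i2 {v inT E hk} j => [|[|[|]]].
rewrite coords_comb; apply/rowP => j; rewrite summxE (bigD1 j) //= big1 => [|j' j'j].
  by rewrite !mxE theta_form_gen_types // eqxx mulr1 addr0.
by rewrite !mxE theta_form_gen_types // nth_uniq ?types_uniq // (negbTE (_ : j' != j :> nat)) // mulr0.
Qed.

Lemma diffD x y : diff (x + y) = diff x + diff y. Proof. exact: lextD. Qed.

Lemma diff_scale c x : diff (c *: x) = c *: diff x. Proof. exact: lextZ. Qed.

(** The terms of [grow true] have their hair at the second end vertex, whereas [diff_gen_one] splits
    at the first; exchanging the ends costs [flip_sign s]. *)
Lemma diff_theta_gen s : size s = 3%N -> all (leq 1) s -> hairs false true s = k ->
  ceq (diff (theta_gen false true s)) ((-1) ^+ flip_sign s *: type_diff 1 s).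
Proof.
move=> s3 s1 hk; have [So ST] := stdP false true s3 s1.
have Sk := std_n_ext false true s3 s1; rewrite hk in Sk.
have h0 : (0 < n_ext (std_theta false true s))%N by rewrite Sk.
have -> : diff (theta_gen false true s) = diff_gen (std_theta false true s) by exact: lext_gen.
have := has_theta_flip So ST; rewrite addFb /type_diff scale1r.
case: s s3 s1 hk So ST Sk h0 => [|P [|Q [|R []]]] // _ _ _ So _ _ h0.
by move=> T; have := diff_gen_one N_gt0 N_even m_odd h0 So T.
Qed.

Lemma flip_sign3 P Q R : flip_sign [:: P; Q; R] = odd 'C(P, 2) (+) odd 'C(Q, 2) (+) odd 'C(R, 2).
Proof. by rewrite /flip_sign !big_cons big_nil addbF addbA. Qed.

Lemma odd_bin2S P : odd 'C(P.+1, 2) = odd 'C(P, 2) (+) odd P.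
Proof. by rewrite binS oddD bin1. Qed.

(** Here p, q, r are the parities of P, Q, R, and x, y, z those of 'C(P, 2), 'C(Q, 2), 'C(R, 2). The
    numbers a0, a1, a2 belong to the triples in which one strand grows by 2; this changes
    [flip_sign], so they vanish. The numbers a3, a4, a5 belong to the triples in which two strands
    grow; each arises in two ways, which cancel if these two strands have the same parity, while
    otherwise [flip_sign] becomes odd or the signs cancel as well. *)
Lemma growth_signs (p q r x y z : bool) (u v w a0 a1 a2 a3 a4 a5 : rat) :
  ~~ (x (+) y (+) z) ->
  u = (-1) ^+ (x (+) p (+) y (+) z) *
    (a0 + (-1) ^+ (~~ p) * a3 + (-1) ^+ (~~ (p (+) q)) * a4) ->
  v = (-1) ^+ (x (+) (y (+) q) (+) z) * (a3 + (-1) ^+ p * a1 + (-1) ^+ (p (+) ~~ q) * a5) ->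
  w = (-1) ^+ (x (+) y (+) (z (+) r)) * (a4 + (-1) ^+ p * a5 + (-1) ^+ (p (+) q) * a2) ->
  (x (+) p (+) ~~ p (+) y (+) z -> a0 = 0) ->
  (x (+) (y (+) q (+) ~~ q) (+) z -> a1 = 0) ->
  (x (+) y (+) (z (+) r (+) ~~ r) -> a2 = 0) ->
  (x (+) p (+) (y (+) q) (+) z -> a3 = 0) -> (x (+) p (+) y (+) (z (+) r) -> a4 = 0) ->
  (x (+) (y (+) q) (+) (z (+) r) -> a5 = 0) ->
  u + (-1) ^+ p * v + (-1) ^+ (p (+) q) * w = 0.
Proof.
move=> e -> -> -> H0 H1 H2.
have -> : a0 = 0 by apply: H0; move: e; clear; case: x; case: y; case: z; case: p.
have -> : a1 = 0 by apply: H1; move: e; clear; case: x; case: y; case: z; case: q.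
have -> : a2 = 0 by apply: H2; move: e; clear; case: x; case: y; case: z; case: r.
move=> {H0 H1 H2}.
have zE : z = x (+) y by move: e; clear; case: x; case: y; case: z.
rewrite {}zE {e}.
case: p q r x y => -[] [] [] [] /= H3 H4 H5;
 rewrite ?(H3 isT) ?(H4 isT) ?(H5 isT) ?expr0 ?expr1; ring.
Qed.

Lemma coords_diff_grow P Q R : [&& 0 < P, 0 < Q & 0 < R]%N ->
  hairs true true [:: P; Q; R] = k -> ~~ flip_sign [:: P; Q; R] ->
  coords 0 k (diff (grow true P Q R)) = 0.
Proof.
move=> /and3P[P0 Q0 R0]; rewrite /hairs /= => hk; rewrite flip_sign3 => e.
apply/rowP => t; rewrite !mxE; set f := theta_form _ _ _.
have fD x y : f (x + y) = f x + f y by exact: theta_formD.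
have fZ c x : f (c *: x) = c * f x by exact: theta_formZ.
have f0 x y z : [&& 0 < x, 0 < y & 0 < z]%N -> hairs false false [:: x; y; z] = k ->
    flip_sign [:: x; y; z] -> f (theta_gen false false [:: x; y; z]) = 0.
  move=> /and3P[x0 y0 z0] h ez; apply: (theta_form_zero N_gt0 N_even m_odd); apply: theta_gen_eps => //.
  by rewrite /= x0 y0 z0.
have fS x y z : [&& 0 < x, 0 < y & 0 < z]%N -> hairs false true [:: x; y; z] = k ->
    f (diff (theta_gen false true [:: x; y; z])) = (-1) ^+ flip_sign [:: x; y; z] *
      (f (theta_gen false false [:: x.+1; y; z]) + (-1) ^+ odd x * f (theta_gen false false [:: x; y.+1; z])
       + (-1) ^+ odd (x + y) * f (theta_gen false false [:: x; y; z.+1])).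
  move=> /and3P[x0 y0 z0] h; rewrite -!fZ -!fD -fZ; apply: subr0_eq.
  apply: etrans (esym (theta_formB _ _ _ _ _)) _; apply: (theta_form_zero N_gt0 N_even m_odd).
  have := @diff_theta_gen [:: x; y; z]; rewrite /type_diff scale1r; apply=> //=.
  by rewrite x0 y0 z0.
have Z x y z : [&& 0 < x, 0 < y & 0 < z]%N -> (x + y + z = P + Q + R + 2)%N ->
    flip_sign [:: x; y; z] -> f (theta_gen false false [:: x; y; z]) = 0.
  by move=> xyz h; apply: f0 => //; move: hk xyz; rewrite /hairs /=; lia.
have fd c d x y z : f (diff (x + c *: y + d *: z)) = f (diff x) + c * f (diff y) + d * f (diff z).
  by rewrite !diffD !diff_scale !fD !fZ.
apply: etrans (fd _ _ _ _ _) _.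
have h1 : hairs false true [:: P.+1; Q; R] = k by move: hk; rewrite /hairs /=; lia.
have h2 : hairs false true [:: P; Q.+1; R] = k by move: hk; rewrite /hairs /=; lia.
have h3 : hairs false true [:: P; Q; R.+1] = k by move: hk; rewrite /hairs /=; lia.
have PQR (x y z : nat) : [&& 0 < P + x, 0 < Q + y & 0 < R + z]%N.
  by rewrite !addn_gt0 P0 Q0 R0.
have := PQR 2 0 0; have := PQR 0 2 0; have := PQR 0 0 2; have := PQR 1 1 0.
have := PQR 1 0 1; have := PQR 0 1 1; have := PQR 1 0 0; have := PQR 0 1 0; have := PQR 0 0 1.
rewrite !addn0 !addn1 !addn2 => g3 g2 g1 t5 t4 t3 t2 t1 t0.
have := Z _ _ _ t0 ltac:(lia); have := Z _ _ _ t1 ltac:(lia); have := Z _ _ _ t2 ltac:(lia).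
have := Z _ _ _ t3 ltac:(lia); have := Z _ _ _ t4 ltac:(lia); have := Z _ _ _ t5 ltac:(lia).
have := fS _ _ _ g1 h1; have := fS _ _ _ g2 h2; have := fS _ _ _ g3 h3.
move: e; rewrite !flip_sign3 !odd_bin2S /= !oddD /= => e E3 E2 E1 Z5 Z4 Z3 Z2 Z1 Z0.
exact: growth_signs e E1 E2 E3 Z0 Z1 Z2 Z3 Z4 Z5.
Qed.

End Complex.

Section Homology.
Variables m N k : nat.
Hypotheses (N_gt0 : (0 < N)%N) (N_even : ~~ odd N) (m_odd : odd m) (k_gt0 : (0 < k)%N).

(** The square of the differential is evaluated on the types of defect 2 only, where it reduces to
    [coords_diff_grow]. *)
Lemma bmx_mul : bmx 1 k *m bmx 0 k = 0.
Proof.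
apply/row_matrixP => r; rewrite row_mul row0.
set s := nth [::] (types 2 k) r; have sT : s \in types 2 k by apply: mem_nth.
have -> : row r (bmx 1 k) = coords 1 k (type_diff 2 s) by apply/rowP => j; rewrite !mxE.
have hs := hairy_type_diff (isT : (1 <= 1)%N) k_gt0 sT.
rewrite -(coords_diff N_gt0 N_even m_odd k_gt0 (isT : (0 <= 1)%N) hs).
have [P [Q [R [E s0 hk _ e]]]] := typesP sT; rewrite E in e hk *.
have -> : diff (type_diff 2 [:: P; Q; R]) = 2 *: diff (grow true P Q R) by exact: diff_scale.
have -> : coords 0 k (2 *: diff (grow true P Q R)) = 2 *: coords 0 k (diff (grow true P Q R)).
  by apply/rowP => j; rewrite !mxE theta_formZ.
by rewrite (coords_diff_grow N_gt0 N_even m_odd) ?scaler0.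
Qed.

Lemma homology0 : hairy_homology_dim m N 0 k (size (types 0 k) - \rank (bmx 0 k)).
Proof.
suff: hairy_homology_dim m N 0 k (\rank (1%:M : 'M[rat]_(size (types 0 k))) - \rank (bmx 0 k)).
  by rewrite mxrank1.
apply: (@quotient_dim_rank _ _ (coords 0 k) (hairy_chain 0 k)).
- exact: coords_comb.
- exact: coordsB.
- by move=> z [hz _]; rewrite submx1.
- move=> v _; have [x hx <-] := coords_onto k_gt0 v (isT : (0 <= 2)%N).
  by exists x => //; split=> //; rewrite (diff_zero hx); apply: zero_class0.
- by move=> d c x hx; apply: hairy_chain_sum => j _; apply: hairy_chainZ.
- exact: hairy_chainB.
- move=> x hx; split.
    case=> y hy /(hairy_diff N_gt0 N_even m_odd k_gt0 (isT : (0 <= 1)%N) hx hy) ->.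
    exact: submxMl.
  case/submxP=> v E; have [y hy cy] := coords_onto k_gt0 v (isT : (1 <= 2)%N).
  exists y => //; apply/(hairy_diff N_gt0 N_even m_odd k_gt0 (isT : (0 <= 1)%N) hx hy).
  by rewrite cy.
exact: submx1.
Qed.

Lemma homology1 :
  hairy_homology_dim m N 1 k (size (types 1 k) - \rank (bmx 0 k) - \rank (bmx 1 k)).
Proof.
rewrite -mxrank_ker.
apply: (@quotient_dim_rank _ _ (coords 1 k) (hairy_chain 1 k)).
- exact: coords_comb.
- exact: coordsB.
- move=> z [hz dz]; split=> //; apply/sub_kermxP.
  rewrite -(coords_diff N_gt0 N_even m_odd k_gt0 (isT : (0 <= 1)%N) hz).
  exact: coords_zero dz.
- move=> v /sub_kermxP vM; have [x hx cx] := coords_onto k_gt0 v (isT : (1 <= 2)%N).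
  exists x => //; split=> //.
  suff : zero_class m N (0 - diff x) by rewrite sub0r => /zero_classN; rewrite opprK.
  apply/(hairy_diff N_gt0 N_even m_odd k_gt0 (isT : (0 <= 1)%N) (hairy_chain0 0 k) hx).
  by rewrite cx vM; apply: coords_zero (zero_class0 m N).
- by move=> d c x hx; apply: hairy_chain_sum => j _; apply: hairy_chainZ.
- exact: hairy_chainB.
- move=> x hx; split.
    case=> y hy /(hairy_diff N_gt0 N_even m_odd k_gt0 (isT : (1 <= 1)%N) hx hy) ->.
    exact: submxMl.
  case/submxP=> v E; have [y hy cy] := coords_onto k_gt0 v (isT : (2 <= 2)%N).
  exists y => //; apply/(hairy_diff N_gt0 N_even m_odd k_gt0 (isT : (1 <= 1)%N) hx hy).
  by rewrite cy.
by apply/sub_kermxP; exact: bmx_mul.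
Qed.

End Homology.

(** * Ranks and counting *)

(** In a nontrivial relation between the rows, take a row with nonzero coefficient and largest key:
    no other row of the relation meets its leading column. *)
Lemma rank_triangular (K : fieldType) p q (A : 'M[K]_(p, q)) (rows : seq 'I_p)
    (lead : 'I_p -> 'I_q) (key : 'I_q -> nat) : uniq rows ->
  {in rows, forall r, A r (lead r) != 0} ->
  {in rows &, forall r r', r != r' -> A r' (lead r) != 0 -> (key (lead r) < key (lead r'))%N} ->
  (size rows <= \rank A)%N.
Proof.
move=> U H0 H1; pose B := rowsub (tnth (in_tuple rows)) A.
have rB : \rank B = size rows.
  apply/eqP; apply: inj_row_free => v vB; apply/rowP => j; rewrite mxE; apply/eqP.
  apply: contraT => vj; pose f j := key (lead (tnth (in_tuple rows) j)).
  case: (@arg_maxnP _ j (fun j => v 0 j != 0) f vj) => r vr rmax.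
  have := congr1 (fun w : 'rV__ => w 0 (lead (tnth (in_tuple rows) r))) vB.
  rewrite !mxE (bigD1 r) //= big1 ?addr0 => [/eqP|r' r'r].
    by rewrite mulf_eq0 (negbTE vr) mxE (negbTE (H0 _ (mem_tnth _ (in_tuple rows)))).
  apply/eqP; rewrite mulf_eq0 mxE -[X in X || _]negbK -[X in _ || X]negbK -negb_and.
  apply/negP => /andP[/rmax vr' Ar].
  have rr : tnth (in_tuple rows) r != tnth (in_tuple rows) r'.
    have x0 := tnth (in_tuple rows) r.
    by rewrite !(tnth_nth x0) nth_uniq // eq_sym.
  have := H1 _ _ (mem_tnth r (in_tuple rows)) (mem_tnth r' (in_tuple rows)) rr Ar.
  by rewrite ltnNge => /negP; apply; exact: vr'.
by rewrite -rB; apply: mxrankS; apply/row_subP => r; rewrite row_rowsub row_sub.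
Qed.

(** * Entries of the matrices and their triangular parts *)

Section Entries.
Variables i k : nat.
Hypothesis i1 : (i <= 1)%N.

Definition entry (s t : seq nat) : rat := theta_form (0 < i)%N (1 < i)%N t (type_diff i.+1 s).

Lemma bmxE r j : bmx i k r j = entry (nth [::] (types i.+1 k) r) (nth [::] (types i k) j).
Proof. by rewrite !mxE. Qed.

(** For i = 1 the terms of [grow] have the hair at the second end vertex and the basis has it at the
    first, whence [flip_sign s]. *)
Lemma theta_form_gen_mixed s t : size s = 3%N -> all (leq 1) s -> t \in types i k ->
  theta_form (0 < i)%N (1 < i)%N t (theta_gen false (0 < i)%N s) =
  if perm_eq s t then (-1) ^+ (((0 < i)%N && flip_sign s) (+) (odd_sign s (+) odd_sign t)) else 0.
Proof.
move=> s3 s1 tT; have i2 : (i <= 2)%N by apply: leq_trans i1 _.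
have [So ST] := stdP false (0 < i)%N s3 s1; apply: etrans (theta_form_gen _ _ _ _) _.
have {}ST : has_theta (std_theta false (0 < i)%N s) (0 < i)%N (1 < i)%N s ((0 < i)%N && flip_sign s).
  move: ST So; case: i i1 => [|[|]] // _ ST So.
  by have := has_theta_flip So ST; rewrite addFb.
by rewrite (types_coef i2 tT So ST).
Qed.

End Entries.

Lemma mem_types3 j k x y z : ([:: x; y; z] \in types j k) =
  [&& 0 < z, z <= y, y <= x, odd x ==> (x != y), odd y ==> (y != z),
      (0 < j) + (1 < j) + (x + y + z) == k + 3 &
      (j == 1%N) || ~~ flip_sign [:: x; y; z]]%N.
Proof.
rewrite mem_types /is_type /hairs /= !andbT.
case: (boolP (0 < z)%N) => z0; last by rewrite !andbF.
case: (boolP (z <= y)%N) => zy; last by rewrite !(andbF, andFb).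
case: (boolP (y <= x)%N) => yx; last by rewrite !(andbF, andFb).
have -> : (0 < x)%N by apply: leq_trans yx; apply: leq_trans zy.
have -> : (0 < y)%N by apply: leq_trans zy.
rewrite /= !andbA; congr (_ && _).
congr (_ && _); last first.
  by apply/eqP/eqP; case: (_ < _)%N; case: (_ < _)%N; lia.
case ox: (odd x); case oy: (odd y); case oz: (odd z); rewrite /= ?inE //; move: zy yx ox oy oz; lia.
Qed.

Definition match_sign (i : nat) (t s : seq nat) : rat :=
  if perm_eq s t then (-1) ^+ (((0 < i)%N && flip_sign s) (+) (odd_sign s (+) odd_sign t)) else 0.

Section EntryTriple.
Variables i k : nat.
Hypothesis i1 : (i <= 1)%N.

Lemma entryE x y z t : (0 < x)%N -> (0 < y)%N -> (0 < z)%N -> t \in types i k ->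
  entry i [:: x; y; z] t = i.+1%:R * (match_sign i t [:: x.+1; y; z] +
    (-1) ^+ odd x * match_sign i t [:: x; y.+1; z] +
    (-1) ^+ odd (x + y) * match_sign i t [:: x; y; z.+1]).
Proof.
move=> x0 y0 z0 tT; rewrite /entry /type_diff /grow; apply: etrans (theta_formZ _ _ _ _ _) _.
congr (_ * _); apply: etrans (theta_formD _ _ _ _ _) _; congr (_ + _).
  apply: etrans (theta_formD _ _ _ _ _) _; congr (_ + _).
    by apply: (@theta_form_gen_mixed i k i1); rewrite //= y0 z0.
  apply: etrans (theta_formZ _ _ _ _ _) _; congr (_ * _).
  by apply: (@theta_form_gen_mixed i k i1); rewrite //= x0 z0.
apply: etrans (theta_formZ _ _ _ _ _) _; congr (_ * _).
by apply: (@theta_form_gen_mixed i k i1); rewrite //= x0 y0.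
Qed.

End EntryTriple.

Section Kids.
Variables i k : nat.
Hypothesis i1 : (i <= 1)%N.

Lemma sorted_types j s t : sorted geq s -> t \in types j k -> perm_eq s t -> s = t.
Proof.
rewrite mem_types => ss /and5P[_ _ ts _ _]; apply: sorted_eq ss ts.
  by move=> x y z /[swap]; apply: leq_trans.
by move=> x y; rewrite andbC; apply: anti_leq.
Qed.

(** If enlarging y or z breaks the order, that entry was equal to its predecessor, and sorting
    yields another triple of the list. *)
Lemma entry_kid x y z t : [:: x; y; z] \in types i.+1 k -> t \in types i k ->
  entry i [:: x; y; z] t != 0 ->
  t \in [:: [:: x.+1; y; z]; [:: x; y.+1; z]; [:: x; y; z.+1]].
Proof.
move=> sT tT; move: (sT); rewrite mem_types3 => /and5P[z0 zy yx _ _].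
have [x0 y0] : (0 < x)%N /\ (0 < y)%N by lia.
rewrite (entryE i1 _ _ _ tT) //; set f := match_sign i _ => ne0.
have fP s : perm_eq s t || (f s == 0) by rewrite /f /match_sign; case: ifP; rewrite ?eqxx.
have p1 : perm_eq [:: x.+1; y; z] t -> t = [:: x.+1; y; z].
  by move=> p; apply/esym; apply: sorted_types tT p; rewrite /= andbT; lia.
have p2 : perm_eq [:: x; y.+1; z] t -> t = [:: x; y.+1; z] \/ t = [:: x.+1; y; z].
  case: (ltngtP y x) => [yx'||yx'] p; [left|by lia|right].
    by apply/esym; apply: sorted_types tT p; rewrite /= andbT; lia.
  by apply: p1; apply: perm_trans p; rewrite yx'; apply/permP => q /=; lia.
have p3 : perm_eq [:: x; y; z.+1] t ->
    [\/ t = [:: x; y; z.+1], t = [:: x; y.+1; z] | t = [:: x.+1; y; z]].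
  case: (ltngtP z y) => [zy'||zy'] p; [apply: Or31|by lia|].
    by apply/esym; apply: sorted_types tT p; rewrite /= andbT; lia.
  have /p2[] : perm_eq [:: x; y.+1; z] t.
  - by apply: perm_trans p; rewrite zy'; apply/permP => q /=; lia.
  - exact: Or32.
  exact: Or33.
move: (fP [:: x.+1; y; z]) (fP [:: x; y.+1; z]) (fP [:: x; y; z.+1]).
case/orP=> [/p1 ->|/eqP f1]; first by rewrite !inE eqxx.
case/orP=> [/p2[] ->|/eqP f2]; [by rewrite !inE eqxx ?orbT..|].
case/orP=> [/p3[] ->|/eqP f3]; [by rewrite !inE eqxx ?orbT..|].
by case/eqP: ne0; rewrite f1 f2 f3 !mulr0 ?addr0 ?mulr0.
Qed.

Lemma scaled_sign_neq0 (n : nat) (o c d : bool) :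
  n.+1%:R * ((-1) ^+ o * (1 + c%:R + d%:R)) != 0 :> rat.
Proof.
rewrite mulf_neq0 ?mulf_neq0 ?pnatr_eq0 ?signr_eq0 //; last by case: c; case: d.
by rewrite Num.Theory.pnatr_eq0.
Qed.

(** For x = y, or x = y = z, several terms become the same triple after sorting. The common length
    is even, so their signs agree and they cannot cancel. *)
Lemma entry_up x y z : [:: x; y; z] \in types i.+1 k -> [:: x.+1; y; z] \in types i k ->
  entry i [:: x; y; z] [:: x.+1; y; z] != 0.
Proof.
move=> sT tT; move: (sT); rewrite mem_types3 => /and5P[z0 zy yx oxy /andP[oyz _]].
have [x0 y0] : (0 < x)%N /\ (0 < y)%N by lia.
rewrite (entryE i1 _ _ _ tT) //; set f := match_sign i _.
set o := ((0 < i)%N && flip_sign [:: x.+1; y; z]).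
have f1 : f [:: x.+1; y; z] = (-1) ^+ o * 1 by rewrite /f /match_sign perm_refl addbb addbF mulr1.
have f2 : (-1) ^+ odd x * f [:: x; y.+1; z] = (-1) ^+ o * (x == y)%:R.
  case: eqP => [E|xy]; last first.
    rewrite /f /match_sign; case: ifP => [/perm_mem/(_ x.+1)|]; last by rewrite !mulr0.
    by rewrite !inE eqxx; lia.
  move: oxy tT; rewrite /f /match_sign /o -{}E eqxx => ox _; have {}ox : odd x = false by case: (odd x) ox.
  rewrite ox mul1r (_ : perm_eq _ _); last by apply/permP => q /=; lia.
  by rewrite /odd_sign /= ox addbb addbF !flip_sign3 mulr1 /=; congr ((-1) ^+ (_ && _)); rewrite addbAC addbC addbA.
have f3 : (-1) ^+ odd (x + y) * f [:: x; y; z.+1] = (-1) ^+ o * ((x == y) && (y == z))%:R.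
  case: eqP => [E|xy] /=; last first.
    rewrite /f /match_sign; case: ifP => [/perm_mem/(_ x.+1)|]; last by rewrite !mulr0.
    by rewrite !inE eqxx; lia.
  case: eqP => [E'|yz]; last first.
    rewrite /f /match_sign; case: ifP => [/perm_mem/(_ x.+1)|]; last by rewrite !mulr0.
    by rewrite !inE eqxx; lia.
  move: oxy tT; rewrite /f /match_sign /o -E' -E eqxx => ox _; have {}ox : odd x = false by case: (odd x) ox.
  rewrite oddD ox mul1r (_ : perm_eq _ _); last by apply/permP => q /=; lia.
  by rewrite /odd_sign /= ox addbb addbF !flip_sign3 mulr1 /=; congr ((-1) ^+ (_ && _)); rewrite addbC addbA.
by rewrite f1 f2 f3 -!mulrDr scaled_sign_neq0.
Qed.

Lemma entry_mid x y z : [:: x; y; z] \in types i.+1 k -> [:: x; y.+1; z] \in types i k ->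
  entry i [:: x; y; z] [:: x; y.+1; z] != 0.
Proof.
move=> sT tT; move: (sT); rewrite mem_types3 => /and5P[z0 zy yx oxy /andP[oyz _]].
have yx' : (y < x)%N by move: tT; rewrite mem_types3; case/and5P.
have [x0 y0] : (0 < x)%N /\ (0 < y)%N by lia.
rewrite (entryE i1 _ _ _ tT) //; set f := match_sign i _.
set o := odd x (+) ((0 < i)%N && flip_sign [:: x; y.+1; z]).
have f1 : f [:: x.+1; y; z] = (-1) ^+ o * 0.
  rewrite /f /match_sign; case: ifP => [/perm_mem/(_ x.+1)|]; last by rewrite !mulr0.
  by rewrite !inE eqxx; lia.
have f2 : (-1) ^+ odd x * f [:: x; y.+1; z] = (-1) ^+ o * 1.
  by rewrite /f /match_sign perm_refl addbb addbF mulr1 -signr_addb.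
have f3 : (-1) ^+ odd (x + y) * f [:: x; y; z.+1] = (-1) ^+ o * (y == z)%:R.
  case: eqP => [E|yz]; last first.
    rewrite /f /match_sign; case: ifP => [|]; last by rewrite !mulr0.
    by rewrite perm_cons => /perm_mem/(_ y.+1); rewrite !inE eqxx; lia.
  move: oyz tT; rewrite /f /match_sign /o -{}E eqxx => oy _; have {}oy : odd y = false by case: (odd y) oy.
  rewrite oddD oy addbF (_ : perm_eq _ _); last by apply/permP => q /=; lia.
  by rewrite /odd_sign /= oy addbb addbF !flip_sign3 mulr1 -signr_addb /=; congr ((-1) ^+ (_ (+) (_ && _))); rewrite addbAC.
rewrite f1 f2 f3 -!mulrDr add0r.
by have := scaled_sign_neq0 i o false (y == z); rewrite addr0.
Qed.

End Kids.

Lemma odd_bin2 n : odd 'C(n, 2) = (2 <= n %% 4)%N.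
Proof.
rewrite {1}(divn_eq n 4); have := ltn_pmod n (isT : 0 < 4)%N; move: (n %% 4)%N => r r4.
elim: (n %/ 4)%N => [|q IH]; last first.
  rewrite mulSn -addnA addnC !addn4 /= !odd_bin2S /= -{}IH.
  by case: (odd 'C(_, 2)); case: (odd _).
by case: r r4 => [|[|[|[|]]]].
Qed.

(** As x - odd x is 2 'C(x, 2) modulo 4, the sign condition compares the number of odd entries with
    the sum of all entries. That sum is fixed by [j] and [k], and the condition is in a form
    accessible to [lia]. *)
Lemma mem_types_mod j k x y z : ([:: x; y; z] \in types j k) =
  [&& 0 < z, z <= y, y <= x, odd x ==> (x != y), odd y ==> (y != z),
      (0 < j) + (1 < j) + (x + y + z) == k + 3 &
      (j == 1%N) || (odd x + odd y + odd z == x + y + z %[mod 4])]%N.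
Proof.
rewrite mem_types3; do 6!congr (_ && _); congr (_ || _).
rewrite flip_sign3 !odd_bin2.
lia.
Qed.

Lemma entry_low i k x : (i <= 1)%N -> [:: x.+1; x.+1; x] \in types i.+1 k ->
  [:: x.+1; x.+1; x.+1] \in types i k -> entry i [:: x.+1; x.+1; x] [:: x.+1; x.+1; x.+1] != 0.
Proof.
move=> i1 sT tT; move: (sT); rewrite mem_types3 => /and5P[x0 _ _ _ _].
rewrite (entryE i1 _ _ _ tT) // /match_sign.
case: ifP => [/perm_mem/(_ x.+2)|_]; first by rewrite !inE eqxx; lia.
case: ifP => [/perm_mem/(_ x.+2)|_]; first by rewrite !inE eqxx; lia.
rewrite perm_refl addbb addbF mulr0 !add0r -signr_addb mulf_neq0 ?signr_eq0 //.
by rewrite Num.Theory.pnatr_eq0.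
Qed.

Lemma rank_bmx i k (rows : seq (seq nat)) (lead : seq nat -> seq nat) : uniq rows ->
  {in rows, forall s, [/\ s \in types i.+1 k, lead s \in types i k & entry i s (lead s) != 0]} ->
  {in rows &, forall s s', s != s' -> entry i s' (lead s) != 0 ->
     (head 0%N (lead s) < head 0%N (lead s'))%N} ->
  (size rows <= \rank (bmx i k))%N.
Proof.
move=> U H0 H1; case: rows U H0 H1 => // s0 rows U H0 H1.
have [s0T l0T _] := H0 s0 (mem_head _ _).
have idx_lt j s : s \in types j k -> (index s (types j k) < size (types j k))%N.
  by rewrite index_mem.
pose row s : 'I_(size (types i.+1 k)) := insubd (Ordinal (idx_lt _ _ s0T)) (index s (types i.+1 k)).
pose col t : 'I_(size (types i k)) := insubd (Ordinal (idx_lt _ _ l0T)) (index t (types i k)).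
have rowK s : s \in types i.+1 k -> nth [::] (types i.+1 k) (row s) = s.
  by move=> sT; rewrite val_insubd idx_lt // nth_index.
have colK t : t \in types i k -> nth [::] (types i k) (col t) = t.
  by move=> tT; rewrite val_insubd idx_lt // nth_index.
rewrite -(size_map row); apply: (@rank_triangular _ _ _ _ _
  (fun r => col (lead (nth [::] (types i.+1 k) r))) (fun c => head 0%N (nth [::] (types i k) c))).
- rewrite map_inj_in_uniq // => s s' /H0[sT _ _] /H0[sT' _ _] E.
  by rewrite -(rowK _ sT) E rowK.
- by move=> _ /mapP[s /H0[sT lT ne0] ->]; rewrite bmxE colK ?rowK.
move=> _ _ /mapP[s sR ->] /mapP[s' sR' ->] ss'.
have [[sT lT _] [sT' lT' _]] := (H0 s sR, H0 s' sR').
rewrite bmxE !rowK // !colK //; apply: H1 => //.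
by apply: contraNneq ss' => ->.
Qed.

(* The second and third case only apply to k = 1, 2 mod 4, where the repeated
   odd length forbids to enlarge another strand. *)
Definition lead (b : bool) (s : seq nat) : seq nat :=
  if s is [:: x; y; z] then
    if [&& b, odd y & x == y.+1] then [:: x; y.+1; z]
    else if [&& b, odd z, x == y & x == z.+1] then [:: x; y; z.+1]
    else [:: x.+1; y; z]
  else s.

(** The key is the largest entry of the leading triple. A regular [lead b s] arises from another
    regular row only by enlarging a smaller strand; that row then already has this largest entry, so
    its own leading triple has a larger one. Ordering and parity conditions settle the exceptional
    shapes. *)
Lemma rank_lead i k b (rows : seq (seq nat)) : (i <= 1)%N -> uniq rows ->
  {in rows, forall s, s \in types i.+1 k /\ lead b s \in types i k} ->
  (size rows <= \rank (bmx i k))%N.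
Proof.
move=> i1 U H; apply: (rank_bmx (lead := lead b)) => // [s /H[sT lT]|s s' /H[sT lT] /H[sT' lT']].
  split=> //; have [x [y [z [E _ _ _ _]]]] := typesP sT; rewrite {}E in sT lT *.
  move: sT lT; rewrite /lead; case: ifP => [_|_]; first exact: entry_mid.
  case: ifP => [/and4P[_ _ /eqP xy /eqP xz]|_]; last exact: entry_up.
  by rewrite -{}xy {}xz; apply: entry_low.
have [x [y [z [E _ _ _ _]]]] := typesP sT; rewrite {s}E in sT lT *.
have [x' [y' [z' [E' _ _ _ _]]]] := typesP sT'; rewrite {s'}E' in sT' lT' *.
move=> ss' /(entry_kid i1 sT' lT).
move: sT sT'; rewrite !mem_types3 => /and5P[_ zy yx oxy /andP[oyz _]] /and5P[_ zy' yx' oxy' /andP[oyz' _]].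
have {}ss' : ~~ [&& x == x', y == y' & z == z'].
  by apply: contraNN ss' => /and3P[/eqP -> /eqP -> /eqP ->].
move: ss'; rewrite /lead !inE => ss' {lT lT' H U rows}.
case: ifP => A; [|case: ifP => B]; (case: ifP => A'; [|case: ifP => B']) => /or3P[] /eqP[] ? ? ?; subst;
 rewrite /= ?ltnS.

all: clear i1; lia.
Qed.

(** * The matching of triples *)

Lemma size_bij (T U : eqType) (A : seq T) (B : seq U) (f : T -> U) (g : U -> T) :
  uniq A -> uniq B -> {in A, forall x, f x \in B /\ g (f x) = x} ->
  {in B, forall y, g y \in A /\ f (g y) = y} -> size A = size B.
Proof.
move=> uA uB H H'; rewrite -(size_map f); apply/perm_size/uniq_perm => // [|y].
  by rewrite map_inj_in_uniq // => x x' /H[_ {2}<-] /H[_ {2}<-] ->.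
apply/mapP/idP => [[x /H[xB _] ->] //|/H'[gy yE]]; by exists (g y).
Qed.

(** The inverse of [lead b] on the relevant triples. An exceptional move ends with two equal even
    largest entries, or with three equal even entries, and this is how it is recognized. *)
Definition unlead (b : bool) (s : seq nat) : seq nat :=
  if s is [:: x; y; z] then
    if [&& b, ~~ odd x & x == y] then
      if y == z then [:: x; y; z.-1] else [:: x; y.-1; z]
    else [:: x.-1; y; z]
  else s.

Definition triples (p : nat -> nat -> nat -> bool) (s : seq nat) : bool :=
  if s is [:: x; y; z] then p x y z else false.

(* Rows of the matrix of the differential to defect 0 carrying its rank, by the
   residue r of k modulo 4. *)
Definition pivot (r : nat) : pred (seq nat) := triples (fun x y z =>
  let c := (odd x + odd y + odd z)%N in
  match r with
  | 3 => (c == 3%N) || ~~ odd x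
  | 2 => [|| c == 0%N, odd x | x == y.+1]
  | 1 => (c == 1%N) && [|| odd x, odd y && (x == y.+1) | [&& odd z, x == y & x == z.+1]]
  | _ => (c == 2%N) && ~~ odd x
  end).

(** The types of defect 1 that are neither leading triples of defect 2 nor pivots. For k = 1 modulo
    4 the entry z is odd, and z + 3 <= x only excludes the pivots (x, x, x - 1). *)
Definition crit1 (r : nat) : pred (seq nat) := triples (fun x y z =>
  match r with
  | 1 => [&& ~~ odd x, x == y & z + 3 <= x]%N
  | 0 => [&& ~~ odd x, ~~ odd z & x == y]
  | _ => false
  end).

(** The types of defect 0 that are not leading triples of pivots. For r = 2 the triple (x, x, x - 1)
    is the sorted form of (x, x - 1, x), so it belongs to the same family. *)
Definition crit0 (r : nat) : pred (seq nat) := triples (fun x y z =>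
  match r with
  | 3 => ~~ odd x && (x == y.+1)
  | 2 => ~~ odd x && ((x == y.+1) || (x == y) && (x == z.+1))
  | _ => false
  end).

Section Count.
Variables q r : nat.
Hypothesis r4 : (r < 4)%N.
Notation k := (4 * q + r)%N.
Notation b := ((r == 1%N) || (r == 2%N)).

Lemma lead2 s : s \in types 2 k ->
  [/\ lead false s \in types 1 k, ~~ pivot r (lead false s), ~~ crit1 r (lead false s) &
      unlead false (lead false s) = s].
Proof.
move=> sT; have [x [y [z [E _ _ _ _]]]] := typesP sT; move: sT; rewrite {s}E.
rewrite /unlead /lead /pivot /crit1 /triples !mem_types_mod /= => sT.
by case: r r4 sT => [|[|[|[|]]]] // _ sT; split => //; lia.
Qed.

Lemma unlead2 s : s \in types 1 k -> ~~ pivot r s -> ~~ crit1 r s ->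
  unlead false s \in types 2 k /\ lead false (unlead false s) = s.
Proof.
move=> sT; have [x [y [z [E _ _ _ _]]]] := typesP sT; move: sT; rewrite {s}E.
rewrite /unlead /lead /pivot /crit1 /triples !mem_types_mod /= => sT.
case: x sT => [|x] /= sT P C; first by lia.
split=> //; move: sT P C.
case: r r4 => [|[|[|[|]]]] // _; case ox: (odd x); case oy: (odd y); case oz: (odd z);
  rewrite /= => sT P C; lia.
Qed.

Lemma pivot_crit1 s : s \in types 1 k -> pivot r s -> ~~ crit1 r s.
Proof.
move=> sT; have [x [y [z [E _ _ _ _]]]] := typesP sT; move: sT; rewrite {s}E.
rewrite /pivot /crit1 /triples !mem_types_mod /= => sT.
by case: r r4 sT => [|[|[|[|]]]] // _ sT; lia.
Qed.

Lemma lead1 s : s \in types 1 k -> pivot r s ->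
  [/\ lead b s \in types 0 k, ~~ crit0 r (lead b s) & unlead b (lead b s) = s].
Proof.
move=> sT; have [x [y [z [E _ _ _ _]]]] := typesP sT; move: sT; rewrite {s}E.
rewrite /lead; case: ifP => A; [|case: ifP => B];
  rewrite /unlead /pivot /crit0 /triples !mem_types_mod /= => sT P.
- have -> : (x == y.+1) = true by lia.
  have -> : odd x = false by lia.
  have -> : (y.+1 == z) = false by lia.
  by rewrite andbT ifT; last lia; case: r r4 sT P A => [|[|[|[|]]]] // _ sT P A; split => //; lia.
- have -> : (x == y) = true by lia.
  have -> : odd x = false by lia.
  have -> : (y == z.+1) = true by lia.
  by rewrite andbT ifT; last lia; case: r r4 sT P A B => [|[|[|[|]]]] // _ sT P A B; split => //; lia.
have -> : [&& b, ~~ ~~ odd x & x.+1 == y] = false by lia.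
case: r r4 sT P A B => [|[|[|[|]]]] // _; case ox: (odd x); case oy: (odd y); case oz: (odd z);
  rewrite //= => sT P A B; split => //; lia.
Qed.

Lemma unlead1 s : s \in types 0 k -> ~~ crit0 r s ->
  [/\ unlead b s \in types 1 k, pivot r (unlead b s) & lead b (unlead b s) = s].
Proof.
move=> sT; have [x [y [z [E _ _ _ _]]]] := typesP sT; move: sT; rewrite {s}E.
rewrite /unlead; case: ifP => A; [case: ifP => B|];
  rewrite /lead /pivot /crit0 /triples !mem_types_mod /= => sT P.
- have -> : [&& b, odd y & x == y.+1] = false by lia.
  have -> : [&& b, odd z.-1, x == y & x == z.-1.+1] = true by lia.
  have -> : z.-1.+1 = z by lia.
  by case: r r4 sT P A B => [|[|[|[|]]]] // _ sT P A B; split => //; lia.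
- have -> : [&& b, odd y.-1 & x == y.-1.+1] = true by lia.
  have -> : y.-1.+1 = y by lia.
  by case: r r4 sT P A B => [|[|[|[|]]]] // _ sT P A B; split => //; lia.
have -> : [&& b, odd y & x.-1 == y.+1] = false.
  by case: r r4 sT P A => [|[|[|[|]]]] // _ sT P A; lia.
have -> : [&& b, odd z, x.-1 == y & x.-1 == z.+1] = false.
  by case: r r4 sT P A => [|[|[|[|]]]] // _ sT P A; lia.
case: x sT P A => [|x] /=; first by lia.
case: r r4 => [|[|[|[|]]]] // _; case ox: (odd x); case oy: (odd y); case oz: (odd z);
  rewrite //= => sT P A; split => //; lia.
Qed.

End Count.

Section Dimensions.
Variables q r : nat.
Hypothesis r4 : (r < 4)%N.
Notation k := (4 * q + r)%N.

(** [lead false] matches the types of defect 2 with those types of defect 1 that are neither pivots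
    nor unmatched; by [pivot_crit1] these two kinds are disjoint. *)
Lemma size_types1 : size (types 1 k) =
  (size (types 2 k) + size (filter (pivot r) (types 1 k)) + size (filter (crit1 r) (types 1 k)))%N.
Proof.
have -> : size (types 2 k) =
    size (filter [pred s | ~~ pivot r s & ~~ crit1 r s] (types 1 k)).
  apply: (size_bij (f := lead false) (g := unlead false)) => [| |s sT|s].
  - exact: types_uniq.
  - by rewrite filter_uniq ?types_uniq.
  - by have [H1 H2 H3 H4] := lead2 r4 sT; rewrite mem_filter /= H1 H2 H3.
  by rewrite mem_filter /= => /andP[/andP[P C] sT]; apply: unlead2 sT P C.
have := @pivot_crit1 q r r4; move: (types 1 k) => T; rewrite !size_filter.
elim: T => //= s l IH H.
rewrite IH => [|t tl]; last by apply: H; rewrite inE tl orbT.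
by have := H s (mem_head _ _); case: (pivot r s); case: (crit1 r s) => //= H'; lia.
Qed.

Lemma size_types0 : size (types 0 k) =
  (size (filter (pivot r) (types 1 k)) + size (filter (crit0 r) (types 0 k)))%N.
Proof.
have -> : size (filter (pivot r) (types 1 k)) = size (filter (predC (crit0 r)) (types 0 k)).
  apply: (size_bij (f := lead ((r == 1%N) || (r == 2%N))) (g := unlead ((r == 1%N) || (r == 2%N)))).
  - by rewrite filter_uniq ?types_uniq.
  - by rewrite filter_uniq ?types_uniq.
  - move=> s; rewrite mem_filter => /andP[P sT]; have [H1 H2 H3] := lead1 r4 sT P.
    by rewrite mem_filter /= H1 H2.
  move=> s; rewrite mem_filter => /andP[P sT]; have [H1 H2 H3] := unlead1 r4 sT P.
  by rewrite mem_filter /= H1 H2.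
by move: (types 0 k) => T; rewrite !size_filter addnC count_predC.
Qed.

Lemma rank_bmx1 : \rank (bmx 1 k) = size (types 2 k).
Proof.
apply/eqP; rewrite eqn_leq rank_leq_row.
apply: (@rank_lead _ _ false) => // [|s sT]; first exact: types_uniq.
by have [] := lead2 r4 sT.
Qed.

Lemma crit0_nil : (r < 2)%N -> filter (crit0 r) (types 0 k) = [::].
Proof.
move=> r2; rewrite -(filter_pred0 (types 0 k)); apply: eq_filter => s.
by rewrite /crit0 /triples; case: s => [|x [|y [|z []]]] //; case: r r2 => [|[]].
Qed.

Lemma crit1_nil : (1 < r)%N -> filter (crit1 r) (types 1 k) = [::].
Proof.
move=> r2; rewrite -(filter_pred0 (types 1 k)); apply: eq_filter => s.
by rewrite /crit1 /triples; case: s => [|x [|y [|z []]]] //; case: r r2 => [|[]].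
Qed.

(** The pivots give the lower bound. For r < 2 they are as many as the types of defect 0, so the map
    is onto. For r > 1 there are no unmatched types of defect 1, and the vanishing of the composite
    bounds the rank by the number of types of defect 1 minus that of defect 2, which is the number
    of pivots. *)
Lemma rank_bmx0 m N : (0 < N)%N -> ~~ odd N -> odd m -> (0 < k)%N ->
  \rank (bmx 0 k) = size (filter (pivot r) (types 1 k)).
Proof.
move=> N0 Ne mo k0; apply/eqP; rewrite eqn_leq; apply/andP; split; last first.
  apply: (@rank_lead _ _ ((r == 1%N) || (r == 2%N))) => // [|s].
    by rewrite filter_uniq ?types_uniq.
  by rewrite mem_filter => /andP[P sT]; have [] := lead1 r4 sT P.
case: (ltnP 1 r) => r1; last first.
  by apply: leq_trans (rank_leq_col _) _; rewrite {1}size_types0 crit0_nil // addn0.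
have := mulmx0_rank_max (bmx_mul N0 Ne mo k0).
move/leq_trans => /(_ _ (eq_leq size_types1)).
by rewrite rank_bmx1 crit1_nil // addn0 leq_add2l.
Qed.

Lemma size_crit (p : pred (seq nat)) (T : seq (seq nat)) (f : nat -> seq nat) (g : seq nat -> nat)
    (a n : nat) : uniq T ->
  {in T, forall s, p s -> (a <= g s < a + n)%N /\ f (g s) = s} ->
  (forall j, (a <= j < a + n)%N -> [/\ f j \in T, p (f j) & g (f j) = j]) ->
  size (filter p T) = n.
Proof.
move=> U H H'; rewrite -(size_iota a n); apply: (size_bij (f := g) (g := f)).
- exact: filter_uniq.
- exact: iota_uniq.
- by move=> s; rewrite mem_filter mem_iota => /andP[ps sT]; have [] := H s sT ps.
by move=> j; rewrite mem_filter mem_iota => /H'[-> -> ->].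
Qed.

End Dimensions.

(** * The number of unmatched triples *)

(** The triple is (2 j + 2, 2 j + 1, z) with z = k - 4 j. Positivity of z means j <= q; as z and 2 j
    + 1 are odd and distinct, z <= 2 j - 1, that is, 6 j >= k + 1. *)
Lemma size_crit0_3 q : let k := (4 * q + 3)%N in
  size (filter (crit0 3) (types 0 k)) = ((k + 1) %/ 12)%N.
Proof.
move=> k; apply: (@size_crit _ _ (fun j => [:: j.*2.+2; j.*2.+1; k - 4 * j]%N)
  (fun s => (head 0%N s)./2.-1) ((k + 6) %/ 6)); first exact: types_uniq.
  move=> s sT; have [x [y [z [E _ _ _ _]]]] := typesP sT; move: sT; rewrite {s}E.
  rewrite mem_types_mod /crit0 /triples /= => sT P; split; first by lia.
  by congr [:: _; _; _]; lia.
move=> j J; rewrite mem_types_mod /crit0 /triples /=; split; lia.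
Qed.

(** Now z = k - 4 j is even, so z <= 2 j, or z = 2 j + 2 in the exceptional triple, which has to be
    sorted. Together this means 6 j >= k - 2, with j <= q as before. *)
Lemma size_crit0_2 q : let k := (4 * q + 2)%N in
  size (filter (crit0 2) (types 0 k)) = ceil_div k 12.
Proof.
move=> k; rewrite /ceil_div; apply: (@size_crit _ _
  (fun j => if (k - 4 * j == j.*2.+2)%N then [:: j.*2.+2; j.*2.+2; j.*2.+1]
            else [:: j.*2.+2; j.*2.+1; k - 4 * j]%N)
  (fun s => (head 0%N s)./2.-1) ((k + 3) %/ 6)); first exact: types_uniq.
  move=> s sT; have [x [y [z [E _ _ _ _]]]] := typesP sT; move: sT; rewrite {s}E.
  rewrite mem_types_mod /crit0 /triples /= => sT P; split; first by lia.
  by case: ifP => C; congr [:: _; _; _]; lia.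
move=> j J; case: ifP => C; rewrite mem_types_mod /crit0 /triples /=; split; lia.
Qed.

(** The condition z + 3 <= 2 j for z = k + 2 - 4 j reads 6 j >= k + 5, and positivity of z reads j
    <= q. *)
Lemma size_crit1_1 q : let k := (4 * q + 1)%N in
  size (filter (crit1 1) (types 1 k)) = (k %/ 12)%N.
Proof.
move=> k; apply: (@size_crit _ _ (fun j => [:: j.*2; j.*2; k + 2 - 4 * j]%N)
  (fun s => (head 0%N s)./2) ((k + 10) %/ 6)); first exact: types_uniq.
  move=> s sT; have [x [y [z [E _ _ _ _]]]] := typesP sT; move: sT; rewrite {s}E.
  rewrite mem_types_mod /crit1 /triples /= => sT P; split; first by lia.
  by congr [:: _; _; _]; lia.
move=> j J; rewrite mem_types_mod /crit1 /triples /=; split; lia.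
Qed.

(** Here z = k + 2 - 4 j is even and may equal 2 j, so sortedness reads 6 j >= k + 2, and positivity
    of z again j <= q. *)
Lemma size_crit1_0 q : let k := (4 * q + 0)%N in
  size (filter (crit1 0) (types 1 k)) = ceil_div k 12.
Proof.
move=> k; rewrite /ceil_div; apply: (@size_crit _ _ (fun j => [:: j.*2; j.*2; k + 2 - 4 * j]%N)
  (fun s => (head 0%N s)./2) ((k + 7) %/ 6)); first exact: types_uniq.
  move=> s sT; have [x [y [z [E _ _ _ _]]]] := typesP sT; move: sT; rewrite {s}E.
  rewrite mem_types_mod /crit1 /triples /= => sT P; split; first by lia.
  by congr [:: _; _; _]; lia.
move=> j J; rewrite mem_types_mod /crit1 /triples /=; split; lia.
Qed.

Local Close Scope ring_scope.

Theorem theorem6p4 (m N : nat) (m_gt0 : 0 < m) (N_gt0 : 0 < N)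
    (N_even : ~~ odd N) (m_odd : odd m) (k : nat) (k_gt0 : 0 < k) :
  hairy_homology_dim m N 0 k
    (match k %% 4 with
     | 3 => (k + 1) %/ 12
     | 2 => ceil_div k 12
     | _ => 0
     end)
  /\
  hairy_homology_dim m N 1 k
    (match k %% 4 with
     | 1 => k %/ 12
     | 0 => ceil_div k 12
     | _ => 0
     end).
Proof.
have r4 : k %% 4 < 4 by rewrite ltn_mod.
have kE : k = 4 * (k %/ 4) + k %% 4 by rewrite mulnC -divn_eq.
move: (k %/ 4) (k %% 4) r4 kE => q r r4 kE; subst k.
have := homology1 N_gt0 N_even m_odd k_gt0; have := homology0 N_gt0 N_even m_odd k_gt0.
have rk0 := rank_bmx0 r4 N_gt0 N_even m_odd k_gt0; have rk1 := rank_bmx1 q r4.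
have -> : size (types 0 (4 * q + r)) - \rank (bmx 0 (4 * q + r)) =
    size (filter (crit0 r) (types 0 (4 * q + r))).
  by rewrite rk0; have := size_types0 q r4; lia.
have -> : size (types 1 (4 * q + r)) - \rank (bmx 0 (4 * q + r)) - \rank (bmx 1 (4 * q + r)) =
    size (filter (crit1 r) (types 1 (4 * q + r))).
  by rewrite rk0 rk1; have := size_types1 q r4; lia.
case: r r4 k_gt0 {rk0 rk1} => [|[|[|[|]]]] // _ k_gt0.
- by rewrite crit0_nil // size_crit1_0.
- by rewrite crit0_nil // size_crit1_1.
- by rewrite size_crit0_2 crit1_nil.
by rewrite size_crit0_3 crit1_nil.
Qed.
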